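(* Let $d\ge 1$, let $\Omega\subseteq\mathbb{R}^d$ be a non-empty open connected set (bounded or unbounded), and let $a,b:\Omega\to\mathbb{R}$ be measurable with $a\in L^\infty(\Omega)$, $b\in L^\infty_{\mathrm{loc}}(\Omega)$ and $b_{\min}:=\operatorname{ess\,inf} b>-\infty$. If $a_{\min}:=\operatorname{ess\,inf} a<0$, then there exists $\alpha_0>0$ such that for all $\alpha>\alpha_0$ the system $$\psi_{tt}+\alpha\,a\,\psi_t+S_0\psi=0,\qquad \psi(0,\cdot)=\phi_1\in D(S_0),\qquad \psi_t(0,\cdot)=\phi_2\in D(s_0),$$ is unstable, i.e. there exist initial data $\phi_1\in D(S_0)$, $\phi_2\in D(s_0)$ for which the corresponding solution is unbounded: $\sup_{t\ge 0}\big(\|\psi(t,\cdot)\|_{s_0}^2+\|\psi_t(t,\cdot)\|^2\big)=\infty$.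
   Context: $(\cdot,\cdot)$ and $\|\cdot\|$ denote the inner product and norm of the complex Hilbert space $L^2(\Omega)$. $D(s_0)$ is the closure of $C_0^\infty(\Omega)$ in the norm $\|\psi\|_{s_0}^2:=\|\psi\|_{H^1(\Omega)}^2+\|(b-b_{\min})^{1/2}\psi\|^2$, where $\|\psi\|_{H^1(\Omega)}^2=\|\nabla\psi\|^2+\|\psi\|^2$, and $s_0(\phi,\psi):=(\nabla\phi,\nabla\psi)+(\phi,b\psi)$ for $\phi,\psi\in D(s_0)$. $S_0$ is the self-adjoint operator on $L^2(\Omega)$ associated with the closed, symmetric, lower-bounded form $s_0$ (the Dirichlet realization of $-\Delta+b$); $S_0\psi=(-\Delta+b)\psi$ with $D(S_0)=\{\psi\in D(s_0): (-\Delta+b)\psi\in L^2(\Omega)\}$. A solution is a function $t\mapsto\psi(t,\cdot)\in C^0([0,\infty);D(S_0))\cap C^1([0,\infty);D(s_0))\cap C^2([0,\infty);L^2(\Omega))$ satisfying the initial value problem ($D(S_0)$ carries the graph norm, $D(s_0)$ the norm $\|\cdot\|_{s_0}$); under the stated assumptions on $a,b$ it exists and is unique for each pair of initial data. *)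

(* Defs.v *)
From HB Require Import structures.
From mathcomp Require Import all_boot all_order all_algebra.
From mathcomp Require Import all_classical all_reals all_analysis.
From mathcomp Require Import ess_sup_inf complex.

Set Implicit Arguments.
Unset Strict Implicit.
Unset Printing Implicit Defensive.
Import Order.TTheory GRing.Theory Num.Theory.
Import numFieldNormedType.Exports.

Local Open Scope classical_set_scope.
Local Open Scope ring_scope.

(* The product sigma-algebra on row vectors, generated by the coordinates. *)
Section rV_measurable.
Variables (R : realType) (n : nat).

Let coord : 'I_n -> 'rV[R]_n -> measurableTypeR R := fun i x => x ord0 i.

Let rV_set0 : g_sigma_preimage coord set0.
Proof. exact: sigma_algebra0. Qed.

Let rV_setC A : g_sigma_preimage coord A -> g_sigma_preimage coord (~` A).
Proof. exact: sigma_algebraC. Qed.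

Let rV_bigcup (F : _^nat) : (forall i, g_sigma_preimage coord (F i)) ->
  g_sigma_preimage coord (\bigcup_i (F i)).
Proof. exact: sigma_algebra_bigcup. Qed.

HB.instance Definition _ := @isMeasurable.Build default_measure_display
  'rV[R]_n (g_sigma_preimage coord) rV_set0 rV_setC rV_bigcup.

Lemma measurable_coord i : measurable_fun [set: 'rV[R]_n] (coord i).
Proof.
move=> _ Y mY; rewrite setTI; apply: sub_sigma_algebra => /=.
rewrite -bigcup_seq/=; exists i => /=; first by rewrite mem_index_enum.
by exists Y => //; rewrite setTI.
Qed.

Lemma measurable_fun_rV d (T : measurableType d) (f : T -> 'rV[R]_n) :
  (forall i, measurable_fun [set: T] (coord i \o f)) ->
  measurable_fun [set: T] f.
Proof.
move=> mf; apply: (@measurability _ _ _ _ _ _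
  (\big[setU/set0]_(i < n) preimage_set_system setT (coord i) measurable)) => //.
move=> _ [B + <-]; rewrite -bigcup_seq => -[i _ [A mA <-]].
by rewrite setTI -comp_preimage; exact: mf.
Qed.

End rV_measurable.


Section lebesgue_step.
Variables (R : realType) (n : nat).

Definition cons_rV (p : measurableTypeR R * 'rV[R]_n) : 'rV[R]_n.+1 :=
  row_mx (const_mx p.1 : 'rV_1) p.2.

Lemma cons_rV0 p : cons_rV p ord0 ord0 = p.1.
Proof.
rewrite /cons_rV mxE; case: splitP => [j _|j /= /eqP]; first by rewrite mxE.
by rewrite eqn_leq ltn0.
Qed.

Lemma cons_rVS p (i : 'I_n) : cons_rV p ord0 (lift ord0 i) = p.2 ord0 i.
Proof.
have -> : lift ord0 i = rshift 1 i :> 'I_n.+1 by exact/val_inj.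
exact: (@row_mxEr _ _ 1 n).
Qed.

Lemma measurable_cons_rV : measurable_fun setT cons_rV.
Proof.
apply: measurable_fun_rV => i; have [j ->|->] := unliftP ord0 i.
  rewrite (_ : _ \o _ = (fun x : 'rV[R]_n => x ord0 j : measurableTypeR R) \o snd);
    last by apply/funext => p /=; rewrite cons_rVS.
  by apply: measurableT_comp => //; exact: measurable_coord.
by rewrite (_ : _ \o _ = fst)//; apply/funext => p /=; rewrite cons_rV0.
Qed.

Variable mu : {sigma_finite_measure set 'rV[R]_n -> \bar R}.

Definition lebesgue_step : set 'rV[R]_n.+1 -> \bar R :=
  pushforward (lebesgue_measure \x mu)%E cons_rV.

Let step0 : lebesgue_step set0 = 0%E.
Proof. by rewrite /lebesgue_step /pushforward preimage_set0 measure0. Qed.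

Let step_ge0 A : (0 <= lebesgue_step A)%E.
Proof. by rewrite /lebesgue_step /pushforward measure_ge0. Qed.

Let step_preimage A : measurable A -> measurable (cons_rV @^-1` A).
Proof. by move=> mA; rewrite -[X in measurable X]setTI; exact: measurable_cons_rV. Qed.

Let step_sigma_additive : semi_sigma_additive lebesgue_step.
Proof.
move=> F mF tF mUF; rewrite /lebesgue_step /pushforward preimage_bigcup.
apply: measure_semi_sigma_additive.
- by move=> k; exact: step_preimage.
- apply/trivIsetP => /= i j _ _ ij; rewrite -preimage_setI.
  by move/trivIsetP : tF => /(_ _ _ _ _ ij) ->//; rewrite preimage_set0.
- by rewrite -preimage_bigcup; exact: step_preimage.
Qed.

HB.instance Definition _ := isMeasure.Build _ _ _ lebesgue_step
  step0 step_ge0 step_sigma_additive.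

Lemma lebesgue_step_box (A : set (measurableTypeR R)) (B : set 'rV[R]_n) :
  measurable A -> measurable B ->
  lebesgue_step [set x | A (x ord0 ord0) /\ B (\row_i x ord0 (lift ord0 i))] =
  (lebesgue_measure A * mu B)%E.
Proof.
move=> mA mB; rewrite -product_measure1E//= /lebesgue_step /pushforward.
congr ((_ \x _)%E _); apply/seteqP; split => p /=; rewrite cons_rV0;
  (rewrite (_ : (\row_i _) = p.2)//; apply/rowP => i; by rewrite mxE cons_rVS).
Qed.

Let tail_rV (x : 'rV[R]_n.+1) : 'rV[R]_n := \row_i x ord0 (lift ord0 i).

Let measurable_tail_rV : measurable_fun setT tail_rV.
Proof.
apply: measurable_fun_rV => i.
rewrite (_ : _ \o _ =
    fun x : 'rV[R]_n.+1 => x ord0 (lift ord0 i) : measurableTypeR R).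
  exact: measurable_coord.
by apply/funext => x /=; rewrite mxE.
Qed.

Let step_sigma_finite : sigma_finite setT lebesgue_step.
Proof.
have /sigma_finiteP[F [TF ndF Foo]] := sigma_finiteT (@lebesgue_measure R).
have /sigma_finiteP[G [TG ndG Goo]] := sigma_finiteT mu.
exists (fun k => [set x : 'rV[R]_n.+1 | F k (x ord0 ord0) /\ G k (tail_rV x)]).
  apply/seteqP; split => // x _.
  have [k _ Fk] : (\bigcup_k F k) (x ord0 ord0) by rewrite -TF.
  have [l _ Gl] : (\bigcup_k G k) (tail_rV x) by rewrite -TG.
  exists (maxn k l) => //; split.
  - by move: Fk; exact/subsetPset/ndF/leq_maxl.
  - by move: Gl; exact/subsetPset/ndG/leq_maxr.
move=> k; have [mF Fk] := Foo k; have [mG Gk] := Goo k; split.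
  apply: measurableI.
    by rewrite -[X in measurable X]setTI; exact: (measurable_coord ord0).
  by rewrite -[X in measurable X]setTI; exact: measurable_tail_rV.
by rewrite lebesgue_step_box// lte_mul_pinfty// ge0_fin_numE.
Qed.

HB.instance Definition _ := Measure_isSigmaFinite.Build _ _ _ lebesgue_step
  step_sigma_finite.

End lebesgue_step.

Fixpoint borel_lebesgue (R : realType) n :
    {sigma_finite_measure set 'rV[R]_n -> \bar R} :=
  match n with
  | 0 => \d_ (0 : 'rV[R]_0)
  | m.+1 => lebesgue_step (borel_lebesgue R m)
  end.

Lemma borel_lebesgue_box (R : realType) n (A : 'I_n -> set (measurableTypeR R)) :
  (forall i, measurable (A i)) ->
  borel_lebesgue R n [set x | forall i, A i (x ord0 i)] =
  (\prod_(i < n) lebesgue_measure (A i))%E.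
Proof.
elim: n A => [|n IH] A mA.
  rewrite big_ord0 /= diracE mem_set//.
  by move=> -[].
rewrite big_ord_recl -(IH (fun i => A (lift ord0 i)))//.
pose B := [set x : 'rV[R]_n | forall i, A (lift ord0 i) (x ord0 i)].
have mB : measurable B.
  rewrite (_ : B =
    \big[setI/setT]_(i < n) [set x : 'rV[R]_n | A (lift ord0 i) (x ord0 i)]).
    apply: bigsetI_measurable => i _.
    by rewrite -[X in measurable X]setTI; exact: (measurable_coord i).
  rewrite -bigcap_seq; apply/seteqP; split => x /= h i; first by move=> _; exact: h.
  by apply: h => /=; rewrite mem_index_enum.
rewrite -/B -lebesgue_step_box//=.
congr lebesgue_step; apply/seteqP; split => x /=.
  by move=> h; split => [//|i]; rewrite mxE; exact: h.
move=> [h0 h] i; have [k ->|->//] := unliftP ord0 i.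
by have := h k; rewrite mxE.
Qed.

(* The measurable sets of this copy of ['rV[R]_n] are the Lebesgue sets. *)
Definition lebesgue_space (R : realType) n :=
  caratheodory_type (borel_lebesgue R n)^*%mu.

Definition lebesgue (R : realType) n : {measure set lebesgue_space R n -> \bar R} :=
  @completed_measure_extension _ _ _ (borel_lebesgue R n).

Lemma lebesgueE (R : realType) n (A : set 'rV[R]_n) :
  measurable A -> lebesgue R n A = borel_lebesgue R n A.
Proof. exact: measurable_mu_extE. Qed.

Section test_functions.
Variables (R : realType) (n : nat).

Definition partial (j : 'I_n) (f : 'rV[R]_n -> R) : 'rV[R]_n -> R :=
  'D_(delta_mx ord0 j) f.

Definition smooth (f : 'rV[R]_n -> R) := forall s : seq 'I_n,
  continuous (foldr partial f s) /\
  forall x j, derivable (foldr partial f s) x (delta_mx ord0 j).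

Definition cpartial (j : 'I_n) (u : 'rV[R]_n -> R[i]) : 'rV[R]_n -> R[i] :=
  fun x => (partial j (fun y => complex.Re (u y)) x
            +i* partial j (fun y => complex.Im (u y)) x)%C.

(* [C_0^oo(Omega)], extended by zero to the whole space *)
Definition Cc_smooth (Omega : set 'rV[R]_n) : set ('rV[R]_n -> R[i]) :=
  [set u | [/\ smooth (fun x => complex.Re (u x)),
               smooth (fun x => complex.Im (u x)) &
               exists K, [/\ compact K, K `<=` Omega &
                             forall x, ~ K x -> u x = 0]]].

End test_functions.

(* Elements of [L^2(Omega)] are represented by functions on the whole space,
   of which only the values almost everywhere on [Omega] matter; [L2norm],
   [H1norm] and so on are therefore seminorms. *)
Section L2.
Variables (R : realType) (n : nat) (Omega : set 'rV[R]_n).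
Local Notation E := 'rV[R]_n.
Local Notation mu := (lebesgue R n).

Definition ae_on (P : E -> Prop) := {ae mu, forall x, Omega x -> P x}.

Definition ess_inf_on (f : E -> R) : \bar R :=
  ess_inf mu (fun x => if x \in Omega then (f x)%:E else +oo%E).

Definition ess_sup_on (D : set E) (f : E -> R) : \bar R :=
  ess_sup mu (fun x => if x \in D then (f x)%:E else -oo%E).

Definition Lmeasurable (f : E -> R) :=
  measurable_fun (Omega : set (lebesgue_space R n))
    (f : lebesgue_space R n -> measurableTypeR R).

Definition Linfty (f : E -> R) :=
  Lmeasurable f /\ (ess_sup_on Omega (fun x => `|f x|%R) < +oo)%E.

Definition Linfty_loc (f : E -> R) := Lmeasurable f /\
  forall K, compact K -> K `<=` Omega -> (ess_sup_on K (fun x => `|f x|%R) < +oo)%E.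

Definition sqmod (z : R[i]) : R := complex.Re z ^+ 2 + complex.Im z ^+ 2.

Definition L2 : set (E -> R[i]) := [set u |
  [/\ Lmeasurable (fun x => complex.Re (u x)),
      Lmeasurable (fun x => complex.Im (u x)) &
      (\int[mu]_(x in Omega) (sqmod (u x))%:E < +oo)%E]].

Definition cintegral (f : E -> R[i]) : R[i] :=
  ((\int[mu]_(x in Omega) complex.Re (f x))
   +i* (\int[mu]_(x in Omega) complex.Im (f x)))%C.

Definition L2inner (u v : E -> R[i]) : R[i] :=
  cintegral (fun x => (u x)^*%C * v x).

Definition L2norm (u : E -> R[i]) : R :=
  Num.sqrt (\int[mu]_(x in Omega) sqmod (u x)).

Definition is_weak_partial (j : 'I_n) (u v : E -> R[i]) :=
  forall phi, Cc_smooth Omega phi ->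
    cintegral (fun x => u x * cpartial j phi x) =
    - cintegral (fun x => v x * phi x).

Definition H1 : set (E -> R[i]) := [set u |
  L2 u /\ forall j, exists2 v, L2 v & is_weak_partial j u v].

(* a representative of the j-th weak derivative, which is unique a.e. *)
Definition weak_partial (j : 'I_n) (u : E -> R[i]) : E -> R[i] :=
  xget (fun=> 0) [set v | L2 v /\ is_weak_partial j u v].

Definition H1norm (u : E -> R[i]) : R :=
  Num.sqrt (\sum_(j < n) L2norm (weak_partial j u) ^+ 2 + L2norm u ^+ 2).

End L2.

Section operator.
Variables (R : realType) (n : nat) (Omega : set 'rV[R]_n) (b : 'rV[R]_n -> R).
Local Notation E := 'rV[R]_n.

Definition bmin : R := fine (ess_inf_on Omega b).

Definition weighted (u : E -> R[i]) : E -> R[i] :=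
  fun x => (Num.sqrt (b x - bmin))%:C%C * u x.

Definition s0norm (u : E -> R[i]) : R :=
  Num.sqrt (H1norm Omega u ^+ 2 + L2norm Omega (weighted u) ^+ 2).

Definition dom_s0 : set (E -> R[i]) := [set u |
  [/\ H1 Omega u, L2 Omega (weighted u) &
      forall e : R, 0 < e ->
        exists2 phi, Cc_smooth Omega phi & s0norm (u \- phi) < e]].

Definition s0 (phi psi : E -> R[i]) : R[i] :=
  \sum_(j < n) L2inner Omega (weak_partial Omega j phi) (weak_partial Omega j psi)
  + L2inner Omega phi (fun x => (b x)%:C%C * psi x).

(* [f] represents the vector [S0 psi] of the operator associated with [s0]. *)
Definition is_S0 (psi f : E -> R[i]) :=
  L2 Omega f /\ forall phi, dom_s0 phi -> s0 phi psi = L2inner Omega phi f.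

Definition dom_S0 : set (E -> R[i]) := [set psi |
  dom_s0 psi /\ exists f, is_S0 psi f].

Definition S0 (psi : E -> R[i]) : E -> R[i] := xget (fun=> 0) (is_S0 psi).

Definition S0norm (psi : E -> R[i]) : R :=
  Num.sqrt (L2norm Omega psi ^+ 2 + L2norm Omega (S0 psi) ^+ 2).

End operator.

(* Curves [0, +oo) -> X, where X is the set of functions [D] with seminorm [N]. *)
Section curves.
Variables (R : realType) (T : Type) (D : set (T -> R[i])) (N : (T -> R[i]) -> R).
Implicit Types u v : R -> T -> R[i].

Definition C0_curve u :=
  (forall t, 0 <= t -> D (u t)) /\
  forall t0, 0 <= t0 ->
    N (u t \- u t0) @[t --> within [set t | 0 <= t] (nbhs t0)] --> (0 : R).

(* one-sided at [t0 = 0] *)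
Definition is_curve_derivative u v := forall t0, 0 <= t0 ->
  N (fun x => (t - t0)^-1%:C%C * (u t x - u t0 x) - v t0 x)
    @[t --> within [set t | 0 <= t] t0^'] --> (0 : R).

Definition C1_curve u v :=
  [/\ C0_curve u, C0_curve v & is_curve_derivative u v].

End curves.

Section evolution.
Variables (R : realType) (n : nat) (Omega : set 'rV[R]_n) (a b : 'rV[R]_n -> R).
Local Notation E := 'rV[R]_n.

(* [psit] is the time derivative of the solution [psi]. *)
Definition solution (alpha : R) (phi1 phi2 : E -> R[i]) (psi psit : R -> E -> R[i]) :=
  C0_curve (dom_S0 Omega b) (S0norm Omega b) psi /\
  C1_curve (dom_s0 Omega b) (s0norm Omega b) psi psit /\
  exists psitt,
    [/\ C1_curve (L2 Omega) (L2norm Omega) psi psit,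
        C1_curve (L2 Omega) (L2norm Omega) psit psitt,
        forall t, 0 <= t -> ae_on Omega (fun x =>
          psitt t x + (alpha * a x)%:C%C * psit t x + S0 Omega b (psi t) x = 0),
        ae_on Omega (fun x => psi 0 x = phi1 x) &
        ae_on Omega (fun x => psit 0 x = phi2 x)].

Definition energy (psi psit : R -> E -> R[i]) (t : R) : R :=
  s0norm Omega b (psi t) ^+ 2 + L2norm Omega (psit t) ^+ 2.

End evolution.

(* Main.v *)
(* Put [m := - ess inf a] and [lam := alpha m / 2].  The wave equation is
   the first-order system [(w, v)' = (v, - alpha a v - S0 w)], and along it the
   quadratic form [Q(w, v) = |v - lam w|^2 + s0(w, w) + lam^2 |w|^2
   + alpha lam (a w, w)] satisfies [Q' = 2 lam Q - 2 ((alpha a + 2 lam) z, z)]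
   with [z = v - lam w].  Since [alpha a + 2 lam >= 0] almost everywhere,
   [Q' <= 2 lam Q]: once negative, [Q] tends to [- oo], and the energy is
   unbounded because [Q] is dominated by it.  On the data [(phi, lam phi)] the
   form is [alpha^2 (m / 2) ((a + m / 2) phi, phi) + s0(phi, phi)]; as [a + m / 2]
   is negative on a set of positive measure, some test function [phi] makes the
   first term negative, and [alpha] large makes the sum negative.

   The solution is the limit of implicit Euler steps of size [h, h/2, h/4, ...]:
   the generator is dissipative up to a constant in the energy norm, and its
   resolvent equation is solved by the Riesz representation.  Smooth initial data
   are obtained by applying resolvents to [(phi, lam phi)], which perturbs [Q]
   arbitrarily little.  All of this takes place in spaces of real-valued
   functions; the solution is real. *)
From HB Require Import structures.
Require Import Defs.
From mathcomp Require Import all_boot all_order all_algebra.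
From mathcomp Require Import all_classical all_reals all_analysis.
From mathcomp Require Import ess_sup_inf measurable_realfun complex ring lra.
Set Implicit Arguments.
Unset Strict Implicit.
Unset Printing Implicit Defensive.
Import Order.TTheory GRing.Theory Num.Theory.
Import numFieldNormedType.Exports.
Local Open Scope classical_set_scope.
Local Open Scope ring_scope.

(** * Seminormed spaces and the Riesz representation *)

(** For unbounded [Omega] the operator [S0] may have no eigenvalues, so instability cannot be read
    off an eigenfunction expansion; a quadratic form of which only the sign matters takes its place.
    The value [lam = alpha m / 2] is the least one with [alpha a + 2 lam >= 0] almost everywhere,
    and [lam^2 + alpha lam a = alpha^2 (m / 2) (a + m / 2)] is quadratic in [alpha], against a fixed
    [s0(phi, phi)]. Vectors are functions known only almost everywhere, so norms are seminorms,
    limits are not unique and the generator is a relation [A x y]. Completeness is used for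
    sequences with geometric increments, which step halving produces with an explicit rate.
    Comparing two steps of size [h / 2] with one of size [h] costs two applications of [A]; the
    velocity [A x] must converge too, hence data in the domain of the cube of [A]. Approximation by
    test functions comes from a sigma-algebra argument with explicit cutoffs instead of
    mollification, and integration by parts from translation invariance. *)

Section seminorm.
Context (R : realType) (V : lmodType R).

Record seminorm (N : V -> R) : Prop := Seminorm {
  seminormD : forall u v, N (u + v) <= N u + N v;
  seminormZ : forall c u, N (c *: u) = `|c| * N u }.

(** Completeness restricted to sequences with geometric increments, the only ones that the
    constructions below produce. The limit comes with a rate and need not be unique, since [N] may
    vanish on nonzero vectors. *)
Definition geo_complete (N : V -> R) := forall (u : nat -> V) C,
  (forall k, N (u k.+1 - u k) <= C / 2 ^+ k) ->
  exists w, forall k, N (w - u k) <= 2 * C / 2 ^+ k.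

Variable N : V -> R.
Hypothesis hN : seminorm N.

Lemma seminorm0 : N 0 = 0.
Proof. by rewrite -(scale0r 0) (seminormZ hN) normr0 mul0r. Qed.

Lemma seminormN u : N (- u) = N u.
Proof. by rewrite -scaleN1r (seminormZ hN) normrN1 mul1r. Qed.

Lemma seminorm_ge0 u : 0 <= N u.
Proof.
have := seminormD hN u (- u).
by rewrite subrr seminorm0 seminormN -mulr2n pmulrn_lge0.
Qed.

Lemma seminormB u v : N (u - v) <= N u + N v.
Proof. by rewrite -(seminormN v); exact: seminormD. Qed.

Lemma seminorm_distC u v : N (u - v) = N (v - u).
Proof. by rewrite -opprB seminormN. Qed.

Lemma seminorm_tri v u w : N (u - w) <= N (u - v) + N (v - w).
Proof. by rewrite -[u - w](subrKA v); exact: seminormD. Qed.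

Lemma seminorm_le v u : N u <= N v + N (u - v).
Proof. by rewrite -{1}(subrK v u) addrC; exact: seminormD. Qed.

End seminorm.

Section geometric.
Context (R : realType).
Implicit Types (x y C : R).

(** Passage to the limit [k -> oo] in an inequality with a geometric error, whatever the sign of
    [C]. *)
Lemma ler_geo x y C : (forall k, x <= y + C / 2 ^+ k) -> x <= y.
Proof.
move=> h; apply/ler_addgt0Pr => e e0.
pose n := Num.truncn (`|C| / e).
apply: (le_trans (h n)); rewrite lerD2l ler_pdivrMr ?exprn_gt0//.
apply: (le_trans (ler_norm C)).
have : `|C| / e < n.+1%:R by exact: truncnS_gt.
rewrite ltr_pdivrMr// => /ltW/le_trans; apply.
rewrite mulrC ler_pM2l//.
by rewrite -natrX ler_nat ltn_expl.
Qed.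

Lemma geo_small C e : 0 < e -> exists k : nat, C / 2 ^+ k < e.
Proof.
move=> e0; apply/not_existsP => h.
have : e <= 0; last by rewrite leNgt e0.
apply: (@ler_geo _ _ C) => k; rewrite add0r leNgt; apply/negP; exact: h.
Qed.

End geometric.

Section semi_ip.
Context (R : realType) (V : lmodType R).

Record semi_ip (ip : V -> V -> R) : Prop := SemiIp {
  ipC : forall u v, ip u v = ip v u;
  ipDl : forall u v w, ip (u + v) w = ip u w + ip v w;
  ipZl : forall c u v, ip (c *: u) v = c * ip u v;
  ip_ge0 : forall u, 0 <= ip u u }.

Definition ipnorm (ip : V -> V -> R) u := Num.sqrt (ip u u).

Variable ip : V -> V -> R.
Hypothesis hip : semi_ip ip.

Lemma ipDr u v w : ip w (u + v) = ip w u + ip w v.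
Proof. by rewrite (ipC hip) (ipDl hip) !(ipC hip w). Qed.

Lemma ipZr c u v : ip u (c *: v) = c * ip u v.
Proof. by rewrite (ipC hip) (ipZl hip) (ipC hip u). Qed.

Lemma ipNl u v : ip (- u) v = - ip u v.
Proof. by rewrite -scaleN1r (ipZl hip) mulN1r. Qed.

Lemma ipNr u v : ip u (- v) = - ip u v.
Proof. by rewrite -scaleN1r ipZr mulN1r. Qed.

Definition ipE := (ipDl hip, ipDr, ipNl, ipNr, ipZl hip, ipZr).

(** The discriminant of the nonnegative polynomial [t |-> ip (u + t v) (u + t v)]. When [ip v v = 0]
    it is affine, and that case is treated apart. *)
Lemma ip_CS2 u v : ip u v ^+ 2 <= ip u u * ip v v.
Proof.
have q t : 0 <= ip u u + 2 * t * ip u v + t ^+ 2 * ip v v.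
  have := ip_ge0 hip (u + t *: v); rewrite !ipE (ipC hip v u) => h.
  by apply: (le_trans h); rewrite le_eqVlt; apply/orP; left; apply/eqP; ring.
have u0 := ip_ge0 hip u.
have := ip_ge0 hip v; rewrite le_eqVlt => /predU1P[/esym v0|v0].
  have [->|uv0] := eqVneq (ip u v) 0; first by rewrite expr0n/= v0 mulr0.
  (* At this [t] the affine polynomial would take the value -1. *)
  have := q (- (ip u u + 1) / (2 * ip u v)); rewrite v0 mulr0 addr0.
  rewrite (_ : _ + _ = - 1) ?oppr_ge0 ?ler10//.
  by field; rewrite uv0.
have := q (- ip u v / ip v v).
rewrite (_ : _ + _ = (ip u u * ip v v - ip u v ^+ 2) / ip v v).
  by rewrite pmulr_lge0 ?invr_gt0// subr_ge0.
by field; rewrite gt_eqF.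
Qed.

Lemma sqr_ipnorm u : ipnorm ip u ^+ 2 = ip u u.
Proof. by rewrite sqr_sqrtr// ip_ge0. Qed.

Lemma ipnorm_ge0 u : 0 <= ipnorm ip u.
Proof. exact: sqrtr_ge0. Qed.

Lemma ip_CS u v : `|ip u v| <= ipnorm ip u * ipnorm ip v.
Proof.
rewrite -ler_sqr ?nnegrE ?mulr_ge0 ?ipnorm_ge0//.
by rewrite exprMn !sqr_ipnorm real_normK ?num_real// ip_CS2.
Qed.

Lemma ipnorm_seminorm : seminorm (ipnorm ip).
Proof.
split=> [u v|c u]; last first.
  by rewrite /ipnorm !ipE mulrA -expr2 sqrtrM ?sqr_ge0// sqrtr_sqr.
rewrite -ler_sqr ?nnegrE ?addr_ge0 ?ipnorm_ge0// sqrrD !sqr_ipnorm !ipE.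
rewrite (ipC hip v u).
have := ip_CS u v; have := ler_norm (ip u v); rewrite -mulr_natl; lra.
Qed.

Lemma ipnorm_parallelogram u v :
  ipnorm ip (u - v) ^+ 2 = 2 * ip u u + 2 * ip v v - ip (u + v) (u + v).
Proof. rewrite sqr_ipnorm !ipE (ipC hip v u); ring. Qed.

(* The Riesz representation, by minimizing [J w = (w, w) - 2 l w]. *)
Lemma riesz (l : V -> R) (C : R) :
  geo_complete (ipnorm ip) ->
  (forall u v, l (u + v) = l u + l v) -> (forall c u, l (c *: u) = c * l u) ->
  (forall u, `|l u| <= C * ipnorm ip u) ->
  exists w, forall v, ip w v = l v.
Proof.
move=> cmpl lD lZ lC.
pose J w := ip w w - 2 * l w.
have Jlb w : - C ^+ 2 <= J w.
  have := lC w; have := ler_norm (l w); rewrite /J -sqr_ipnorm.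
  have := sqr_ge0 (ipnorm ip w - C); rewrite !expr2; lra.
pose S := [set J w | w in [set: V]].
have S0 : S !=set0 by exists (J 0), 0.
have hS : has_inf S by split=> //; exists (- C ^+ 2) => _ [w _ <-]; exact: Jlb.
have infS w : inf S <= J w by apply: ge_inf; [case: hS | exists w].
(* Near-minimizers with error [d k]: by the parallelogram law consecutive ones differ by at most
   [1 / 2 ^+ k], as [geo_complete] asks. *)
pose d (k : nat) : R := (2 ^+ k)^-1 ^+ 2 / 4.
have d0 k : 0 < d k by rewrite divr_gt0// exprn_gt0// invr_gt0 exprn_gt0.
have /choice[w hw] k : exists w, J w < inf S + d k.
  by have [_ [w _ <-] h] := inf_adherent (d0 k) hS; exists w.
have par k l0 : ipnorm ip (w k - w l0) ^+ 2 <= 2 * d k + 2 * d l0.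
  have := infS (2^-1 *: (w k + w l0)); have := hw k; have := hw l0.
  rewrite ipnorm_parallelogram /J lZ lD !ipE (ipC hip (w l0)); lra.
have step k : ipnorm ip (w k.+1 - w k) <= 1 / 2 ^+ k.
  rewrite -ler_sqr ?nnegrE ?ipnorm_ge0 ?divr_ge0 ?exprn_ge0//.
  apply: (le_trans (par _ _)); rewrite /d (exprS 2 k) div1r invfM exprMn.
  have := sqr_ge0 ((2 ^+ k)^-1 : R); lra.
have [x hx] := cmpl w 1 step; exists x => v.
(* Near-minimality of [w k] along the line through it in the direction [v]. The limit of this
   inequality is [q] below, and a nonnegative quadratic polynomial without constant term has no
   linear term either. *)
have bnd k t : - d k <= t ^+ 2 * ip v v + 2 * t * (ip (w k) v - l v).
  have := infS (w k + t *: v); have := hw k.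
  rewrite /J lD lZ !ipE (ipC hip v); lra.
pose M := 2 * ipnorm ip v.
have lim k : `|ip (w k) v - ip x v| <= M / 2 ^+ k.
  rewrite -ipNl -(ipDl hip).
  apply: (le_trans (ip_CS _ _)); rewrite (seminorm_distC ipnorm_seminorm).
  rewrite /M (mulrAC 2) ler_wpM2r ?ipnorm_ge0//.
  by have := hx k; rewrite mulr1.
have q t : 0 <= t ^+ 2 * ip v v + 2 * t * (ip x v - l v).
  apply: (@ler_geo _ _ _ (1 + 2 * `|t| * M)) => k.
  have h1 := bnd k t.
  have h2 : 2 * t * (ip (w k) v - ip x v) <= 2 * `|t| * M / 2 ^+ k.
    apply: (le_trans (ler_norm _)); rewrite !normrM normr_nat -!(mulrA (2 * `|t|)).
    by rewrite ler_wpM2l// mulr_ge0.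
  have h3 : d k <= 1 / 2 ^+ k.
    have x0 : 0 <= (2 ^+ k)^-1 :> R by rewrite invr_ge0 exprn_ge0.
    have x1 : (2 ^+ k)^-1 <= 1 :> R by rewrite invf_le1 ?exprn_ege1 ?exprn_gt0// ler1n.
    rewrite div1r /d expr2; nra.
  rewrite mulrDl; lra.
have [v0|v0] := eqVneq (ip v v) 0.
  have := q (- (ip x v - l v)); rewrite v0 mulr0 add0r => h.
  have : (ip x v - l v) ^+ 2 <= 0 by rewrite expr2; lra.
  by rewrite le_eqVlt ltNge sqr_ge0 orbF sqrf_eq0 subr_eq0 => /eqP.
have vp : 0 < ip v v by rewrite lt_neqAle eq_sym v0 ip_ge0.
have := q (- (ip x v - l v) / ip v v).
rewrite (_ : _ + _ = - ((ip x v - l v) ^+ 2 / ip v v)); last by field.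
rewrite oppr_ge0 pmulr_lle0 ?invr_gt0//.
by rewrite le_eqVlt ltNge sqr_ge0 orbF sqrf_eq0 subr_eq0 => /eqP.
Qed.

End semi_ip.

(** * The implicit Euler scheme and quadratic growth *)

Lemma sub_telescope (V : zmodType) (P Q W a b c d : V) :
  P - Q - W = (P - a) + (b - Q) + ((a - b - c) + ((c - d) + (d - W))).
Proof.
rewrite !subrKA !addrA.
rewrite [RHS](ACl (1 * 4 * 7 * (2 * 5) * (3 * 6)))/=.
by rewrite addNr subrr !addr0.
Qed.

Section implicit_euler.
Context (R : realType) (X : lmodType R).
Variables (N : X -> R) (A : X -> X -> Prop) (om h0 : R).
Hypothesis hN : seminorm N.
Hypothesis cmpl : geo_complete N.
Hypothesis AD : forall x y x' y', A x y -> A x' y' -> A (x + x') (y + y').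
Hypothesis AZ : forall c x y, A x y -> A (c *: x) (c *: y).
Hypothesis om0 : 0 <= om.
Hypothesis diss : forall (h : R) x y, 0 <= h -> A x y ->
  (1 - h * om) * N x <= N (x - h *: y).
Hypothesis h0_gt0 : 0 < h0.
Hypothesis range : forall (h : R) f, 0 < h < h0 ->
  exists x y, A x y /\ x - h *: y = f.
Hypothesis closed : forall x y,
  (forall e : R, 0 < e -> exists x' y', [/\ A x' y', N (x - x') < e & N (y - y') < e]) ->
  A x y.

Let AB x y x' y' : A x y -> A x' y' -> A (x - x') (y - y').
Proof. by move=> h h'; rewrite -(scaleN1r x') -(scaleN1r y'); apply: AD => //; exact: AZ. Qed.

(** The vector [x 0] lies in the domain of the cube of the generator; the successive images are
    recorded because [A] is only a relation. Order three is what [S_half] uses at level 1. *)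
Definition chain (x : nat -> X) := forall i, (i < 3)%N -> A (x i) (x i.+1).

(** One implicit Euler step [y = (1 - h A)^-1 x], made at all four levels of the chain at once, with
    the stability bound at each level. *)
Let step_spec h (x y : nat -> X) := [/\ chain y,
  forall i, (i < 3)%N -> y i = x i + h *: y i.+1 &
  forall i, (i <= 3)%N -> (1 - h * om) * N (y i) <= N (x i)].

Let step_ex (h : R) x : 0 < h < h0 -> chain x -> exists y, step_spec h x y.
Proof.
move=> hh cx; have [h_gt0 _] := andP hh.
(* Only the equation at level 2 is solved. The lower levels are then defined by the recurrence and
   form a chain by linearity; solving each level separately would not link the solutions. *)
have [y2 [y3 [A23 E2]]] := range (x 2) hh.
pose y1 := x 1 + h *: y2; pose y0 := x 0 + h *: y1.
have A12 : A y1 y2.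
  have -> : y2 = x 2 + h *: y3 by rewrite -E2 subrK.
  by apply: AD; [exact: cx | exact: AZ].
have A01 : A y0 y1 by apply: AD; [exact: cx | exact: AZ].
exists (fun i => nth 0 [:: y0; y1; y2; y3] i); split.
- by case=> [|[|[|]]].
- by case=> [|[|[|]]]//= _; rewrite -E2 subrK.
have h0' := ltW h_gt0.
case=> [|[|[|[|]]]]//= _.
- by apply: le_trans (diss h0' A01) _; rewrite /y0 addrK.
- by apply: le_trans (diss h0' A12) _; rewrite /y1 addrK.
- by apply: le_trans (diss h0' A23) _; rewrite E2.
(* The last level is a difference quotient, [y3 = (y2 - x 2) / h], hence in the domain as well. *)
have A3 : A y3 (h^-1 *: (y3 - x 3)).
  have := AZ h^-1 (AB A23 (cx 2%N isT)).
  by rewrite -E2 opprB addrCA subrr addr0 scalerA mulVf ?gt_eqF// scale1r.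
apply: le_trans (diss h0' A3) _.
by rewrite scalerA divff ?gt_eqF// scale1r opprB addrCA subrr addr0.
Qed.

Let step_fun : exists st : R -> (nat -> X) -> nat -> X,
  forall (h : R) x, 0 < h < h0 -> chain x -> step_spec h x (st h x).
Proof.
have /choice[st hst] : forall p : R * (nat -> X), exists y,
    0 < p.1 < h0 -> chain p.2 -> step_spec p.1 p.2 y.
  move=> [h x] /=; have [[hh cx]|h1] := pselect (0 < h < h0 /\ chain x).
    by have [y hy] := step_ex hh cx; exists y.
  by exists x => hh cx; case: h1.
by exists (fun h x => st (h, x)) => h x; exact: (hst (h, x)).
Qed.

Let g s : R := expR (2 * om * s).

Let g_ge0 s : 0 <= g s. Proof. exact: expR_ge0. Qed.
Let gD s t : g (s + t) = g s * g t. Proof. by rewrite /g mulrDr expRD. Qed.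
Let g_le s t : s <= t -> g s <= g t.
Proof. by move=> st; rewrite ler_expR ler_wpM2l// mulr_ge0. Qed.
Let g_ge1 s : 0 <= s -> 1 <= g s.
Proof. by move=> /g_le; rewrite /g mulr0 expR0. Qed.

(** For [0 <= s <= 1/2] one has [(1 + 2 s) (1 - s) >= 1], and [1 + 2 s <= exp (2 s)]. This is the
    origin of the rate [2 * om] in [g]. *)
Let step_le h a b : 0 <= h -> h * om <= 1 / 2 -> 0 <= a ->
  (1 - h * om) * a <= b -> a <= g h * b.
Proof.
move=> hp hom a0 hab.
have b0 : 0 <= b by apply: le_trans hab; rewrite mulr_ge0//; lra.
have ho : 0 <= h * om by rewrite mulr_ge0.
have : (1 + 2 * om * h) * b <= g h * b.
  by rewrite ler_wpM2r// expR_ge1Dx.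
apply: le_trans.
have : (1 + 2 * (h * om)) * ((1 - h * om) * a) <= (1 + 2 * (h * om)) * b.
  by rewrite ler_wpM2l//; lra.
rewrite -(mulrA 2) (mulrC om); apply: le_trans.
have : 0 <= h * om * (1 - 2 * (h * om)) * a by rewrite !mulr_ge0//; lra.
by lra.
Qed.

(** The witness is [J (J z0)] for the resolvent [J = (1 - h A)^-1]: each application gains one
    order, from the domain of [A] to that of its cube. It differs from [z0] by [h (y1 + w1)], where
    [N y1 <= 2 N z1] and [N w1 <= 4 N z1]; hence the factor 6. *)
Lemma smooth_data z0 z1 e : A z0 z1 -> 0 < e ->
  exists x, chain x /\ N (x 0%N - z0) < e.
Proof.
move=> Az e0; have nN := seminorm_ge0 hN.
(* The sum of all lower bounds wanted for [1 / h], so that [h < h0], [2 h om <= 1] and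
   [6 h N z1 < e] hold together. *)
pose c := 1 / h0 + 2 * om + 6 * N z1 / e + 1.
have c1 : 0 < 1 / h0 by rewrite divr_gt0.
have c2 : 0 <= 6 * N z1 / e by rewrite !mulr_ge0// invr_ge0 ltW.
have c0 : 0 < c by rewrite /c; have := om0; lra.
pose h := c^-1; have h_gt0 : 0 < h by rewrite invr_gt0.
have hc : h * c = 1 by rewrite mulVf ?gt_eqF.
have le_c a : a <= c -> h * a <= 1 by move=> ac; rewrite -hc ler_wpM2l// ltW.
have hh : 0 < h < h0.
  rewrite h_gt0/= -[ltRHS]mulr1 -hc mulrCA -[ltLHS]mulr1 ltr_pM2l//.
  apply: (@lt_le_trans _ _ (h0 * (1 / h0 + 1))).
    by rewrite mulrDr div1r divff ?gt_eqF// mulr1 ltrDl.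
  by rewrite ler_pM2l// /c; have := om0; lra.
have hom : h * (2 * om) <= 1 by apply: le_c; rewrite /c; lra.
have he : h * (6 * N z1) < e.
  have : 6 * N z1 / e < c by rewrite /c; have := om0; lra.
  by rewrite ltr_pdivrMr// -(ltr_pM2l h_gt0) (mulrA h c) hc mul1r.
have res y y' f : A y y' -> y - h *: y' = f -> N y <= 2 * N f.
  move=> Ay <-; have := diss (ltW h_gt0) Ay; have := nN y; nra.
have [y0 [y1 [Ay Ey]]] := range z0 hh.
have Dy : y0 - z0 = h *: y1 by rewrite -Ey opprB addrCA subrr addr0.
have Ay1 : A y1 (h^-1 *: (y1 - z1)).
  have := AZ h^-1 (AB Ay Az).
  by rewrite Dy scalerA mulVf ?gt_eqF// scale1r.
have Ny : N y1 <= 2 * N z1.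
  apply: res Ay1 _.
  by rewrite scalerA divff ?gt_eqF// scale1r opprB addrCA subrr addr0.
have [w1 [w2 [Aw Ew]]] := range y1 hh.
have Nw : N w1 <= 2 * N y1 by exact: res Aw Ew.
have Dw : w1 - y1 = h *: w2 by rewrite -Ew opprB addrCA subrr addr0.
set y2 := h^-1 *: (y1 - z1) in Ay1.
exists (fun i => nth 0 [:: y0 + h *: w1; w1; w2; h^-1 *: (w2 - y2)] i); split.
  case=> [|[|[|]]]//= _.
    have -> : w1 = y1 + h *: w2 by rewrite -Dw subrKC.
    by apply: AD => //; apply: AZ; rewrite -Dw subrKC.
  have := AZ h^-1 (AB Aw Ay1).
  by rewrite Dw scalerA mulVf ?gt_eqF// scale1r.
rewrite /= addrAC Dy -scalerDr (seminormZ hN) gtr0_norm//.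
apply: le_lt_trans he; rewrite ler_pM2l//.
by apply: (le_trans (seminormD hN _ _)); lra.
Qed.

Variable x : nat -> X.
Hypothesis chx : chain x.

Let M := \sum_(i < 4) N (x i).
Let M_ge0 : 0 <= M. Proof. by apply: sumr_ge0 => i _; exact: seminorm_ge0. Qed.
Let NxM i : (i <= 3)%N -> N (x i) <= M.
Proof.
move=> i3; rewrite /M (bigD1 (Ordinal (i3 : (i < 4)%N)))//= lerDl.
by apply: sumr_ge0 => j _; exact: seminorm_ge0.
Qed.

Section fixed_step.
Variable st : R -> (nat -> X) -> nat -> X.
Hypothesis hst : forall (h : R) x, 0 < h < h0 -> chain x -> step_spec h x (st h x).

Let S h n := iter n (st h) x.

Let good h := 0 < h < h0 /\ h * om <= 1 / 2.

Let S_chain h n : good h -> chain (S h n).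
Proof. by move=> [hh _]; elim: n => //= n ih; case: (hst hh ih). Qed.

Let S_step h n : good h -> step_spec h (S h n) (S h n.+1).
Proof. by move=> hg; apply: hst; [case: hg | exact: S_chain]. Qed.

Let good0 h : good h -> 0 <= h.
Proof. by move=> [/andP[/ltW]]. Qed.

Let S_bound h n i : good h -> (i <= 3)%N -> N (S h n i) <= g (n%:R * h) * M.
Proof.
move=> hg i3; elim: n => [|n ih].
  by rewrite mul0r /g mulr0 expR0 mul1r NxM.
have [_ _ /(_ _ i3)] := S_step n hg.
move/step_le; move/(_ (good0 hg) hg.2 (seminorm_ge0 hN _)) => h1.
rewrite -natr1 mulrDl mul1r addrC gD -mulrA.
by apply: (le_trans h1); rewrite ler_wpM2l.
Qed.

Let S_diff h n j i : good h -> (i < 3)%N ->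
  N (S h (n + j) i - S h n i) <= (j%:R * h) * (g ((n + j)%:R * h) * M).
Proof.
move=> hg i3; have h_ge0 := good0 hg; elim: j => [|j ih].
  by rewrite addn0 subrr seminorm0// !mul0r.
rewrite addnS; have [_ /(_ _ i3) E _] := S_step (n + j) hg.
rewrite E addrAC; apply: (le_trans (seminormD hN _ _)).
rewrite (seminormZ hN) ger0_norm // -[in leRHS]natr1 !mulrDl mul1r lerD//.
  apply: (le_trans ih); rewrite ler_wpM2l ?mulr_ge0//.
  rewrite ler_wpM2r// g_le// ler_wpM2r //.
  by rewrite ler_nat.
by rewrite ler_wpM2l //; exact: S_bound.
Qed.

Let S_diff2 h n j : good h ->
  N (S h (n + j) 0%N - S h n 0%N - (j%:R * h) *: S h n 1%N)
    <= (j%:R * h) ^+ 2 * (g ((n + j)%:R * h) * M).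
Proof.
move=> hg; have h_ge0 := good0 hg; elim: j => [|j ih].
  by rewrite addn0 subrr mul0r scale0r subr0 seminorm0// expr0n mul0r.
have [_ /(_ 0%N isT) E _] := S_step (n + j) hg.
rewrite addnS [S h (n + j).+1 0%N]E.
have -> : S h (n + j) 0%N + h *: S h (n + j).+1 1%N - S h n 0%N -
    (j.+1%:R * h) *: S h n 1%N =
  (S h (n + j) 0%N - S h n 0%N - (j%:R * h) *: S h n 1%N) +
  h *: (S h (n + j.+1) 1%N - S h n 1%N).
  rewrite addnS scalerBr -natr1 mulrDl mul1r scalerDl opprD !addrA.
  by rewrite [LHS](ACl (1 * 3 * 4 * 2 * 5)).
apply: (le_trans (seminormD hN _ _)).
have h1 : N (h *: (S h (n + j.+1) 1%N - S h n 1%N)) <=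
    h * ((j.+1%:R * h) * (g ((n + j.+1)%:R * h) * M)).
  by rewrite (seminormZ hN) ger0_norm// ler_wpM2l//; exact: S_diff.
apply: (le_trans (lerD ih h1)).
have gm : g ((n + j)%:R * h) * M <= g ((n + j.+1)%:R * h) * M.
  by rewrite ler_wpM2r// g_le// ler_wpM2r// ler_nat addnS.
have h2 : (j%:R * h) ^+ 2 * (g ((n + j)%:R * h) * M) <=
    (j%:R * h) ^+ 2 * (g ((n + j.+1)%:R * h) * M).
  by rewrite ler_wpM2l// sqr_ge0.
apply: (le_trans (lerD h2 (lexx _))).
rewrite -addnS; set G := g _ * M.
have G0 : 0 <= G by rewrite mulr_ge0.
have hG : 0 <= h ^+ 2 * G * j%:R by rewrite !mulr_ge0// sqr_ge0.
rewrite -natr1 !expr2; nra.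
Qed.

(* Halving the step: [(1 - hA/2)^2 = (1 - hA) + h^2/4 A^2]. *)
Let S_half h n i : good h -> (i <= 1)%N ->
  N (S h n i - S (h / 2) (2 * n) i) <=
  n%:R * h ^+ 2 * (g (2 * (n%:R * h)) * M).
Proof.
move=> hg i1; have h_ge0 := good0 hg.
have hg2 : good (h / 2).
  have [/andP[a b] c] := hg; have := mulr_ge0 h_ge0 om0.
  by split; [apply/andP; split|]; lra.
elim: n => [|n ih]; first by rewrite muln0 subrr seminorm0// !mul0r.
have -> : (2 * n.+1 = (2 * n).+2)%N by rewrite mulnS.
have i3 : (i < 3)%N by case: (i) i1 => [|[|]].
have i3' : (i.+1 < 3)%N by case: (i) i1 => [|[|]].
have [c1 /(_ _ i3) E1 _] := S_step n hg.
have [_ /(_ _ i3) E2 _] := S_step (2 * n) hg2.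
have [c3 E3 _] := S_step (2 * n).+1 hg2.
set p := S h n in ih E1 *; set p' := S h n.+1 in c1 E1 *.
set q := S (h / 2) (2 * n) in ih E2 *.
set q1 := S (h / 2) (2 * n).+1 in E2 E3 *.
set q2 := S (h / 2) (2 * n).+2 in c3 E3 *.
have AA := AB (c1 _ i3) (c3 _ i3).
have E : p' i - q2 i - h *: (p' i.+1 - q2 i.+1) =
    (p i - q i) + (h ^+ 2 / 4) *: q2 i.+2.
  have -> : p i = p' i - h *: p' i.+1 by rewrite E1 addrK.
  have -> : q i = q2 i - h *: q2 i.+1 + (h ^+ 2 / 4) *: q2 i.+2.
    have -> : q i = q1 i - (h / 2) *: q1 i.+1 by rewrite E2 addrK.
    have -> : q1 i = q2 i - (h / 2) *: q2 i.+1 by rewrite (E3 _ i3) addrK.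
    have -> : q1 i.+1 = q2 i.+1 - (h / 2) *: q2 i.+2 by rewrite (E3 _ i3') addrK.
    rewrite scalerBr scalerA opprD opprK addrA -(addrA (q2 i)) -opprD -scalerDl.
    rewrite (_ : h / 2 + h / 2 = h); last by field.
    by rewrite (_ : h / 2 * (h / 2) = h ^+ 2 / 4)// expr2; field.
  rewrite scalerBr !opprD !opprK !addrA subrK.
  by rewrite [RHS](ACl (1 * 3 * 2 * 4)).
have := diss h_ge0 AA; rewrite E => h1.
(* Both schemes have reached the same time [(n + 1) h]. *)
have h2 : N (q2 i.+2) <= g (n.+1%:R * h) * M.
  rewrite (_ : n.+1%:R * h = (2 * n).+2%:R * (h / 2)).
    by apply: S_bound => //; case: (i) i1 => [|[|]].
  by rewrite -[((2 * n).+2)%N]/(2 + 2 * n)%N -mulnS natrM; field.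
have h3 : (1 - h * om) * N (p' i - q2 i) <=
   n%:R * h ^+ 2 * (g (2 * (n%:R * h)) * M) + h ^+ 2 * (g (n.+1%:R * h) * M).
  apply: (le_trans h1); apply: (le_trans (seminormD hN _ _)); apply: lerD => //.
  rewrite (seminormZ hN) ger0_norm ?divr_ge0 ?sqr_ge0//.
  rewrite -mulrA ler_wpM2l ?sqr_ge0//.
  apply: le_trans h2; rewrite ler_piMl ?seminorm_ge0//; lra.
apply: (le_trans (step_le h_ge0 hg.2 (seminorm_ge0 hN _) h3)).
have nh0 : 0 <= n%:R * h by rewrite mulr_ge0.
have En : n.+1%:R * h = n%:R * h + h by rewrite -natr1 mulrDl mul1r.
(* The factor 2 in the argument of [g] pays for the factor [g h] lost at every step. *)
set G := g (2 * (n.+1%:R * h)) * M.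
rewrite (_ : n.+1%:R * h ^+ 2 * G = n%:R * h ^+ 2 * G + h ^+ 2 * G).
  have gG a : h + a <= 2 * (n.+1%:R * h) -> g h * (g a * M) <= G.
    by move=> ?; rewrite mulrA -gD ler_wpM2r// g_le.
  rewrite mulrDr lerD//.
    by rewrite mulrCA ler_wpM2l ?mulr_ge0 ?sqr_ge0//; apply: gG; rewrite En; lra.
  by rewrite mulrCA ler_wpM2l ?sqr_ge0//; apply: gG; rewrite En; lra.
by rewrite -natr1; ring.
Qed.

Variable r : R.
Hypothesis hr : good r.
Let hk k := r / 2 ^+ k.

Let rpos : 0 < r. Proof. by case: hr => /andP[]. Qed.
Let hk_gt0 k : 0 < hk k. Proof. by rewrite divr_gt0 ?exprn_gt0. Qed.
Let hk_le k : hk k <= r.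
Proof.
rewrite ler_pdivrMr ?exprn_gt0// ler_peMr ?(ltW rpos)//.
by rewrite exprn_ege1// ler1n.
Qed.
Let hkS k : hk k.+1 = hk k / 2.
Proof. by rewrite /hk exprS invfM mulrCA mulrC. Qed.
Let hk_good k : good (hk k).
Proof.
have [/andP[a b] c] := hr; split.
  by rewrite hk_gt0/= (le_lt_trans (hk_le k)).
by apply: le_trans c; rewrite ler_wpM2r.
Qed.

Let nk k t := Num.truncn (t / hk k).

Let nk_le k t : 0 <= t -> (nk k t)%:R * hk k <= t.
Proof.
by move=> t0; rewrite -ler_pdivlMr// truncn_le divr_ge0// ltW.
Qed.

Let nk_gt k t : t < (nk k t)%:R * hk k + hk k.
Proof.
by rewrite -[X in _ + X]mul1r -mulrDl natr1 -ltr_pdivrMr// truncnS_gt.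
Qed.

Let U k t := S (hk k) (nk k t).
Let C T := (T + 1) * (g (2 * T) * M).

Let C_ge0 T : 0 <= T -> 0 <= C T.
Proof. by move=> T0; rewrite !mulr_ge0// addr_ge0. Qed.

Let C_le s t : 0 <= s -> s <= t -> C s <= C t.
Proof.
move=> s0 s_t; rewrite ler_pM ?mulr_ge0 ?addr_ge0 ?lerD2r//.
by rewrite ler_wpM2r// g_le// ler_wpM2l.
Qed.

Let U_bound T k t i : 0 <= t <= T -> (i <= 3)%N -> N (U k t i) <= g T * M.
Proof.
move=> /andP[t0 tT] i3; apply: le_trans (S_bound _ (hk_good k) i3) _.
by rewrite ler_wpM2r// g_le// (le_trans (nk_le k t0)).
Qed.

(** After halving, the number of steps below [t] is twice the old one, or one more. [S_half] covers
    the doubled count and [S_diff] the possible extra step. *)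
Let U_cauchy k t i : 0 <= t -> (i <= 1)%N ->
  N (U k.+1 t i - U k t i) <= (C t * r) / 2 ^+ k.
Proof.
move=> t0 i1; set n := nk k t.
have i3 : (i < 3)%N by case: (i) i1 => [|[|]].
have : (nk k.+1 t = 2 * n \/ nk k.+1 t = 2 * n + 1)%N.
  have l1 := nk_le k t0; have u1 := nk_gt k t.
  have l2 := nk_le k.+1 t0; have u2 := nk_gt k.+1 t.
  rewrite hkS in l2 u2; rewrite -/n in l1 u1; have hp := hk_gt0 k.
  have e1 : (2 * n < (nk k.+1 t).+1)%N.
    rewrite -(ltr_nat R) natrM -natr1 -(ltr_pM2r hp).
    by rewrite mulrDl; lra.
  have e2 : (nk k.+1 t < 2 * n + 2)%N.
    rewrite -(ltr_nat R) natrD natrM -(ltr_pM2r hp).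
    by rewrite mulrDl; lra.
  move: e1 e2; rewrite ltnS leq_eqVlt => /predU1P[->|]; first by left.
  by rewrite addn2 ltnS => a b; right; apply/eqP; rewrite eqn_leq addn1 a b.
have hp := ltW (hk_gt0 k); have half := S_half n (hk_good k) i1.
have nh : n%:R * hk k <= t := nk_le k t0.
have h1 : N (S (hk k.+1) (2 * n) i - U k t i) <= t * hk k * (g (2 * t) * M).
  rewrite seminorm_distC// hkS; apply: (le_trans half).
  rewrite expr2 mulrA; apply: ler_pM.
  - by apply: mulr_ge0 => //; apply: mulr_ge0.
  - by rewrite mulr_ge0.
  - by rewrite ler_wpM2r.
  - by rewrite ler_wpM2r// g_le// ler_wpM2l.
have EC : C t * r / 2 ^+ k = hk k * (g (2 * t) * M) + t * hk k * (g (2 * t) * M).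
  by rewrite /C /hk; ring.
have gM0 : 0 <= g (2 * t) * M by rewrite mulr_ge0.
rewrite EC.
case=> e.
  rewrite {1}/U e (le_trans h1)// lerDr.
  exact: mulr_ge0.
apply: (le_trans (seminorm_tri hN (S (hk k.+1) (2 * n) i) _ _)).
have h3 : N (U k.+1 t i - S (hk k.+1) (2 * n) i) <= hk k * (g (2 * t) * M).
  rewrite /U e; apply: (le_trans (S_diff _ _ (hk_good k.+1) i3)).
  rewrite mul1r; apply: ler_pM.
  - exact: ltW.
  - by rewrite mulr_ge0.
  - by rewrite hkS; lra.
  - by rewrite ler_wpM2r// g_le// -e (le_trans (nk_le k.+1 t0))//; lra.
exact: lerD.
Qed.

(** Convergence is obtained at levels 0 and 1, because [S_half] at level [i] uses the bound at level
    [i + 2]. *)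
Let lim_ex i : (i <= 1)%N -> exists w : R -> X, forall t, 0 <= t ->
  forall k, N (w t - U k t i) <= 2 * (C t * r) / 2 ^+ k.
Proof.
move=> i1; have /choice[w hw] : forall t, exists w, 0 <= t ->
    forall k, N (w - U k t i) <= 2 * (C t * r) / 2 ^+ k.
  move=> t; have [t0|t0] := pselect (0 <= t); last by exists 0.
  by have [w hw] := cmpl (fun k => U_cauchy k t0 i1); exists w.
by exists w.
Qed.

(** The relation [u' = v] appears as a Taylor estimate, inherited from [S_diff2] and [S_diff] as the
    step tends to 0. The initial value is attained up to a vector of seminorm 0. *)
Lemma euler_limit_fixed : exists u v : R -> X,
  [/\ forall t, 0 <= t -> A (u t) (v t),
      N (u 0 - x 0) = 0 &
      forall T, exists2 K, 0 <= K & forall s t, 0 <= s -> s <= t -> t <= T ->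
        N (u t - u s - (t - s) *: v s) <= K * (t - s) ^+ 2 /\
        N (v t - v s) <= K * (t - s)].
Proof.
have [u hu] := lim_ex (isT : 0 <= 1)%N.
have [v hv] := lim_ex (isT : 1 <= 1)%N.
exists u, v; split=> [t t0||T].
- apply: closed => e e0.
  have [k hk1] := geo_small (2 * (C t * r)) e0.
  exists (U k t 0%N), (U k t 1%N); split.
  + exact: (S_chain _ (hk_good k)).
  + exact: le_lt_trans (hu _ t0 k) hk1.
  + exact: le_lt_trans (hv _ t0 k) hk1.
- apply/eqP; rewrite eq_le seminorm_ge0// andbT.
  apply: (@ler_geo _ _ _ (2 * (C 0 * r))) => k; rewrite add0r.
  apply: le_trans (hu _ (lexx _) k).
  by rewrite /U /nk mul0r truncn0.
exists (g T * M); first by rewrite mulr_ge0.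
move=> s t s0 s_t tT.
have t0 := le_trans s0 s_t; have T0 := le_trans t0 tT.
pose D := 2 * (C T * r).
have hu' a k : 0 <= a <= T -> N (u a - U k a 0%N) <= D / 2 ^+ k.
  move=> /andP[a0 aT]; apply: (le_trans (hu _ a0 k)).
  rewrite ler_pM2r ?invr_gt0 ?exprn_gt0// ler_pM2l// ler_pM2r//.
  exact: C_le.
have hv' a k : 0 <= a <= T -> N (v a - U k a 1%N) <= D / 2 ^+ k.
  move=> /andP[a0 aT]; apply: (le_trans (hv _ a0 k)).
  rewrite ler_pM2r ?invr_gt0 ?exprn_gt0// ler_pM2l// ler_pM2r//.
  exact: C_le.
have sT : 0 <= s <= T by rewrite s0 (le_trans s_t).
have tT' : 0 <= t <= T by rewrite t0.
(* The scheme takes [j] steps from [s] to [t], which matches [t - s] up to one step of rounding. *)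
have nn k : exists j : nat, [/\ nk k t = (nk k s + j)%N,
    j%:R * hk k <= (t - s) + hk k & (t - s) - hk k <= j%:R * hk k].
  exists (nk k t - nk k s)%N.
  have nle : (nk k s <= nk k t)%N.
    by apply: le_truncn; rewrite ler_pM2r ?invr_gt0.
  have := nk_le k s0; have := nk_le k t0; have := nk_gt k s; have := nk_gt k t.
  by rewrite subnKC// natrB// mulrBl => *; split=> //; lra.
have G0 : 0 <= g T * M by rewrite mulr_ge0.
have hk0 k := ltW (hk_gt0 k).
have Sg k j : nk k t = (nk k s + j)%N ->
    g ((nk k s + j)%:R * hk k) * M <= g T * M.
  by move=> <-; rewrite ler_wpM2r// g_le// (le_trans (nk_le k t0)).
split; last first.
  apply: (@ler_geo _ _ _ (D + D + r * (g T * M))) => k.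
  have [j [ej j1 j2]] := nn k.
  have d1 : N (U k t 1%N - U k s 1%N) <= (t - s + hk k) * (g T * M).
    rewrite /U ej; apply: (le_trans (S_diff _ _ (hk_good k) (isT : 1 < 3)%N)).
    by apply: ler_pM; [exact: mulr_ge0|exact: mulr_ge0|exact: j1|exact: Sg].
  apply: (le_trans (seminorm_tri hN (U k t 1%N) _ _)).
  have := seminorm_tri hN (U k s 1%N) (U k t 1%N) (v s).
  have := hv' _ k tT'; have := hv' _ k sT.
  rewrite (seminorm_distC hN (v s)) !mulrDl (mulrAC r) -/(hk k).
  move: d1; rewrite mulrDl; lra.
apply: (@ler_geo _ _ _ (D + D + (T + T + r + 1) * r * (g T * M) + T * D)) => k.
have [j [ej j1 j2]] := nn k.
have d1 : N (U k t 0%N - U k s 0%N - (j%:R * hk k) *: U k s 1%N)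
    <= (t - s + hk k) ^+ 2 * (g T * M).
  rewrite /U ej; apply: (le_trans (S_diff2 _ _ (hk_good k))).
  apply: ler_pM; [exact: sqr_ge0|exact: mulr_ge0| |exact: Sg].
  have ts0 : 0 <= t - s + hk k by rewrite addr_ge0 ?subr_ge0.
  have jh0 : 0 <= j%:R * hk k by exact: mulr_ge0.
  by rewrite ler_sqr ?nnegrE.
have d2 : N ((j%:R * hk k - (t - s)) *: U k s 1%N) <= hk k * (g T * M).
  rewrite (seminormZ hN); apply: ler_pM => //; first exact: seminorm_ge0.
  - by rewrite ler_norml; lra.
  - exact: U_bound.
have d3 : N ((t - s) *: (U k s 1%N - v s)) <= T * (D / 2 ^+ k).
  rewrite (seminormZ hN) ger0_norm ?subr_ge0// seminorm_distC//.
  apply: ler_pM; [by rewrite subr_ge0|exact: seminorm_ge0|lra|exact: hv'].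
(* The pieces are the two approximation errors of [u], the discrete Taylor remainder, the rounding
   of the elapsed time and the approximation error of [v s]. *)
have -> : u t - u s - (t - s) *: v s =
    (u t - U k t 0%N) + (U k s 0%N - u s) +
    ((U k t 0%N - U k s 0%N - (j%:R * hk k) *: U k s 1%N) +
    ((j%:R * hk k - (t - s)) *: U k s 1%N + (t - s) *: (U k s 1%N - v s))).
  rewrite (scalerBl (j%:R * hk k)) (scalerBr (t - s) (U k s 1%N)).
  exact: sub_telescope.
have t1 := seminormD hN.
apply: (le_trans (t1 _ _)).
have e1 := t1 (u t - U k t 0%N) (U k s 0%N - u s).
set w1 := (X in _ + N X <= _).
have e2 : N w1 <= (t - s + hk k) ^+ 2 * (g T * M) + (hk k * (g T * M) + T * (D / 2 ^+ k)).
  apply: (le_trans (t1 _ _)); apply: lerD => //.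
  by apply: (le_trans (t1 _ _)); apply: lerD.
have := hu' _ k tT'; have := hu' _ k sT; rewrite (seminorm_distC hN (u s)).
have hkr := hk_le k; have hkp := hk_gt0 k.
have e3 : (t - s + hk k) ^+ 2 <= (t - s) ^+ 2 + (T + T + r) * hk k by rewrite !expr2; nra.
have e4 := ler_wpM2r G0 e3.
rewrite (_ : (D + D + (T + T + r + 1) * r * (g T * M) + T * D) / 2 ^+ k =
  D / 2 ^+ k + D / 2 ^+ k + (T + T + r) * hk k * (g T * M) + hk k * (g T * M) +
  T * (D / 2 ^+ k)); last by rewrite /hk; ring.
move: e1 e2 e4; rewrite mulrDl; lra.
Qed.

End fixed_step.

Lemma euler_limit : exists u v : R -> X,
  [/\ forall t, 0 <= t -> A (u t) (v t),
      N (u 0 - x 0) = 0 &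
      forall T, exists2 K, 0 <= K & forall s t, 0 <= s -> s <= t -> t <= T ->
        N (u t - u s - (t - s) *: v s) <= K * (t - s) ^+ 2 /\
        N (v t - v s) <= K * (t - s)].
Proof.
have [st hst] := step_fun.
pose r := Num.min (h0 / 2) (1 / (2 * (om + 1))).
have om1 : 0 < om + 1 by exact: ltr_wpDl.
have b0 : 0 < 1 / (2 * (om + 1)) by rewrite divr_gt0// mulr_gt0.
have r0 : 0 < r by rewrite lt_min b0 divr_gt0.
have rh : r <= h0 / 2 by rewrite ge_min lexx.
have rb : r <= 1 / (2 * (om + 1)) by rewrite ge_min lexx orbT.
apply: (@euler_limit_fixed st hst r); split; first by rewrite r0/=; lra.
apply: (@le_trans _ _ (1 / (2 * (om + 1)) * (om + 1))).
  by apply: ler_pM => //; [exact: ltW | lra].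
by rewrite le_eqVlt; apply/orP; left; apply/eqP; field; rewrite gt_eqF.
Qed.

End implicit_euler.

(** * Decrease of a negative quadratic form along a trajectory *)

Section quadratic_growth.
Context (R : realType) (X : lmodType R).
Variables (N : X -> R) (A : X -> X -> Prop) (Q : X -> X -> R) (C lam : R).
Hypothesis hN : seminorm N.
Hypothesis QC : forall x y, Q x y = Q y x.
Hypothesis QD : forall x y z, Q (x + y) z = Q x z + Q y z.
Hypothesis QZ : forall c x y, Q (c *: x) y = c * Q x y.
Hypothesis Qbound : forall x y, `|Q x y| <= C * (N x * N y).
Hypothesis lam_gt0 : 0 < lam.
Hypothesis QA : forall x y, A x y -> Q x y <= lam * Q x x.

Let QDr x y z : Q z (x + y) = Q z x + Q z y.
Proof. by rewrite QC QD !(QC z). Qed.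

Let QZr c x y : Q x (c *: y) = c * Q x y.
Proof. by rewrite QC QZ (QC x). Qed.

Let QDD x y : Q (x + y) (x + y) = Q x x + 2 * Q x y + Q y y.
Proof. rewrite !(QD, QDr) (QC y x); ring. Qed.

Variables u v : R -> X.
Hypothesis uA : forall t, 0 <= t -> A (u t) (v t).
Hypothesis u_diff : forall T, exists2 K, 0 <= K & forall s t,
  0 <= s -> s <= t -> t <= T ->
        N (u t - u s - (t - s) *: v s) <= K * (t - s) ^+ 2 /\
        N (v t - v s) <= K * (t - s).
Hypothesis Q0 : Q (u 0) (u 0) < 0.

(** A discrete Gronwall argument on a uniform subdivision of [[0, T]], without differentiating
    [Q (u t) (u t)]. Half of the rate [2 lam] absorbs the Taylor error, the other half gives the
    linear decrease, which is enough for unboundedness. *)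
Lemma quadratic_growth T : 0 <= T -> Q (u T) (u T) <= (1 + lam * T) * Q (u 0) (u 0).
Proof.
rewrite le_eqVlt => /predU1P[<-|T0]; first by rewrite mulr0 addr0 mul1r.
have [K K0 hK] := u_diff T.
pose B1 := K * T + N (v 0); pose B0 := K * T ^+ 2 + T * B1 + N (u 0).
have nN x := seminorm_ge0 hN x.
have B1_ge0 : 0 <= B1 by rewrite addr_ge0// mulr_ge0// ltW.
have vB t : 0 <= t <= T -> N (v t) <= B1.
  move=> /andP[t0 tT]; have [_] := hK 0 t (lexx _) t0 tT; rewrite subr0.
  have := seminorm_le hN (v 0) (v t); rewrite /B1; nra.
have uB t : 0 <= t <= T -> N (u t) <= B0.
  move=> /andP[t0 tT]; have [h _] := hK 0 t (lexx _) t0 tT.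
  rewrite subr0 in h.
  have e1 := seminorm_le hN (u 0) (u t).
  have e2 := seminorm_le hN (t *: v 0) (u t - u 0).
  rewrite (seminormZ hN) ger0_norm// in e2.
  have e3 : N (v 0) <= B1 by rewrite vB// lexx ltW.
  have e4 : t * N (v 0) <= T * B1 by rewrite ler_pM.
  have e5 : K * t ^+ 2 <= K * T ^+ 2.
    by rewrite ler_wpM2l// ler_sqr ?nnegrE// ltW.
  rewrite /B0; lra.
have B0_ge0 : 0 <= B0 by apply: le_trans (uB 0 _); rewrite ?nN// lexx ltW.
(* The three terms bound [Q (v s) (v s)], the pairing of the linear part with the Taylor remainder,
   and the square of the remainder, each after division by [tau ^+ 2]. *)
pose D := `|C| * (B1 ^+ 2 + 2 * (B0 + T * B1) * K + K ^+ 2 * T ^+ 2).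
have Qle x y a b : N x <= a -> N y <= b -> Q x y <= `|C| * (a * b).
  move=> xa yb; apply: (le_trans (ler_norm _)); apply: (le_trans (Qbound _ _)).
  apply: (@le_trans _ _ (`|C| * (N x * N y))).
    by rewrite ler_wpM2r ?mulr_ge0// ler_norm.
  by rewrite ler_wpM2l// ler_pM.
have step s tau : 0 <= s -> 0 <= tau -> s + tau <= T ->
    Q (u (s + tau)) (u (s + tau)) <= (1 + 2 * lam * tau) * Q (u s) (u s) + D * tau ^+ 2.
  move=> s0 tau0 stT.
  have sT : 0 <= s <= T by rewrite s0; lra.
  have tauT : tau <= T by lra.
  have [] := hK s (s + tau) s0 _ stT; first by lra.
  rewrite [s + tau - s]addrAC subrr add0r => h _.
  set rho := u (s + tau) - u s - tau *: v s in h.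
  have -> : u (s + tau) = u s + tau *: v s + rho.
    by rewrite /rho -[u (s + tau) - _ - _]addrA -opprD subrKC.
  have q1 : tau * Q (u s) (v s) <= tau * (lam * Q (u s) (u s)).
    by rewrite ler_wpM2l//; exact: QA (uA s0).
  have q2 : tau ^+ 2 * Q (v s) (v s) <= tau ^+ 2 * (`|C| * (B1 * B1)).
    by rewrite ler_wpM2l ?sqr_ge0// Qle// vB.
  have n1 : N (u s + tau *: v s) <= B0 + T * B1.
    apply: (le_trans (seminormD hN _ _)); rewrite lerD ?uB//.
    by rewrite (seminormZ hN) ger0_norm// ler_pM// vB.
  have q3 := Qle _ _ _ _ n1 h.
  have q4 := Qle _ _ _ _ h h.
  have q5 : `|C| * (K * tau ^+ 2 * (K * tau ^+ 2)) <= `|C| * (K ^+ 2 * T ^+ 2) * tau ^+ 2.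
    rewrite (_ : `|C| * _ = `|C| * (K ^+ 2 * tau ^+ 2) * tau ^+ 2); last by ring.
    rewrite ler_wpM2r ?sqr_ge0// ler_wpM2l// ler_wpM2l ?sqr_ge0//.
    by rewrite ler_sqr ?nnegrE// ltW.
  set w := u s + tau *: v s in n1 q3 *.
  have -> : Q (w + rho) (w + rho) = Q w w + 2 * Q w rho + Q rho rho.
    exact: QDD.
  have -> : Q w w = Q (u s) (u s) + 2 * (tau * Q (u s) (v s)) + tau ^+ 2 * Q (v s) (v s).
    by rewrite /w QDD !(QZ, QZr); ring.
  rewrite /D; lra.
pose q0 := - Q (u 0) (u 0).
have q0_gt0 : 0 < q0 by rewrite oppr_gt0.
have D0 : 0 <= D.
  by rewrite !(mulr_ge0, addr_ge0)// ?sqr_ge0// ltW.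
(* With [n + 1] steps the error [D * tau ^+ 2] is at most [lam * q0 * tau]. *)
pose n := Num.truncn (D * T / (lam * q0)).
have hn : D * (T / n.+1%:R) <= lam * q0.
  have : D * T / (lam * q0) < n.+1%:R by exact: truncnS_gt.
  rewrite ltr_pdivrMr ?mulr_gt0// => /ltW h.
  by rewrite mulrA ler_pdivrMr// (mulrC (lam * q0)).
set tau := T / n.+1%:R in hn.
have tau0 : 0 <= tau by rewrite divr_ge0// ltW.
have ntau : n.+1%:R * tau = T by rewrite mulrC divfK.
have ind m : (m <= n.+1)%N ->
    Q (u (m%:R * tau)) (u (m%:R * tau)) <= - (1 + m%:R * lam * tau) * q0.
  elim: m => [|m ih] mn; first by rewrite !mul0r /q0; lra.
  have {}ih := ih (ltnW mn).
  have m0 : 0 <= m%:R * tau by rewrite mulr_ge0.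
  have e : m.+1%:R * tau = m%:R * tau + tau by rewrite -natr1 mulrDl mul1r.
  have := step (m%:R * tau) tau m0 tau0.
  rewrite -e => /(_ _)/le_trans; apply.
    by rewrite -ntau ler_wpM2r// ler_nat.
  have l0 : 0 <= lam * tau by rewrite mulr_ge0// ltW.
  apply: (@le_trans _ _ ((1 + 2 * lam * tau) * (- (1 + m%:R * lam * tau) * q0) + D * tau ^+ 2)).
    by rewrite lerD2r; apply: ler_wpM2l ih; lra.
  have h1 : D * tau * tau <= lam * q0 * tau by rewrite ler_wpM2r.
  have h2 : 0 <= (lam * tau) * (m%:R * tau) * lam * q0.
    by rewrite !mulr_ge0// ltW.
  rewrite -natr1 expr2; lra.
have := ind n.+1 (leqnn _); rewrite ntau mulrAC ntau /q0 [lam * _]mulrC; lra.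
Qed.

End quadratic_growth.

(** * Trajectories issued from a direction of negativity *)

Section abstract_instability.
Context (R : realType) (X : lmodType R).
Variables (N : X -> R) (A : X -> X -> Prop) (om h0 : R).
Hypothesis hN : seminorm N.
Hypothesis cmpl : geo_complete N.
Hypothesis AD : forall x y x' y', A x y -> A x' y' -> A (x + x') (y + y').
Hypothesis AZ : forall c x y, A x y -> A (c *: x) (c *: y).
Hypothesis om0 : 0 <= om.
Hypothesis diss : forall (h : R) x y, 0 <= h -> A x y ->
  (1 - h * om) * N x <= N (x - h *: y).
Hypothesis h0_gt0 : 0 < h0.
Hypothesis range : forall (h : R) f, 0 < h < h0 ->
  exists x y, A x y /\ x - h *: y = f.
Hypothesis closed : forall x y,
  (forall e : R, 0 < e -> exists x' y', [/\ A x' y', N (x - x') < e & N (y - y') < e]) ->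
  A x y.
Variables (Q : X -> X -> R) (C lam : R).
Hypothesis QC : forall x y, Q x y = Q y x.
Hypothesis QD : forall x y z, Q (x + y) z = Q x z + Q y z.
Hypothesis QZ : forall c x y, Q (c *: x) y = c * Q x y.
Hypothesis Qbound : forall x y, `|Q x y| <= C * (N x * N y).
Hypothesis lam_gt0 : 0 < lam.
Hypothesis QA : forall x y, A x y -> Q x y <= lam * Q x x.
Variables z0 z1 : X.
Hypothesis Az : A z0 z1.
Hypothesis Qz : Q z0 z0 < 0.

Lemma abstract_instability : exists u v : R -> X,
  [/\ forall t, 0 <= t -> A (u t) (v t),
      forall T, exists2 K, 0 <= K & forall s t, 0 <= s -> s <= t -> t <= T ->
        N (u t - u s - (t - s) *: v s) <= K * (t - s) ^+ 2 /\
        N (v t - v s) <= K * (t - s),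
      Q (u 0) (u 0) < 0 &
      forall T, 0 <= T -> Q (u T) (u T) <= (1 + lam * T) * Q (u 0) (u 0)].
Proof.
(* A perturbation of [z0] of size below [e <= 1] changes [Q] by at most [e * (c - 1)], which is less
   than [- Q z0 z0]. *)
pose c := `|C| * (2 * N z0 + 1) + 1.
have nN := seminorm_ge0 hN.
have c0 : 0 < c by rewrite ltr_wpDl// mulr_ge0// addr_ge0// mulr_ge0.
pose e := Num.min 1 (- Q z0 z0 / c).
have e0 : 0 < e by rewrite lt_min ltr01 divr_gt0// oppr_gt0.
have [x [chx xz]] := smooth_data hN AD AZ om0 diss h0_gt0 range Az e0.
have [u [v [uA u0 uK]]] := euler_limit hN cmpl AD AZ om0 diss h0_gt0 range closed chx.
have Qu : Q (u 0) (u 0) < 0.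
  have d : N (u 0 - z0) < e.
    by apply: (le_lt_trans (seminorm_tri hN (x 0%N) _ _)); rewrite u0 add0r.
  rewrite -[u 0](subrKC z0); set rho := u 0 - z0 in d *.
  rewrite QD QC QD (QC _ (z0 + rho)) QD.
  have := Qbound rho z0; have := Qbound rho rho.
  have le2 a b : `|Q rho a| <= C * (N rho * b) -> 0 <= b -> Q rho a <= `|C| * (e * b).
    move=> h b0; apply: (le_trans (ler_norm _)); apply: (le_trans h).
    apply: (@le_trans _ _ (`|C| * (N rho * b))).
      by rewrite ler_wpM2r ?mulr_ge0// ler_norm.
    by rewrite ler_wpM2l// ler_wpM2r// ltW.
  move=> /le2 -/(_ (nN _)) h1 /le2 -/(_ (nN _)) h2.
  have h3 : `|C| * (e * N rho) <= `|C| * (e * 1).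
    rewrite ler_wpM2l// ler_wpM2l ?ltW// ?(lt_le_trans d)//.
    by rewrite ge_min lexx.
  have h4 : e * c <= - Q z0 z0.
    by rewrite -ler_pdivlMr// ge_min lexx orbT.
  rewrite (QC z0 rho); move: h4; rewrite /c; lra.
exists u, v; split => // T T0.
exact: (quadratic_growth hN QC QD QZ Qbound lam_gt0 QA uA uK Qu).
Qed.

End abstract_instability.

(** * Square-integrable functions *)

Lemma real_geo_complete (R : realType) : geo_complete (fun x : R => `|x|).
Proof.
move=> u C hu.
have C0 : 0 <= C by have := le_trans (normr_ge0 _) (hu 0%N); rewrite expr0 divr1.
have geo : cvgn (series (geometric C (2^-1 : R))).
  by apply: is_cvg_geometric_series; rewrite ger0_norm ?invr_ge0// invf_lt1// ltr1n.
have cv : cvgn (series (fun k => u k.+1 - u k)).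
  apply: normed_cvg; apply: series_le_cvg geo => // k; first exact: normr_ge0.
    by rewrite /geometric/= mulr_ge0// exprn_ge0// invr_ge0.
  by apply: (le_trans (hu k)); rewrite /geometric/= exprVn.
have tel n : series (fun k => u k.+1 - u k) n = u n - u 0%N.
  by rewrite /series/= telescope_sumr.
have cu : cvgn u.
  have -> : u = (fun n => series (fun k => u k.+1 - u k) n + u 0%N).
    by apply/funext => n; rewrite tel subrK.
  by apply: is_cvgD => //; exact: is_cvg_cst.
exists (limn u) => k.
have bnd m : `|u (k + m)%N - u k| <= 2 * C / 2 ^+ k - 2 * C / 2 ^+ (k + m).
  elim: m => [|m ih]; first by rewrite addn0 !subrr normr0.
  rewrite addnS; apply: (le_trans (ler_distD (u (k + m)%N) _ _)).
  apply: (le_trans (lerD (hu _) ih)).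
  rewrite (exprS 2 (k + m)) invfM; lra.
have cu' : (fun n => `|u n - u k|) @ \oo --> `|limn u - u k|.
  by apply: cvg_norm; apply: cvgB => //; exact: cvg_cst.
rewrite -(cvg_lim _ cu')//; apply: limr_le; first by apply/cvg_ex; eexists; exact: cu'.
near=> n; have kn : (k <= n)%N by near: n; exact: nbhs_infty_ge.
have := bnd (n - k)%N; rewrite subnKC// => /le_trans; apply.
by rewrite gerBl divr_ge0// ?exprn_ge0// mulr_ge0.
Unshelve. all: by end_near. Qed.

Section square_integrable.
Context d (T : measurableType d) (R : realType) (mu : {measure set T -> \bar R}).
Variable D : set T.
Hypothesis mD : measurable D.
Implicit Types f g : T -> R.

Definition sqint f :=
  measurable_fun D f /\ mu.-integrable D (EFin \o (fun x => f x ^+ 2)).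

Lemma sqint_lty f : measurable_fun D f ->
  (\int[mu]_(x in D) (f x ^+ 2)%:E < +oo)%E -> sqint f.
Proof.
move=> mf foo; split=> //; apply/integrableP; split.
  by apply/measurable_EFinP; exact: measurable_funX.
apply: le_lt_trans foo; rewrite le_eqVlt; apply/orP; left; apply/eqP.
by apply: eq_integral => x _ /=; rewrite ger0_norm ?sqr_ge0.
Qed.

Lemma sqint_mul f g : sqint f -> sqint g ->
  mu.-integrable D (EFin \o (fun x => f x * g x)).
Proof.
move=> [mf intf] [mg intg].
apply: le_integrable (integrableD mD intf intg) => //.
  by apply/measurable_EFinP; exact: measurable_funM.
move=> x _ /=; rewrite lee_fin normrM [leRHS]ger0_norm ?addr_ge0 ?sqr_ge0//.
rewrite -(real_normK (num_real (f x))) -(real_normK (num_real (g x))).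
have := sqr_ge0 (`|f x| - `|g x|); have := normr_ge0 (f x); have := normr_ge0 (g x).
rewrite !expr2; nra.
Qed.

Lemma sqintD f g : sqint f -> sqint g -> sqint (fun x => f x + g x).
Proof.
move=> hf hg; have [mf intf] := hf; have [mg intg] := hg; split.
  exact: measurable_funD.
have := integrableD mD (integrableD mD intf intg) (integrableZl mD 2 (sqint_mul hf hg)).
apply: eq_integrable => // x _ /=.
by rewrite -EFinM -!EFinD; congr (_%:E); ring.
Qed.

Lemma sqintZ c f : sqint f -> sqint (fun x => c * f x).
Proof.
move=> [mf intf]; split.
  by apply: measurable_funM => //; exact: measurable_cst.
have := integrableZl mD (c ^+ 2) intf.
by apply: eq_integrable => // x _ /=; rewrite -EFinM exprMn.
Qed.

Lemma sqint0 : sqint (fun=> 0).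
Proof.
split; first exact: measurable_cst.
apply: eq_integrable (integrable0 mu D) => // x _ /=.
by rewrite expr0n.
Qed.

Lemma sqint_bounded_mul M f g : measurable_fun D f -> {ae mu, forall x, D x -> `|f x| <= M} ->
  sqint g -> sqint (fun x => f x * g x).
Proof.
move=> mf fM [mg intg]; have mfg := measurable_funM mf mg; apply: sqint_lty => //.
have := integrable_lty mD (integrableZl mD (M ^+ 2) intg).
apply: le_lt_trans; apply: ae_ge0_le_integral => //.
- by move=> x _; rewrite lee_fin sqr_ge0.
- by apply/measurable_EFinP; exact: measurable_funX.
- by move=> x _ /=; rewrite -EFinM lee_fin mulr_ge0// sqr_ge0.
- apply/measurable_EFinP; apply: measurable_funM; first exact: measurable_cst.
  exact: measurable_funX.
apply: filterS fM => x h Dx; rewrite /= -EFinM lee_fin exprMn.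
apply: ler_wpM2r; first exact: sqr_ge0.
rewrite -real_normK ?num_real// ler_sqr ?nnegrE//; first exact: h.
exact: le_trans (normr_ge0 _) (h Dx).
Qed.

Let four_pow k : (4 : R) ^+ k = 2 ^+ k * 2 ^+ k.
Proof. by rewrite -exprMn; congr (_ ^+ _); ring. Qed.

(* Riesz-Fischer: the weighted series [S] of squared increments has finite
   integral and dominates [4^k (g - f k)^2 / 4] pointwise. *)
Lemma sqint_complete (f : nat -> T -> R) (C : R) : (forall k, sqint (f k)) ->
  (forall k, \int[mu]_(x in D) (f k.+1 x - f k x) ^+ 2 <= C / 16 ^+ k) ->
  exists g C', [/\ sqint g,
    forall k, \int[mu]_(x in D) (g x - f k x) ^+ 2 <= C' / 4 ^+ k &
    {ae mu, forall x, D x -> f ^~ x @ \oo --> g x}].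
Proof.
move=> hf hC.
pose dk k x := f k.+1 x - f k x.
have hd k : sqint (dk k).
  have := sqintD (hf k.+1) (sqintZ (-1) (hf k)).
  by congr sqint; apply/funext => x; rewrite /dk mulN1r.
pose S x : \bar R := (\sum_(0 <= k <oo) (4 ^+ k * dk k x ^+ 2)%:E)%E.
have t0 k x : (0 <= (4 ^+ k * dk k x ^+ 2)%:E)%E.
  by rewrite lee_fin mulr_ge0 ?sqr_ge0 ?exprn_ge0.
have S0 x : (0 <= S x)%E by apply: nneseries_ge0.
have mt k : measurable_fun D (fun x => (4 ^+ k * dk k x ^+ 2)%:E).
  apply/measurable_EFinP; apply: measurable_funM; first exact: measurable_cst.
  by apply: measurable_funX; case: (hd k).
have mS : measurable_fun D S by apply: ge0_emeasurable_sum.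
have intS : (\int[mu]_(x in D) S x <= (2 * C)%:E)%E.
  rewrite integral_nneseries//.
  have It k : (\int[mu]_(x in D) (4 ^+ k * dk k x ^+ 2)%:E <= (C / 4 ^+ k)%:E)%E.
    have [_ id] := hd k.
    under eq_integral do rewrite EFinM.
    rewrite integralZl// -(fineK (integrable_fin_num mD id)) -EFinM lee_fin.
    apply: (@le_trans _ _ (4 ^+ k * (C / 16 ^+ k))).
      by rewrite ler_wpM2l ?exprn_ge0//; exact: hC.
    rewrite (_ : (16 : R) ^+ k = 4 ^+ k * 4 ^+ k).
      by rewrite le_eqVlt; apply/orP; left; apply/eqP; field; rewrite expf_neq0.
    by rewrite -exprMn; congr (_ ^+ _); ring.
  have C0 : 0 <= C.
    have := hC 0%N; rewrite expr0 divr1; apply: le_trans.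
    by apply: Rintegral_ge0 => x _; exact: sqr_ge0.
  apply: lime_le.
    by apply: is_cvg_nneseries => k _ _; apply: integral_ge0 => x _.
  near=> n.
  apply: (@le_trans _ _ (\sum_(0 <= k < n) (C / 4 ^+ k)%:E)%E).
    by apply: lee_sum => k _; exact: It.
  rewrite sumEFin lee_fin.
  (* The partial sums are bounded by [C * (2 - 2 / 4 ^+ n)], a bound that goes through the
     induction, unlike the constant [2 * C]. *)
  have -> : 2 * C = C * (2 - 2 / 4 ^+ n) + 2 * C / 4 ^+ n by field; rewrite expf_neq0.
  apply: (@le_trans _ _ (C * (2 - 2 / 4 ^+ n))); last first.
    by rewrite lerDl divr_ge0 ?exprn_ge0// mulr_ge0.
  elim: (n) => [|m ih]; first by rewrite big_nil expr0 divr1 subrr mulr0.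
  rewrite big_nat_recr//=; apply: (le_trans (lerD ih (lexx _))).
  have : 0 <= C / 4 ^+ m by rewrite divr_ge0// exprn_ge0.
  rewrite (exprS 4 m) invfM; lra.
have Sfin x k : (S x < +oo)%E -> `|dk k x| <= Num.sqrt (fine (S x)) / 2 ^+ k.
  move=> Sx; have fS : S x \is a fin_num by rewrite ge0_fin_numE.
  rewrite ler_pdivlMr ?exprn_gt0//.
  rewrite -ler_sqr ?nnegrE ?mulr_ge0 ?exprn_ge0 ?sqrtr_ge0//.
  rewrite sqr_sqrtr ?fine_ge0// exprMn real_normK ?num_real//.
  rewrite (expr2 (2 ^+ k)) -four_pow mulrC -lee_fin fineK//.
  apply: (le_trans _ (@nneseries_lim_ge _ _ xpredT 0 k.+1 _)); last by move=> n _ _.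
  by rewrite big_nat_recr//= leeDr// sume_ge0.
have /choice[g hg] x : exists w,
    ((S x < +oo)%E -> forall k, `|w - f k x| <= 2 * Num.sqrt (fine (S x)) / 2 ^+ k) /\
    (~ (S x < +oo)%E -> w = 0).
  have [Sx|Sx] := pselect (S x < +oo)%E; last by exists 0.
  by have [w hw] := real_geo_complete (Sfin x ^~ Sx); exists w.
have gcv x : (S x < +oo)%E -> f ^~ x @ \oo --> g x.
  move=> Sx; have [h _] := hg x; have {}h := h Sx.
  apply/cvgrPdist_lt => e e0.
  have [m hm] := geo_small (2 * Num.sqrt (fine (S x))) e0.
  near=> n; apply: le_lt_trans (h n) _; apply: le_lt_trans hm.
  rewrite ler_wpM2l ?mulr_ge0 ?sqrtr_ge0// lef_pV2 ?posrE ?exprn_gt0//.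
  rewrite ler_weXn2l ?ler1n//; near: n; exact: nbhs_infty_ge.
have mg : measurable_fun D g.
  (* Where [S] is infinite the sequence may diverge. It is replaced there by 0, the default value of
     [g], so that [g] is a pointwise limit everywhere. *)
  apply: (@measurable_fun_cvg _ _ _ D (fun k x => if (S x < +oo)%E then f k x else 0)).
    move=> k; apply: measurable_fun_if => //.
    - by apply: measurable_fun_lte => //; exact: measurable_cst.
    - by apply: measurable_funS mD _ _; [exact: subIsetl | case: (hf k)].
  move=> x Dx; have [Sx|Sx] := pselect (S x < +oo)%E.
    by rewrite Sx; exact: gcv.
  have [_ ->//] := hg x; move/negP/negbTE : Sx => ->; exact: cvg_cst.
have gle k x : (((g x - f k x) ^+ 2)%:E <= (4 / 4 ^+ k)%:E * S x)%E.
  have [Sx|Sx] := pselect (S x < +oo)%E; last first.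
    have -> : S x = +oo%E by apply/eqP; rewrite -leye_eq leNgt; exact/negP.
    by rewrite gt0_muley ?leey// lte_fin divr_gt0// exprn_gt0.
  have fS : S x \is a fin_num by rewrite ge0_fin_numE.
  have [/(_ Sx k) h _] := hg x.
  rewrite -(fineK fS) -EFinM lee_fin -real_normK ?num_real//.
  apply: (@le_trans _ _ ((2 * Num.sqrt (fine (S x)) / 2 ^+ k) ^+ 2)).
    by rewrite ler_sqr// ?nnegrE// divr_ge0 ?exprn_ge0// mulr_ge0 ?sqrtr_ge0.
  rewrite !exprMn sqr_sqrtr ?fine_ge0// four_pow -exprVn.
  by rewrite le_eqVlt; apply/orP; left; apply/eqP; rewrite exprVn; field; rewrite expf_neq0.
have mgf k : measurable_fun D (fun x => (g x - f k x) ^+ 2).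
  by apply: measurable_funX; apply: measurable_funB => //; case: (hf k).
have Ig k : (\int[mu]_(x in D) ((g x - f k x) ^+ 2)%:E <= ((8 * C) / 4 ^+ k)%:E)%E.
  apply: (@le_trans _ _ (\int[mu]_(x in D) ((4 / 4 ^+ k)%:E * S x))%E).
    apply: ge0_le_integral => //.
    - by move=> x _; rewrite lee_fin sqr_ge0.
    - exact/measurable_EFinP.
    - by apply: emeasurable_funM => //; exact: measurable_cst.
  rewrite ge0_integralZl//.
  apply: (@le_trans _ _ ((4 / 4 ^+ k)%:E * (2 * C)%:E)%E).
    by rewrite lee_wpmul2l// lee_fin divr_ge0// exprn_ge0.
  by rewrite -EFinM lee_fin le_eqVlt; apply/orP; left; apply/eqP; field; rewrite expf_neq0.
have sgf k : sqint (fun x => g x - f k x).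
  apply: sqint_lty; first by apply: measurable_funB => //; case: (hf k).
  exact: le_lt_trans (Ig k) (ltry _).
exists g, (8 * C); split.
- have := sqintD (sgf 0%N) (hf 0%N); congr sqint.
  by apply/funext => x; rewrite subrK.
- move=> k; rewrite -lee_fin; apply: le_trans (Ig k).
  by rewrite /Rintegral fineK// integrable_fin_num//; case: (sgf k).
have iS : mu.-integrable D S.
  apply/integrableP; split=> //; apply: le_lt_trans (ltry (2 * C)).
  apply: le_trans intS; rewrite le_eqVlt; apply/orP; left; apply/eqP.
  by apply: eq_integral => x _; rewrite gee0_abs.
apply: filterS (integrable_ae mD iS) => x h Dx.
by apply: gcv; rewrite -ge0_fin_numE// h.
Unshelve. all: by end_near. Qed.

End square_integrable.

Section L1_distance.
Context d (T : measurableType d) (R : realType) (mu : {measure set T -> \bar R}).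
Implicit Types f g : T -> R.

Definition L1dist f g := (\int[mu]_x `|f x - g x|%:E)%E.

Lemma L1dist_id f : L1dist f f = 0%E.
Proof. by rewrite /L1dist; under eq_integral do rewrite subrr normr0; exact: integral0. Qed.

Lemma L1dist_le f g f1 g1 f2 g2 : measurable_fun setT f -> measurable_fun setT g ->
  measurable_fun setT f1 -> measurable_fun setT g1 ->
  measurable_fun setT f2 -> measurable_fun setT g2 ->
  (forall x, `|f x - g x| <= `|f1 x - g1 x| + `|f2 x - g2 x|) ->
  (L1dist f g <= L1dist f1 g1 + L1dist f2 g2)%E.
Proof.
move=> mf mg mf1 mg1 mf2 mg2 h.
have me (u v : T -> R) : measurable_fun setT u -> measurable_fun setT v ->
    measurable_fun setT (fun x => `|u x - v x|%:E).
  move=> mu_ mv; apply/measurable_EFinP; apply: measurableT_comp => //.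
  exact: measurable_funB.
rewrite /L1dist -ge0_integralD//; [|exact: me|exact: me].
apply: ge0_le_integral => //; first exact: me.
- by apply: emeasurable_funD; exact: me.
- by move=> x _; rewrite -EFinD lee_fin.
Qed.

Lemma L1dist_dominated (Q : set T) (f_ : nat -> T -> R) f e : measurable Q ->
  (mu Q < +oo)%E -> (forall k, measurable_fun setT (f_ k)) -> measurable_fun setT f ->
  (forall k x, `|f_ k x| <= \1_Q x) -> (forall x, f_ ^~ x @ \oo --> f x) ->
  0 < e -> exists k, (L1dist f (f_ k) <= e%:E)%E.
Proof.
move=> mQ Qoo mf_ mf fQ cf e0.
have intQ : mu.-integrable setT (EFin \o (\1_Q : T -> R)).
  apply/integrableP; split; first by apply/measurable_EFinP; exact: measurable_indic.
  by under eq_integral do rewrite /= ger0_norm//; rewrite integral_indic// setIT.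
have [||||_ + _] := @dominated_convergence _ _ _ mu setT measurableT
  (fun k => EFin \o f_ k) (EFin \o f) _ _ _ _ intQ _.
- by move=> k; exact/measurable_EFinP.
- exact/measurable_EFinP.
- by apply: aeW => x _; apply: cvg_EFin; [near=> k|exact: cf].
- by apply: aeW => x k _ /=; rewrite lee_fin.
move=> /fine_cvgP[[N1 _ fin] /cvgrPdist_lt/(_ _ e0)[N2 _ small]].
exists (maxn N1 N2); have := small _ (leq_maxr N1 N2 : [set _ | _] _).
have := fin _ (leq_maxl N1 N2 : [set _ | _] _) => /= fin1.
rewrite sub0r normrN => /ltW /(le_trans (ler_norm _)); rewrite -lee_fin fineK//.
apply: le_trans; rewrite le_eqVlt; apply/orP; left; apply/eqP.
by apply: eq_integral => x _ /=; rewrite distrC.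
Unshelve. all: by end_near. Qed.

End L1_distance.

(** * Lebesgue measure on row vectors *)

Section row_vector_borel.
Context (R : realType) (n : nat).
Local Notation E := 'rV[R]_n.

(** Balls are open cubes for the maximum norm, so their measurability and volume can be computed
    coordinate by coordinate. *)
Lemma rV_ball (x y : E) (e : R) :
  ball x e y <-> 0 < e /\ forall i, `|x ord0 i - y ord0 i| < e.
Proof.
rewrite /ball/= /mx_ball; split=> -[e0 h]; split => // i; first exact: h.
by move=> j; rewrite ord1; exact: h.
Qed.

Lemma measurable_rV_ball (x : E) (e : R) : measurable (ball x e).
Proof.
have [e0|e0] := ltP 0 e; last first.
  rewrite (_ : ball x e = set0)//; apply/seteqP; split => // y /rV_ball[e0'].
  by move: e0; rewrite leNgt e0'.
rewrite (_ : ball x e = \big[setI/setT]_(i < n)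
    ((fun y : E => y ord0 i : measurableTypeR R) @^-1` ball (x ord0 i) e)).
  apply: bigsetI_measurable => i _; rewrite -[X in measurable X]setTI.
  apply: measurable_coord => //; exact: measurable_ball.
rewrite -bigcap_seq; apply/seteqP; split => y /=.
  by move=> /rV_ball[_ h] i _; exact: h.
move=> h; apply/rV_ball; split=> // i.
by apply: h; rewrite /= mem_index_enum.
Qed.

(** Cubes with rational centre and radius [1 / (p + 1)], enumerated by [unpickle] and kept when the
    doubled cube lies in [U]. The doubling leaves room for a compact closed cube in [U], which
    [cutoff_rtest] uses as a support. *)
Lemma open_bigcup_ball (U : set E) : open U -> exists F : nat -> set E,
  U = \bigcup_k F k /\ forall k, F k = set0 \/
    exists c r, [/\ 0 < r, F k = ball c r & ball c (2 * r) `<=` U].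
Proof.
move=> oU.
pose cen (p : 'rV[rat]_n * nat) : E := map_mx ratr p.1.
pose rad (p : 'rV[rat]_n * nat) : R := p.2.+1%:R^-1.
pose F k := if unpickle k is Some p then
  if `[< ball (cen p) (2 * rad p) `<=` U >] then ball (cen p) (rad p) else set0
  else set0.
exists F; split; last first.
  move=> k; rewrite /F; case: unpickle => [p|]; last by left.
  case: asboolP => h; last by left.
  by right; exists (cen p), (rad p); split => //; rewrite invr_gt0.
apply/seteqP; split => x; last first.
  move=> [k _]; rewrite /F; case: unpickle => [p|//].
  case: asboolP => // h; move/rV_ball => [r0 hx]; apply: h; apply/rV_ball.
  by split=> [|i]; [rewrite mulr_gt0 | apply: lt_trans (hx i) _; lra].
move=> Ux; have : nbhs x U by rewrite nbhsE; exists U.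
move=> /nbhs_ballP[e /= e0 xeU].
(* If the centre is within one radius of [x], the doubled cube stays within three radii of [x]. *)
have [m hm] : exists m : nat, 3 * m.+1%:R^-1 < e.
  exists (Num.truncn (3 / e)); rewrite ltr_pdivrMr// mulrC -ltr_pdivrMr//.
  exact: truncnS_gt.
have m0 : 0 < m.+1%:R^-1 :> R by rewrite invr_gt0.
have [dm Edm] : exists dm : R, dm = m.+1%:R^-1 by eexists.
rewrite -Edm in hm m0.
have /choice[q hq] (i : 'I_n) : exists q : rat,
    `|x ord0 i - ratr q| < dm.
  have [q] : exists q : rat, ratr q \in `]x ord0 i - dm, x ord0 i + dm[.
    by apply: rat_in_itvoo; lra.
  by rewrite in_itv/= => h; exists q; rewrite ltr_norml; lra.
exists (pickle (\row_i q i, m)) => //; rewrite /F pickleK.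
have -> : `[< ball (cen (\row_i q i, m)) (2 * rad (\row_i q i, m)) `<=` U >].
  apply/asboolP => y /rV_ball[_ hy]; apply: xeU; apply/rV_ball; split=> // i.
  have := hy i; have := hq i; rewrite /rad/= !mxE -Edm => h1 h2.
  apply: le_lt_trans (ler_distD (ratr (q i)) _ _) _; lra.
apply/rV_ball; rewrite /rad/= -Edm; split=> // i.
by rewrite /cen/= !mxE distrC; exact: hq.
Qed.

Lemma open_measurable_rV (U : set E) : open U -> measurable U.
Proof.
move=> /open_bigcup_ball[F [-> hF]]; apply: bigcupT_measurable => k.
have [->|[c [r [_ -> _]]]] := hF k; first exact: measurable0.
exact: measurable_rV_ball.
Qed.

Lemma continuous_measurable_rV (f : E -> R) : continuous f ->
  measurable_fun setT (f : E -> measurableTypeR R).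
Proof.
move=> /continuousP cf; apply: (measurability _ (RGenOpens.measurableE R)).
move=> _ [_ [a [b ->] <-]]; rewrite setTI; apply: open_measurable_rV.
exact/cf/interval_open.
Qed.

Lemma borel_lebesgue_measurable (A : set E) : measurable A ->
  measurable (A : set (lebesgue_space R n)).
Proof. exact: caratheodory_measurable_mu_ext. Qed.

Lemma lebesgue_continuous_measurable (f : E -> R) (D : set E) :
  open D -> continuous f ->
  measurable_fun (D : set (lebesgue_space R n))
    (f : lebesgue_space R n -> measurableTypeR R).
Proof.
move=> oD cf _ Y mY; apply: borel_lebesgue_measurable.
apply: measurableI; first exact: open_measurable_rV.
by rewrite -[X in measurable X]setTI; exact: continuous_measurable_rV.
Qed.

Lemma lebesgue_ball_lty (x : E) (r : R) : 0 < r -> (lebesgue R n (ball x r) < +oo)%E.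
Proof.
move=> r0; rewrite lebesgueE; last exact: measurable_rV_ball.
have -> : ball x r = [set y | forall i, ball (x ord0 i) r (y ord0 i)].
  by apply/seteqP; split => y; [move/rV_ball => [] | move=> h; apply/rV_ball].
rewrite (@borel_lebesgue_box _ _ (fun i => ball (x ord0 i) r)); last first.
  by move=> i; exact: measurable_ball.
suff -> : (\prod_(i < n) lebesgue_measure (ball (x ord0 i) r) =
    (\prod_(i < n) (r *+ 2))%:E)%E by exact: ltry.
rewrite -prodEFin; apply: eq_bigr => i _.
by rewrite lebesgue_measure_ball// ltW.
Qed.

(** The completed measure is an outer measure, so [A] has countable Borel covers of almost the same
    measure; the hull is the intersection of their unions, cut down to [B]. Finiteness of the
    measure allows subtraction. *)
Lemma lebesgue_borel_hull (A B : set E) :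
  measurable (A : set (lebesgue_space R n)) -> measurable B -> A `<=` B ->
  (lebesgue R n B < +oo)%E ->
  exists G, [/\ measurable G, A `<=` G, G `<=` B & lebesgue R n (G `\` A) = 0%E].
Proof.
move=> mA mB AB Boo.
have leE C : (lebesgue R n C = (borel_lebesgue R n)^*%mu C)%E by [].
have fA : lebesgue R n A \is a fin_num.
  by rewrite ge0_fin_numE// (le_lt_trans _ Boo)// le_measure ?inE//; exact: borel_lebesgue_measurable.
have /choice[G hG] (k : nat) : exists G, [/\ measurable G, A `<=` G &
    (lebesgue R n G <= lebesgue R n A + (k.+1%:R^-1)%:E)%E].
  have k0 : 0 < k.+1%:R^-1 :> R by rewrite invr_gt0.
  have := lb_ereal_inf_adherent k0 fA.
  rewrite -/(mu_ext _ A) => -[_ [F [mF AF] <-] h].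
  exists (\bigcup_k F k); split => //; first exact: bigcupT_measurable.
  apply: le_trans (ltW h); rewrite lebesgueE; last exact: bigcupT_measurable.
  by apply: measure_sigma_subadditive => //; exact: bigcupT_measurable.
exists (B `&` \bigcap_k G k).
have mG : measurable (B `&` \bigcap_k G k).
  by apply: measurableI => //; apply: bigcapT_measurable => k; case: (hG k).
have AG : A `<=` B `&` \bigcap_k G k.
  by move=> x Ax; split; [exact: AB | move=> k _; case: (hG k) => _ + _; exact].
split => //.
have mG' := borel_lebesgue_measurable mG; have mB' := borel_lebesgue_measurable mB.
have Goo : (lebesgue R n (B `&` \bigcap_k G k) < +oo)%E.
  by apply: le_lt_trans Boo; rewrite le_measure ?inE//; exact: subIsetl.
rewrite measureD// (_ : B `&` \bigcap_k G k `&` A = A); last exact/setIidPr.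
apply/eqP; rewrite eq_le; apply/andP; split; last first.
  rewrite leeBrDr// add0e le_measure ?inE//; exact: borel_lebesgue_measurable.
rewrite leeBlDr// add0e; apply/lee_addgt0Pr => e e0.
pose k := Num.truncn (1 / e).
have [mGk AGk hk] := hG k.
apply: (@le_trans _ _ (lebesgue R n (G k))).
  rewrite le_measure ?inE//; first exact: borel_lebesgue_measurable.
  by move=> x [_ /(_ k)]; apply.
apply: le_trans hk _; rewrite leeD2l// lee_fin -(div1r (k.+1%:R)) ler_pdivrMr//.
rewrite mulrC -ler_pdivrMr// ltW//; exact: truncnS_gt.
Qed.

End row_vector_borel.

(** * Smooth functions *)

Section flat_functions.
Context (R : realType).
Implicit Types (p : {poly R}) (x : R).

(* This family is stable under differentiation:
   [(flat p)' = flat ('X^2 * (p - p^`()))]. *)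
Definition flat p x : R := if 0 < x then p.[x^-1] * expR (- x^-1) else 0.

(** Each monomial in [1 / x] is beaten by [exp (1 / x) >= (1 / x)^(i + 1) / (i + 1)!], which leaves
    a factor [x]. *)
Lemma flat_le p : exists2 C, 0 <= C & forall x, `|flat p x| <= C * `|x|.
Proof.
exists (\sum_(i < size p) `|p`_i| * (i.+1)`!%:R).
  by apply: sumr_ge0 => i _; rewrite mulr_ge0.
move=> x; rewrite /flat; case: ifPn => x0; last first.
  by rewrite normr0 mulr_ge0// sumr_ge0// => i _; rewrite mulr_ge0.
have y0 : 0 < x^-1 by rewrite invr_gt0.
have pw i : (x^-1) ^+ i * expR (- x^-1) <= (i.+1)`!%:R * x.
  have f0 : 0 < (i.+1)`!%:R :> R by rewrite ltr0n fact_gt0.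
  have h : (x^-1) ^+ i.+1 * expR (- x^-1) <= (i.+1)`!%:R.
    rewrite expRN ler_pdivrMr ?expR_gt0// mulrC -ler_pdivrMr//.
    by apply: le_trans (expR_ge1Dxn i (ltW y0)); rewrite lerDr.
  apply: le_trans (ler_wpM2r (ltW x0) h).
  rewrite exprS (_ : _ * x = (x^-1 * x) * (x^-1 ^+ i * expR (- x^-1))); last by ring.
  by rewrite mulVf ?gt_eqF// mul1r.
rewrite horner_coef mulr_suml (gtr0_norm x0) mulr_suml.
apply: (le_trans (ler_norm_sum _ _ _)); apply: ler_sum => i _.
rewrite -mulrA normrM -mulrA ler_wpM2l// ger0_norm ?mulr_ge0 ?expR_ge0//.
by rewrite exprn_ge0// ltW.
Qed.

Lemma is_derive_flat p x :
  is_derive x 1 (flat p) (flat ('X^2 * (p - p^`())) x).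
Proof.
have [x0|x0|x0] := ltgtP x 0.
- rewrite /flat ltNge (ltW x0)/=.
  apply: (@near_eq_is_derive _ _ _ (cst 0)).
  near=> y; rewrite ltNge ifN// negbK ltW//; near: y; exact: lt_nbhsl.
- rewrite [flat (_ * _) x]/flat x0.
  have xN0 : x != 0 by rewrite gt_eqF.
  have dV : is_derive x 1 (fun y : R => y^-1) (- x ^- 2).
    apply: (is_derive_eq (@is_deriveV _ id x 1 1 xN0 (is_derive_id _ _))).
    by rewrite /GRing.scale/= mulr1.
  have d1 : is_derive x 1 (fun y => p.[y^-1]) (p^`().[x^-1] * - x ^- 2).
    exact: (@is_derive1_comp _ (horner p) (fun y => y^-1)).
  have d2 : is_derive x 1 (fun y => expR (- y^-1)) (expR (- x^-1) * x ^- 2).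
    have dN : is_derive x 1 (fun y => - y^-1) (x ^- 2).
      by have := is_deriveN dV; rewrite opprK.
    exact: (@is_derive1_comp _ expR (fun y => - y^-1)).
  have d : is_derive x 1 (fun y => p.[y^-1] * expR (- y^-1))
      (('X^2 * (p - p^`())).[x^-1] * expR (- x^-1)).
    apply: (is_derive_eq (is_deriveM d1 d2)).
    rewrite /GRing.scale/= !hornerE exprVn/=.
    ring.
  apply: near_eq_is_derive d.
  near=> y; rewrite /flat ifT//; near: y; exact: lt_nbhsr.
- rewrite x0 [flat (_ * _) 0]/flat ltxx.
  (* The difference quotient of [flat p] at 0 is [flat ('X * p)], hence of order [h]. *)
  have [C C0 hC] := flat_le ('X * p).
  suff : (fun h : R => h^-1 *: (flat p (h *: 1 + 0) - flat p 0)) @ 0^' --> 0.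
    move=> h; apply: DeriveDef; first by apply/cvg_ex; exists 0.
    exact: cvg_lim h.
  apply/cvgr0Pnorm_le => e e0.
  near=> h.
  have h0 : h != 0 by near: h; exact: nbhs_dnbhs_neq.
  rewrite addr0 [h *: 1]mulr1 {2}/flat ltxx subr0.
  apply: (@le_trans _ _ (C * `|h|)).
    apply: le_trans (hC h); rewrite /flat; case: ifP => _; last by rewrite scaler0 normr0.
    by rewrite hornerM hornerX /GRing.scale/= mulrA.
  have : `|h| <= e / (C + 1).
    near: h; apply: dnbhs0_le.
    by rewrite divr_gt0// ltr_wpDl.
  rewrite ler_pdivlMr ?ltr_wpDl// mulrC; apply: le_trans.
  by rewrite ler_wpM2r// lerDl.
Unshelve. all: by end_near. Qed.

Lemma flat1_ge0 x : 0 <= flat 1 x.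
Proof. by rewrite /flat; case: ifP => //; rewrite hornerC mul1r expR_ge0. Qed.

Lemma flat1_le1 x : flat 1 x <= 1.
Proof.
rewrite /flat; case: ifPn => // x0.
by rewrite hornerC mul1r expR_le1 oppr_le0 invr_ge0 ltW.
Qed.

Lemma flat1_gt0 x : (0 < flat 1 x) = (0 < x).
Proof.
rewrite /flat; case: ifP; last by rewrite ltxx.
by rewrite hornerC mul1r expR_gt0.
Qed.

(** A smooth approximation of the indicator of the half-line, from which all cutoffs are made. *)
Lemma cvg_flat1 x : flat 1 (k.+1%:R * x) @[k --> \oo] --> ((0 < x)%R%:R : R).
Proof.
have [x0|x0] := ltP 0 x; last first.
  rewrite (_ : (fun k => _) = cst 0); first exact: cvg_cst.
  by apply/funext => k; rewrite /flat ltNge mulr_ge0_le0.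
rewrite (_ : (fun k => _) = fun k => expR (- (harmonic k * x^-1))); last first.
  by apply/funext => k; rewrite /flat hornerC mul1r mulr_gt0// invfM.
rewrite -expR0; apply: continuous_cvg; first exact: continuous_expR.
rewrite -oppr0; apply: cvgN; rewrite -(mul0r x^-1).
by apply: cvgM; [exact: cvg_harmonic | exact: cvg_cst].
Qed.

End flat_functions.

(** * An algebra of explicit smooth functions *)

Section smooth_algebra.
Context (R : realType) (n : nat).
Local Notation E := 'rV[R]_n.

(** A family closed under partial derivatives, so that one induction yields all orders. The
    predicate [smooth] speaks of partial derivatives only, whereas members of this family are
    differentiable, which the chain rule for [flat] requires. *)
Inductive smooth_alg : (E -> R) -> Prop :=
| smooth_alg_coord i : smooth_alg (fun x => x ord0 i)
| smooth_alg_cst c : smooth_alg (fun=> c)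
| smooth_alg_add f g : smooth_alg f -> smooth_alg g -> smooth_alg (fun x => f x + g x)
| smooth_alg_mul f g : smooth_alg f -> smooth_alg g -> smooth_alg (fun x => f x * g x)
| smooth_alg_flat p f : smooth_alg f -> smooth_alg (fun x => flat p (f x)).

Lemma smooth_alg_partial f : smooth_alg f ->
  (forall x, differentiable f x) /\ forall j, smooth_alg (partial j f).
Proof.
elim=> [i|c|{}f g sf [df pf] sg [dg pg]|{}f g sf [df pf] sg [dg pg]|p {}f sf [df pf]].
- split=> [x|j]; first exact: differentiable_coord.
  rewrite (_ : partial j _ = fun=> (delta_mx ord0 j : E) ord0 i); first exact: smooth_alg_cst.
  apply/funext => x; rewrite /partial.
  have := @derive_mx _ _ _ _ (id : E -> E) x (delta_mx ord0 j) (@derivable_id _ _ _ _).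
  by rewrite derive_id => /matrixP/(_ ord0 i); rewrite !mxE.
- split=> [x|j]; first exact: differentiable_cst.
  rewrite (_ : partial j _ = fun=> 0); first exact: smooth_alg_cst.
  by apply/funext => x; rewrite /partial derive_cst.
- split=> [x|j]; first exact: differentiableD.
  rewrite (_ : partial j _ = fun x => partial j f x + partial j g x).
    exact: smooth_alg_add.
  by apply/funext => x; rewrite /partial deriveD//; exact: diff_derivable.
- split=> [x|j]; first exact: differentiableM.
  rewrite (_ : partial j _ = fun x => f x * partial j g x + g x * partial j f x).
    by apply: smooth_alg_add; exact: smooth_alg_mul.
  by apply/funext => x; rewrite /partial deriveM//; exact: diff_derivable.
- have dflat q y : differentiable (flat q) y.
    by apply/derivable1_diffP; case: (is_derive_flat q y).
  split=> [x|j]; first by apply: (@differentiable_comp _ _ _ _ f (flat p)).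
  rewrite (_ : partial j _ = fun x => flat ('X^2 * (p - p^`())) (f x) * partial j f x).
    by apply: smooth_alg_mul => //; exact: smooth_alg_flat.
  apply/funext => x; rewrite /partial.
  have -> : (fun x => flat p (f x)) = flat p \o f by [].
  rewrite !deriveE//; last exact: differentiable_comp.
  rewrite diff_comp//= deriv1E; last by case: (is_derive_flat p (f x)).
  rewrite derive1E mulrC; congr (_ * _).
  by case: (is_derive_flat p (f x)).
Qed.

Lemma smooth_alg_smooth f : smooth_alg f -> smooth f.
Proof.
move=> sf s; have {}sf : smooth_alg (foldr (@partial R n) f s).
  by elim: s => //= j s ih; have [_] := smooth_alg_partial ih; apply.
have [df _] := smooth_alg_partial sf; split=> [x|x j].
  exact: differentiable_continuous.
exact: diff_derivable.
Qed.

Lemma smoothD (f g : E -> R) : smooth f -> smooth g -> smooth (fun x => f x + g x).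
Proof.
move=> sf sg s.
have -> : foldr (@partial R n) (fun x => f x + g x) s =
    foldr (@partial R n) f s + foldr (@partial R n) g s.
  elim: s => //= j s ->; apply/funext => x; rewrite /partial deriveD//.
  - by have [_] := sf s; apply.
  - by have [_] := sg s; apply.
have [cf df] := sf s; have [cg dg] := sg s; split=> [x|x j].
  by apply: continuousD; [exact: cf|exact: cg].
exact: derivableD.
Qed.

Lemma smoothZ (c : R) (f : E -> R) : smooth f -> smooth (fun x => c * f x).
Proof.
move=> sf s.
have -> : foldr (@partial R n) (fun x => c * f x) s =
    c \*: foldr (@partial R n) f s.
  elim: s => //= j s ->; apply/funext => x; rewrite /partial deriveZ//.
  by have [_] := sf s; apply.
have [cf df] := sf s; split=> [x|x j].
  by apply: continuousM; [exact: cst_continuous | exact: cf].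
exact: derivableZ.
Qed.

Lemma smooth_partial j (f : E -> R) : smooth f -> smooth (partial j f).
Proof. by move=> sf s; have := sf (rcons s j); rewrite foldr_rcons. Qed.

End smooth_algebra.

(** * Approximation of indicators by smooth cutoffs within a cube *)

Section ball_approximation.
Context (R : realType) (n : nat).
Local Notation E := 'rV[R]_n.
Local Notation mu := (lebesgue R n).
Variables (c : E) (r : R).
Hypothesis r0 : 0 < r.
Local Notation Q := (ball c r : set (matrix R 1 n)).
Implicit Types f g phi psi : E -> R.

Definition unit_fun f :=
  [/\ Lmeasurable setT f, forall x, 0 <= f x <= 1 & forall x, ~ Q x -> f x = 0].

Definition cutoff f :=
  [/\ smooth_alg f, forall x, 0 <= f x <= 1 & forall x, ~ Q x -> f x = 0].

Local Notation dist := (@L1dist _ (lebesgue_space R n) R mu).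

(** Values in [[0, 1]] and vanishing off the cube are part of the notion: they make products stable
    and give a common dominating function. *)
Definition approximable f := unit_fun f /\
  forall e : R, 0 < e -> exists2 phi, cutoff phi & (dist f phi <= e%:E)%E.

Lemma smooth_alg_continuous f : smooth_alg f -> continuous f.
Proof.
by move=> /smooth_alg_partial[df _] x; exact: differentiable_continuous.
Qed.

Lemma cutoff_unit phi : cutoff phi -> unit_fun phi.
Proof.
move=> [sp p01 pQ]; split => //.
by apply: lebesgue_continuous_measurable; [exact: openT | exact: smooth_alg_continuous].
Qed.

Lemma approximable_cutoff phi : cutoff phi -> approximable phi.
Proof.
move=> cp; split; first exact: cutoff_unit.
move=> e e0; exists phi => //.
by rewrite L1dist_id lee_fin ltW.
Qed.

Lemma LmeasurableM f g :
  Lmeasurable setT f -> Lmeasurable setT g -> Lmeasurable setT (fun x => f x * g x).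
Proof. exact: (@measurable_funM _ (lebesgue_space R n) R setT f g). Qed.

Lemma unit_funM f g : unit_fun f -> unit_fun g -> unit_fun (fun x => f x * g x).
Proof.
move=> [mf f01 fQ] [mg g01 gQ]; split; first exact: LmeasurableM.
- move=> x; have /andP[f0 f1] := f01 x; have /andP[g0 g1] := g01 x.
  by rewrite mulr_ge0//= mulr_ile1.
- by move=> x /fQ ->; rewrite mul0r.
Qed.

Lemma cutoffM phi psi : cutoff phi -> cutoff psi -> cutoff (fun x => phi x * psi x).
Proof.
move=> cp cq; have [_ h01 hQ] := unit_funM (cutoff_unit cp) (cutoff_unit cq).
by split => //; case: cp cq => sp _ _ [sq _ _]; exact: smooth_alg_mul.
Qed.

Lemma approximableM f g :
  approximable f -> approximable g -> approximable (fun x => f x * g x).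
Proof.
move=> [uf af] [ug ag]; split; first exact: unit_funM.
move=> e e0; have e20 : 0 < e / 2 by rewrite divr_gt0.
have [phi cp hp] := af _ e20; have [psi cq hq] := ag _ e20.
exists (fun x => phi x * psi x); first exact: cutoffM.
have [mf f01 _] := uf; have [mg g01 _] := ug.
have [mp p01 _] := cutoff_unit cp; have [mq q01 _] := cutoff_unit cq.
apply: (@le_trans _ _ (dist f phi + dist g psi)%E); last first.
  by rewrite (splitr e) EFinD leeD.
apply: (@L1dist_le _ (lebesgue_space R n) R mu _ _ f phi g psi
  (LmeasurableM mf mg) (LmeasurableM mp mq) mf mp mg mq) => x.
have -> : f x * g x - phi x * psi x =
    (f x - phi x) * g x + phi x * (g x - psi x) by ring.
have /andP[g0 g1] := g01 x; have /andP[p0 p1] := p01 x.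
apply: (le_trans (ler_normD _ _)); rewrite !normrM (ger0_norm g0) (ger0_norm p0).
by rewrite lerD// ?ler_piMr ?ler_piMl.
Qed.

(* By dominated convergence, the indicator of [Q] being the dominating function. *)
Lemma approximable_lim (f_ : nat -> E -> R) f : (forall k, approximable (f_ k)) ->
  (forall x, f_ ^~ x @ \oo --> f x) -> approximable f.
Proof.
move=> af cf.
have mf : Lmeasurable setT f.
  apply: (@measurable_fun_cvg _ (lebesgue_space R n) R setT f_ f); last by move=> x _; exact: cf.
  by move=> k; case: (af k) => -[].
have uf : unit_fun f.
  split => // [x|x Qx]; last first.
    apply/esym; rewrite -(cvg_lim _ (cf x))//; apply/esym.
    rewrite (_ : f_ ^~ x = cst 0) ?lim_cst//.
    by apply/funext => k; case: (af k) => -[_ _ ->].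
  apply/andP; split.
  - rewrite -(cvg_lim _ (cf x))//; apply: limr_ge; first exact: cvgP (cf x).
    near=> k; by have [[_ /(_ x)/andP[]]] := af k.
  - rewrite -(cvg_lim _ (cf x))//; apply: limr_le; first exact: cvgP (cf x).
    near=> k; by have [[_ /(_ x)/andP[]]] := af k.
split => // e e0; have e20 : 0 < e / 2 by rewrite divr_gt0.
have [k hk] : exists k, (dist f (f_ k) <= (e / 2)%:E)%E.
  apply: (@L1dist_dominated _ (lebesgue_space R n) R mu Q) => //.
  - exact: borel_lebesgue_measurable (measurable_rV_ball c r).
  - exact: lebesgue_ball_lty.
  - by move=> k; case: (af k) => -[].
  - move=> k x; have [[_ /(_ x)/andP[h0 h1] hQ] _] := af k; rewrite indicE.
    rewrite ger0_norm//; have [Qx|Qx] := pselect (Q x); first by rewrite mem_set.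
    by rewrite hQ.
have [[mk _ _] /(_ _ e20)[phi cp hp]] := af k.
exists phi => //; apply: (@le_trans _ _ (dist f (f_ k) + dist (f_ k) phi)%E).
  have [mp _ _] := cutoff_unit cp.
  by apply: (@L1dist_le _ (lebesgue_space R n) R mu) => // x; exact: ler_distD.
by rewrite (splitr e) EFinD leeD.
Unshelve. all: by end_near. Qed.

(** A smooth function that is positive exactly on the cube; composing it with steeper and steeper
    copies of [flat 1] gives the cutoffs [cut k], which tend to the indicator of the cube. *)
Definition ball_bump (x : E) : R := \prod_(j < n) flat 1 (r ^+ 2 - (x ord0 j - c ord0 j) ^+ 2).

Lemma ball_bump_gt0 x : (0 < ball_bump x) = (x \in Q).
Proof.
have pos j : (0 < flat 1 (r ^+ 2 - (x ord0 j - c ord0 j) ^+ 2)) =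
    (`|c ord0 j - x ord0 j| < r).
  rewrite flat1_gt0 subr_gt0 distrC -[RHS]ltr_sqr ?nnegrE ?(ltW r0)//.
  by rewrite real_normK ?num_real.
apply/idP/idP => [h|].
  rewrite inE; apply/rV_ball; split=> // j; rewrite -pos lt_neqAle flat1_ge0 andbT.
  apply/negP => /eqP h0; move: h.
  by rewrite /ball_bump (bigD1 j)//= -h0 mul0r ltxx.
by rewrite inE => /rV_ball[_ h]; apply: prodr_gt0 => j _; rewrite pos.
Qed.

Lemma smooth_alg_ball_bump : smooth_alg ball_bump.
Proof.
rewrite /ball_bump; elim: (index_enum _) => [|j s ih].
  rewrite (_ : (fun x => _) = fun=> 1); first exact: smooth_alg_cst.
  by apply/funext => x; rewrite big_nil.
rewrite (_ : (fun x => _) = fun x : E => flat 1 (r ^+ 2 + (- 1) *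
    ((x ord0 j + - c ord0 j) * (x ord0 j + - c ord0 j))) *
    \prod_(i <- s) flat 1 (r ^+ 2 - (x ord0 i - c ord0 i) ^+ 2)); last first.
  by apply/funext => x; rewrite big_cons mulN1r -expr2.
apply: smooth_alg_mul => //; apply: smooth_alg_flat.
apply: smooth_alg_add; first exact: smooth_alg_cst.
apply: smooth_alg_mul; first exact: smooth_alg_cst.
by apply: smooth_alg_mul; apply: smooth_alg_add;
  (exact: smooth_alg_coord || exact: smooth_alg_cst).
Qed.

Let cut k x := flat 1 (k.+1%:R * ball_bump x).

Let cutP k : cutoff (cut k).
Proof.
split => [|x|x Qx].
- apply: smooth_alg_flat; apply: smooth_alg_mul; first exact: smooth_alg_cst.
  exact: smooth_alg_ball_bump.
- by rewrite flat1_ge0 flat1_le1.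
- rewrite /cut /flat ifF//; apply/negbTE; rewrite -leNgt.
  rewrite mulr_ge0_le0// leNgt ball_bump_gt0.
  by apply/negP; rewrite inE.
Qed.

Let cut_cvg x : cut ^~ x @ \oo --> (\1_Q x : R).
Proof. by rewrite indicE -ball_bump_gt0; exact: cvg_flat1. Qed.

Lemma approximable_ball : approximable \1_Q.
Proof.
apply: (approximable_lim (f_ := cut)) => // k.
exact: approximable_cutoff.
Qed.

(** The complement is taken within the cube. Since the indicator of the cube is not smooth, it is
    approximated too, by [chi]. *)
Lemma approximableC f : approximable f -> approximable (fun x => \1_Q x * (1 - f x)).
Proof.
move=> [uf af]; have [[mQ Q01 QQ] aQ] := approximable_ball.
have mC g : Lmeasurable setT g -> Lmeasurable setT (fun x => 1 - g x).
  exact: (@measurable_funB _ (lebesgue_space R n) R setT (cst 1) g (measurable_cst _)).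
have [mf f01 fQ] := uf.
split.
  split; first exact: LmeasurableM (mC _ mf).
  - move=> x; have /andP[? ?] := f01 x; have /andP[? ?] := Q01 x.
    by rewrite mulr_ge0 ?subr_ge0//= mulr_ile1// ?subr_ge0// lerBlDr lerDl.
  - by move=> x /QQ ->; rewrite mul0r.
move=> e e0; have e20 : 0 < e / 2 by rewrite divr_gt0.
have [phi cp hp] := af _ e20; have [chi cq hq] := aQ _ e20.
have [mp p01 pQ] := cutoff_unit cp; have [mq q01 qQ] := cutoff_unit cq.
exists (fun x => chi x * (1 + (- 1) * phi x)).
  split => [|x|x /qQ ->]; last by rewrite mul0r.
  - have [sp _ _] := cp; have [sq _ _] := cq.
    apply: smooth_alg_mul => //; apply: smooth_alg_add; first exact: smooth_alg_cst.
    by apply: smooth_alg_mul => //; exact: smooth_alg_cst.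
  - have /andP[? ?] := p01 x; have /andP[? ?] := q01 x.
    by rewrite mulN1r mulr_ge0 ?subr_ge0//= mulr_ile1// ?subr_ge0// lerBlDr lerDl.
apply: (@le_trans _ _ (dist \1_Q chi + dist f phi)%E); last first.
  by rewrite (splitr e) EFinD leeD.
have -> : (fun x => chi x * (1 + -1 * phi x)) = (fun x => chi x * (1 - phi x)).
  by apply/funext => x; rewrite mulN1r.
apply: (@L1dist_le _ (lebesgue_space R n) R mu _ _ \1_Q chi f phi
  (LmeasurableM mQ (mC _ mf)) (LmeasurableM mq (mC _ mp)) mQ mq mf mp) => x.
have -> : \1_Q x * (1 - f x) - chi x * (1 - phi x) =
    (\1_Q x - chi x) * (1 - f x) + chi x * (phi x - f x) by ring.
have /andP[f0 f1] := f01 x; have /andP[q0 q1] := q01 x.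
have f1' : 0 <= 1 - f x by rewrite subr_ge0.
apply: (le_trans (ler_normD _ _)); rewrite !normrM (ger0_norm f1') (ger0_norm q0).
rewrite (distrC (phi x)); apply: lerD; first by rewrite ler_piMr// lerBlDr lerDl.
by rewrite ler_piMl.
Qed.

(** The factor [\1_Q] lets [A] range over all sets, so that these sets form a sigma-algebra on the
    whole space. *)
Definition approx_set (A : set E) := approximable (fun x => \1_A x * \1_Q x).

Let indic_in (A : set E) x : A x -> \1_A x = 1 :> R.
Proof. by move=> Ax; rewrite indicE mem_set. Qed.

Let indic_notin (A : set E) x : ~ A x -> \1_A x = 0 :> R.
Proof. by move=> Ax; rewrite indicE memNset. Qed.

Lemma approx_setC A : approx_set A -> approx_set (~` A).
Proof.
move=> /approximableC; congr approximable; apply/funext => x.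
have [Qx|Qx] := pselect (Q x); last by rewrite (indic_notin Qx) mul0r mulr0.
rewrite (indic_in Qx) !mulr1 mul1r.
have [Ax|Ax] := pselect (A x); first by rewrite indic_in// indic_notin ?subrr//; apply.
by rewrite indic_notin// indic_in// subr0.
Qed.

Lemma approx_setI A B : approx_set A -> approx_set B -> approx_set (A `&` B).
Proof.
move=> aA aB; have := approximableM aA aB; congr approximable.
apply/funext => x; rewrite indicI/= -!mulrA; congr (_ * _).
rewrite mulrCA; congr (_ * _).
by have [Qx|Qx] := pselect (Q x); [rewrite indic_in// mulr1|rewrite indic_notin// mulr0].
Qed.

Lemma approx_setT : approx_set setT.
Proof.
have := approximable_ball; congr approximable; apply/funext => x.
by rewrite indicT/= mul1r.
Qed.

(** A countable union is the complement of a countable intersection, whose indicator is the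
    pointwise limit of those of the finite intersections [B N]; [approximable_lim] applies. *)
Lemma approx_set_sigma_algebra : sigma_algebra setT approx_set.
Proof.
split.
- by rewrite -setCT; exact: approx_setC approx_setT.
- by move=> A aA; rewrite setTD; exact: approx_setC.
move=> A aA; rewrite -[X in approx_set X]setCK; apply: approx_setC.
rewrite setC_bigcup.
pose B N := \bigcap_(i in [set k | (k < N)%N]) ~` A i.
have aB N : approx_set (B N).
  elim: N => [|N ih].
    rewrite (_ : B 0%N = setT); first exact: approx_setT.
    by apply/seteqP; split => // x _ i.
  rewrite (_ : B N.+1 = B N `&` ~` A N); first exact: approx_setI (approx_setC _).
  apply/seteqP; split => x.
    by move=> h; split; [move=> i /= iN; apply: h; exact: ltnW | apply: h => /=].
  by move=> [h1 h2] i /=; rewrite ltnS leq_eqVlt => /predU1P[->//|]; exact: h1.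
apply: (approximable_lim aB) => x.
apply: cvg_near_cst.
have [h|h] := pselect ((\bigcap_i ~` A i) x).
  near=> N; rewrite (indic_in h); congr (_ * _).
  by apply: indic_in => i _; exact: h.
have [i Ai] : exists i, A i x.
  by apply: contrapT => h2; apply: h => i _ Ai; apply: h2; exists i.
near=> N; rewrite (indic_notin h) (indic_notin (A := B N))//.
move=> /(_ i); apply => //=; near: N; exact: nbhs_infty_gt.
Unshelve. all: by end_near. Qed.

(** Half-spaces generate the Borel sets, and their indicators are limits of explicit cutoffs. *)
Lemma approx_set_ray i (a : R) : approx_set [set x : E | a < x ord0 i].
Proof.
apply: (approximable_lim (f_ := fun k x => flat 1 (k.+1%:R * (x ord0 i + - a)) * cut k x)).
  move=> k; apply: approximable_cutoff; have [s01 h01 hQ] := cutP k.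
  split => [|x|x /hQ ->]; last by rewrite mulr0.
  - apply: smooth_alg_mul => //; apply: smooth_alg_flat.
    apply: smooth_alg_mul; first exact: smooth_alg_cst.
    by apply: smooth_alg_add; [exact: smooth_alg_coord|exact: smooth_alg_cst].
  - have /andP[? ?] := h01 x.
    by rewrite mulr_ge0 ?flat1_ge0//= mulr_ile1// ?flat1_ge0 ?flat1_le1.
move=> x; apply: cvgM; last exact: cut_cvg.
have := @cvg_flat1 R (x ord0 i - a); rewrite subr_gt0 indicE.
by rewrite (_ : (x \in [set y : E | a < y ord0 i]) = (a < x ord0 i))//; apply/idP/idP; rewrite inE.
Qed.

Lemma approx_set_measurable (A : set E) : measurable A -> approx_set A.
Proof.
apply: (smallest_sub approx_set_sigma_algebra).
move=> B; rewrite -bigcup_seq => -[i _ [Y mY <-]]; rewrite setTI.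
have mE : (measurable : set (set (measurableTypeR R))) = <<s @RGenOInfty.G R >>.
  exact: RGenOInfty.measurableE.
suff h : <<s @RGenOInfty.G R >> `<=`
    [set Y : set R | approx_set ((fun x : E => x ord0 i) @^-1` Y)].
  by apply: h; rewrite -mE.
apply: smallest_sub; last first.
  move=> _ [a ->]; rewrite /= (_ : _ @^-1` _ = [set x : E | a < x ord0 i]); first exact: approx_set_ray.
  by apply/seteqP; split => x /=; rewrite in_itv/= andbT.
have [a0 aC aU] := approx_set_sigma_algebra.
split => /=; first by rewrite preimage_set0.
- by move=> Z /aC; rewrite !setTD preimage_setC.
- by move=> F /aU; rewrite preimage_bigcup.
Qed.

(** A Lebesgue set in the cube has a Borel hull that differs from it by a null set, which the
    distance does not see. *)
Lemma cutoff_approx (A : set E) (e : R) :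
  measurable (A : set (lebesgue_space R n)) -> A `<=` Q -> 0 < e ->
  exists2 phi, cutoff phi & (dist \1_A phi <= e%:E)%E.
Proof.
move=> mA AQ e0.
have mQ := measurable_rV_ball c r.
have [G [mG AG GQ GA0]] := lebesgue_borel_hull mA mQ AQ (lebesgue_ball_lty c r0).
have [_ /(_ _ e0)[phi cp hp]] := approx_set_measurable mG.
exists phi => //; apply: le_trans hp.
have [mp _ _] := cutoff_unit cp.
have mGL := borel_lebesgue_measurable mG.
have E1 : (fun x => \1_G x * \1_Q x) = \1_G :> (E -> R).
  apply/funext => x; have [Gx|Gx] := pselect (G x); last by rewrite (indic_notin Gx) mul0r.
  by rewrite (indic_in (GQ _ Gx)) mulr1.
rewrite E1.
have m1A : Lmeasurable setT (\1_A : E -> R) by exact: measurable_indic.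
have m1G : Lmeasurable setT (\1_G : E -> R) by exact: measurable_indic.
have mN : measurable (G `\` A : set (lebesgue_space R n)) by exact: measurableD.
rewrite -[leRHS]add0e.
have <- : dist \1_A \1_G = 0%E.
  rewrite /L1dist (_ : (fun x => `|\1_A x - \1_G x|%:E) = (fun x => (\1_(G `\` A) x)%:E)).
    by rewrite integral_indic// setIT.
  apply/funext => x; congr (_%:E); rewrite !indicE in_setD.
  have [Ax|Ax] := boolP (x \in A).
    by rewrite mem_set; [rewrite subrr normr0|apply: AG; exact: set_mem].
  by rewrite sub0r normrN andbT ger0_norm.
by apply: (@L1dist_le _ (lebesgue_space R n) R mu) => // x; exact: ler_distD.
Qed.

End ball_approximation.

(** * Test functions *)

Section Rintegral_ae.
Context d (T : measurableType d) (R : realType) (mu : {measure set T -> \bar R}).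
Variable D : set T.
Hypothesis mD : measurable D.
Implicit Types f g : T -> R.

Lemma Rintegral_ae_eq f g : measurable_fun D f -> measurable_fun D g ->
  {ae mu, forall x, D x -> f x = g x} ->
  \int[mu]_(x in D) f x = \int[mu]_(x in D) g x.
Proof.
move=> mf mg h; rewrite /Rintegral; congr fine.
apply: ae_eq_integral => //; try exact/measurable_EFinP.
by apply: filterS h => x h Dx; rewrite h.
Qed.

(** The function [max f g] dominates [f] everywhere and equals [g] almost everywhere. *)
Lemma ae_le_Rintegral f g : mu.-integrable D (EFin \o f) -> mu.-integrable D (EFin \o g) ->
  {ae mu, forall x, D x -> f x <= g x} ->
  \int[mu]_(x in D) f x <= \int[mu]_(x in D) g x.
Proof.
move=> intf intg h.
have mf : measurable_fun D f by apply/measurable_EFinP; exact: measurable_int intf.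
have mg : measurable_fun D g by apply/measurable_EFinP; exact: measurable_int intg.
have mm : measurable_fun D (fun x => Num.max (f x) (g x)) by exact: measurable_maxr.
have e : {ae mu, forall x, D x -> Num.max (f x) (g x) = g x}.
  by apply: filterS h => x h Dx; apply/max_idPr; exact: h.
have intm : mu.-integrable D (EFin \o (fun x => Num.max (f x) (g x))).
  apply: (@le_integrable _ _ _ _ _ mD _ (fun x => `|(EFin \o f) x| + `|(EFin \o g) x|)%E).
  - exact/measurable_EFinP.
  - move=> x _ /=; rewrite lee_fin [leRHS]ger0_norm ?addr_ge0//.
    by rewrite /Num.max; case: ifP => _; rewrite ?lerDl ?lerDr.
  - by apply: integrableD => //; exact: integrable_abse.
rewrite -(Rintegral_ae_eq mm mg e); apply: le_Rintegral => // x _.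
by rewrite le_max lexx.
Qed.

Lemma sqint_bounded_support (Q : set T) f M : measurable Q -> (mu Q < +oo)%E ->
  measurable_fun D f -> (forall x, `|f x| <= M) -> (forall x, ~ Q x -> f x = 0) ->
  sqint mu D f.
Proof.
move=> mQ Qoo mf fM fQ.
have int1 : mu.-integrable D (EFin \o (\1_Q : T -> R)).
  apply/integrableP; split; first by apply/measurable_EFinP; exact: measurable_indic.
  under eq_integral do rewrite /= ger0_norm//.
  rewrite integral_indic//; apply: le_lt_trans Qoo.
  by rewrite le_measure ?inE//; exact: measurableI.
split => //; apply: le_integrable (integrableZl mD (M ^+ 2) int1) => //.
  by apply/measurable_EFinP; exact: measurable_funX.
move=> x _ /=; rewrite lee_fin [leLHS]ger0_norm ?sqr_ge0//.
apply: le_trans (ler_norm _); rewrite indicE.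
have [Qx|Qx] := pselect (Q x); last by rewrite fQ// expr0n mulr_ge0// sqr_ge0.
rewrite mem_set//= mulr1 -(real_normK (num_real (f x))) ler_sqr ?nnegrE//.
exact: le_trans (fM x).
Qed.

(** Orthogonality turns the integral of [f] over [A] into that of [f * (\1_A - phi)], which is
    small; but [f > 0] on [A]. *)
Lemma sqint_orthogonal_ae (A : set T) f : sqint mu D f -> measurable A -> A `<=` D ->
  (mu A < +oo)%E -> (forall x, A x -> 0 < f x) ->
  (forall e : R, 0 < e -> exists phi : T -> R, [/\ measurable_fun setT phi,
    forall x, 0 <= phi x <= 1, sqint mu D phi, (L1dist mu \1_A phi <= e%:E)%E &
    \int[mu]_(x in D) (f x * phi x) = 0]) ->
  {ae mu, forall x, ~ A x}.
Proof.
move=> sf mA AD Aoo fA H.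
have [mf intf] := sf.
have m1 : measurable_fun setT (\1_A : T -> R) by exact: measurable_indic.
have s1 : sqint mu D \1_A.
  apply: sqint_lty => //.
  rewrite (eq_integral (fun x => (\1_A x)%:E)); last first.
    by move=> x _; rewrite indicE; case: (_ \in _); rewrite ?expr1n ?expr0n.
  by rewrite integral_indic// setIidl.
have int1 := sqint_mul mD sf s1.
have le0 : \int[mu]_(x in D) (f x * \1_A x) <= 0.
  apply/ler_addgt0Pr => e e0; rewrite add0r.
  pose I := \int[mu]_(x in D) (f x ^+ 2).
  have I0 : 0 <= I by apply: Rintegral_ge0 => x _; exact: sqr_ge0.
  (* With distance at most [t * t], and [w ^+ 2 <= |w|] for [w = \1_A - phi], the inequality
     [f w <= t f^2 + w^2 / t] bounds the integral by [t * I + t = e]. *)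
  pose t := e / (I + 1); have t0 : 0 < t by rewrite divr_gt0// ltr_wpDl.
  have [phi [mp p01 sp hp ort]] := H (t * t) (mulr_gt0 t0 t0).
  have intp := sqint_mul mD sf sp.
  have -> : \int[mu]_(x in D) (f x * \1_A x) =
      \int[mu]_(x in D) (f x * \1_A x - f x * phi x) by rewrite RintegralB// ort subr0.
  have md : measurable_fun setT (fun x => `|\1_A x - phi x|).
    by apply: measurableT_comp => //; exact: measurable_funB.
  have intd : mu.-integrable D (EFin \o (fun x => `|\1_A x - phi x|)).
    apply: (@integrableS _ _ _ _ setT) => //; apply/integrableP; split.
      exact/measurable_EFinP.
    by under eq_integral do rewrite /= normr_id; exact: le_lt_trans hp (ltry _).
  apply: (@le_trans _ _ (\int[mu]_(x in D) (t * f x ^+ 2 + t^-1 * `|\1_A x - phi x|))).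
    apply: le_Rintegral => //.
    - exact: (@integrableB _ _ _ mu D mD _ _ int1 intp).
    - by apply: (integrableD mD (integrableZl mD t intf) (integrableZl mD t^-1 intd)).
    move=> x _; rewrite -mulrBr.
    have /andP[q0 q1] := p01 x.
    have w1 : `|\1_A x - phi x| <= 1.
      rewrite indicE; case: (x \in A) => /=; rewrite ler_norml; lra.
    have w2 : (\1_A x - phi x) ^+ 2 <= `|\1_A x - phi x|.
      by rewrite -real_normK ?num_real// expr2 ler_piMl.
    apply: (@le_trans _ _ (t * f x ^+ 2 + t^-1 * (\1_A x - phi x) ^+ 2)); last first.
      by rewrite lerD2l ler_wpM2l// invr_ge0 ltW.
    rewrite -subr_ge0; set w := _ - phi x.
    rewrite (_ : _ - _ = t^-1 * ((t * f x - w / 2) ^+ 2 + 3 / 4 * w ^+ 2)); last first.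
      by field; rewrite gt_eqF.
    apply: mulr_ge0; first by rewrite invr_ge0 ltW.
    by apply: addr_ge0; [exact: sqr_ge0 | apply: mulr_ge0 => //; exact: sqr_ge0].
  rewrite RintegralD//; last 2 first.
  - exact: (integrableZl mD t intf).
  - exact: (integrableZl mD t^-1 intd).
  rewrite !RintegralZl// -/I.
  have hd : \int[mu]_(x in D) `|\1_A x - phi x| <= t * t.
    rewrite -lee_fin /Rintegral fineK ?integrable_fin_num//; apply: le_trans hp.
    apply: ge0_subset_integral => //.
    exact/measurable_EFinP.
  apply: (@le_trans _ _ (t * I + t^-1 * (t * t))).
    by rewrite lerD2l ler_wpM2l// invr_ge0 ltW.
  rewrite mulrA mulVf ?gt_eqF// mul1r -[X in _ + X]mulr1 -mulrDr /t divfK//.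
  by rewrite gt_eqF// ltr_wpDl.
have abs0 : (\int[mu]_(x in D) `|(f x * \1_A x)%:E| = 0)%E.
  rewrite (eq_integral (fun x => (f x * \1_A x)%:E)); last first.
    move=> x _ /=; rewrite ger0_norm// indicE; case: (boolP (x \in A)) => xA; last by rewrite mulr0.
    by rewrite mulr1 ltW// fA//; exact: set_mem.
  apply/eqP; rewrite eq_le integral_ge0//.
    by rewrite -(fineK (integrable_fin_num mD int1)) lee_fin le0.
  move=> x _; rewrite lee_fin indicE; case: (boolP (x \in A)) => xA; last by rewrite mulr0.
  by rewrite mulr1 ltW// fA//; exact: set_mem.
have := (ae_eq_integral_abs mu mD (measurable_int _ int1)).1 abs0.
apply: filterS => x h Ax; have := h (AD _ Ax) => /= -[] /eqP.
by rewrite indicE mem_set// mulr1 gt_eqF// fA.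
Qed.

(** Almost everywhere [f phi^2 <= - kappa 1_A + 2 M' |1_A - phi|], and the choice of [e] limits the
    integral of the last term to half of [kappa * mu A]. *)
Lemma bounded_negative_direction (A : set T) f (M kappa : R) : measurable_fun D f ->
  {ae mu, forall x, D x -> `|f x| <= M} -> measurable A -> A `<=` D ->
  (0 < mu A)%E -> (mu A < +oo)%E -> 0 < kappa -> (forall x, A x -> f x <= - kappa) ->
  exists2 e : R, 0 < e & forall phi : T -> R, measurable_fun setT phi ->
    (forall x, 0 <= phi x <= 1) -> (L1dist mu \1_A phi <= e%:E)%E ->
    \int[mu]_(x in D) (f x * phi x ^+ 2) < 0.
Proof.
move=> mf fM mA AD A0 Aoo k0 fA.
have fin : mu A \is a fin_num by rewrite ge0_fin_numE.
pose m := fine (mu A); have m0 : 0 < m by rewrite fine_gt0// A0.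
pose M' := `|M| + 1; have M0 : 0 < M' by rewrite ltr_wpDl.
pose e := kappa * m / (4 * M').
have e0 : 0 < e by rewrite divr_gt0 ?mulr_gt0.
exists e => // phi mp p01 hp.
have md : measurable_fun setT (fun x => `|\1_A x - phi x|).
  by apply: measurableT_comp => //; apply: measurable_funB => //; exact: measurable_indic.
have intd : mu.-integrable D (EFin \o (fun x => `|\1_A x - phi x|)).
  apply: (@integrableS _ _ _ _ setT) => //; apply/integrableP; split.
    exact/measurable_EFinP.
  by under eq_integral do rewrite /= normr_id; exact: le_lt_trans hp (ltry _).
have int1 : mu.-integrable D (EFin \o (\1_A : T -> R)).
  apply/integrableP; split; first by apply/measurable_EFinP; exact: measurable_indic.
  by under eq_integral do rewrite /= ger0_norm//; rewrite integral_indic// setIidl.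
have mpD : measurable_fun D phi by exact: measurable_funTS.
have sp : sqint mu D phi.
  split=> //; apply: le_integrable (integrableD mD int1 intd) => //.
    by apply/measurable_EFinP; exact: measurable_funX.
  move=> x _ /=; rewrite lee_fin; have /andP[q0 q1] := p01 x.
  rewrite [leLHS]ger0_norm ?exprn_ge0// [leRHS]ger0_norm ?addr_ge0//.
  apply: (@le_trans _ _ (phi x)); first by rewrite expr2 ler_piMl.
  by have := ler_norm (phi x - \1_A x); rewrite distrC; lra.
have intf : mu.-integrable D (EFin \o (fun x => f x * phi x ^+ 2)).
  have := sqint_mul mD (sqint_bounded_mul mD mf fM sp) sp.
  by apply: eq_integrable => // x _ /=; rewrite expr2 mulrA.
have intb := integrableD mD (integrableZl mD (- kappa) int1) (integrableZl mD (2 * M') intd).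
apply: (@le_lt_trans _ _ (\int[mu]_(x in D) (- kappa * \1_A x + 2 * M' * `|\1_A x - phi x|))).
  apply: ae_le_Rintegral => //.
  apply: filterS fM => x h Dx.
  have /andP[q0 q1] := p01 x.
  have fM' : `|f x| <= M'.
    by apply: le_trans (h Dx) _; rewrite /M'; have := ler_norm M; lra.
  have -> : f x * phi x ^+ 2 = f x * \1_A x + f x * (phi x ^+ 2 - \1_A x) by ring.
  apply: lerD.
    rewrite indicE; case: (boolP (x \in A)) => xA; last by rewrite !mulr0.
    by rewrite !mulr1 fA//; exact: set_mem.
  apply: (le_trans (ler_norm _)); rewrite normrM -mulrA.
  have p2 : `|phi x ^+ 2 - \1_A x| <= 2 * `|\1_A x - phi x|.
    rewrite indicE; case: (x \in A) => /=.
      rewrite (_ : phi x ^+ 2 - 1 = - ((1 + phi x) * (1 - phi x))); last by ring.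
      by rewrite normrN normrM ler_wpM2r// ger0_norm; lra.
    by rewrite subr0 sub0r normrN !ger0_norm ?sqr_ge0// expr2 ler_wpM2r//; lra.
  rewrite mulrCA; apply: ler_pM => //.
rewrite RintegralD//; [|exact: (integrableZl mD (- kappa) int1)|exact: (integrableZl mD (2 * M') intd)].
rewrite !RintegralZl//.
have -> : \int[mu]_(x in D) \1_A x = m.
  by rewrite /Rintegral integral_indic// setIidl.
have hd : \int[mu]_(x in D) `|\1_A x - phi x| <= e.
  rewrite -lee_fin /Rintegral fineK ?integrable_fin_num//; apply: le_trans hp.
  apply: ge0_subset_integral => //.
  exact/measurable_EFinP.
have : 2 * M' * \int[mu]_(x in D) `|\1_A x - phi x| <= 2 * M' * e.
  by rewrite ler_wpM2l// mulr_ge0// ltW.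
have -> : 2 * M' * e = kappa * m / 2 by rewrite /e; field; rewrite gt_eqF.
by have := mulr_gt0 k0 m0; lra.
Qed.

End Rintegral_ae.

Section real_test_functions.
Context (R : realType) (n : nat) (Omega : set 'rV[R]_n).
Local Notation E := 'rV[R]_n.
Local Notation mu := (lebesgue R n).
Local Notation L := (lebesgue_space R n).

Definition rtest (f : E -> R) := smooth f /\
  exists K, [/\ compact K, K `<=` Omega & forall x, ~ K x -> f x = 0].

(** The support is enclosed in the closed cube of radius [r], which is compact and lies in the
    doubled open cube. *)
Lemma cutoff_rtest (c : E) (r : R) phi : 0 < r -> ball c (2 * r) `<=` Omega ->
  cutoff c r phi -> rtest phi.
Proof.
move=> r0 cO [sp _ pQ]; split; first exact: smooth_alg_smooth.
exists [set v : E | forall i, `[c ord0 i - r, c ord0 i + r]%classic (v ord0 i)]; split.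
- apply: (@rV_compact R n (fun i => `[c ord0 i - r, c ord0 i + r]%classic)) => i.
  exact: segment_compact.
- move=> x hx; apply: cO; apply/rV_ball; split=> [|i]; first by rewrite mulr_gt0.
  by have := hx i; rewrite /= in_itv/= => /andP[? ?]; rewrite ltr_norml; lra.
move=> x hx; apply: pQ => /rV_ball[_ h]; apply: hx => i.
by have := h i; rewrite /= in_itv/= ltr_norml => /andP[? ?]; lra.
Qed.

Hypothesis oO : open Omega.

Lemma ae_onW (P P' : E -> Prop) : (forall x, Omega x -> P x -> P' x) ->
  ae_on Omega P -> ae_on Omega P'.
Proof.
by move=> h; apply: (@filterS L (almost_everywhere mu) _) => x hx Ox; apply: h => //; exact: hx.
Qed.

Lemma ae_onW2 (P P' P'' : E -> Prop) : (forall x, Omega x -> P x -> P' x -> P'' x) ->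
  ae_on Omega P -> ae_on Omega P' -> ae_on Omega P''.
Proof.
move=> h; apply: (@filterS2 L (almost_everywhere mu) _) => x hx hx' Ox.
by apply: h => //; [exact: hx | exact: hx'].
Qed.

Lemma measurable_Omega : measurable (Omega : set L).
Proof. by apply: borel_lebesgue_measurable; exact: open_measurable_rV. Qed.

(** Null sets are stable under countable unions, so a property may be checked on the cubes of a
    countable cover. *)
Lemma ae_open_ball (P : E -> Prop) :
  (forall (c : E) (r : R), 0 < r -> ball c (2 * r) `<=` Omega ->
    {ae mu, forall x, ball c r x -> P x}) ->
  ae_on Omega P.
Proof.
move=> h; have [F [EF hF]] := open_bigcup_ball oO.
have : {ae mu, forall x, forall k, F k x -> P x}.
  apply: ae_foralln => k; have [->|[c [r [r0 -> cO]]]] := hF k; first exact: aeW.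
  exact: h.
rewrite /ae_on; apply: (@filterS L (almost_everywhere mu) _) => x hx; rewrite {1}EF => -[k _]; exact: hx.
Qed.

Lemma cutoff_sqint (c : E) (r : R) phi : 0 < r -> cutoff c r phi -> @sqint _ L R mu Omega phi.
Proof.
move=> r0 cp; have [mp p01 pQ] := cutoff_unit cp.
have mQ := borel_lebesgue_measurable (measurable_rV_ball c r).
have mpO : measurable_fun (Omega : set L) (phi : L -> R) by exact: (@measurable_funTS _ _ L).
apply: (@sqint_bounded_support _ L R mu Omega measurable_Omega (ball c r) phi 1) => //.
  exact: lebesgue_ball_lty.
by move=> x; have /andP[p0 p1] := p01 x; rewrite ger0_norm.
Qed.

Lemma compact_ball (K : set E) : compact K -> exists2 r : R, 0 < r & K `<=` ball 0 r.
Proof.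
move=> cK; have [M [_ hM]] := compact_bounded cK.
pose r := `|M| + 2; have r0 : 0 < r by rewrite ltr_wpDl.
have M1 : M < `|M| + 1 by have := ler_norm M; lra.
exists r => // x Kx; have := hM _ M1 x Kx; rewrite mx_norm_ball /ball_/= sub0r normrN.
by move/le_lt_trans; apply; rewrite /r; lra.
Qed.

Lemma continuous_support_sqint f (K : set E) : continuous f -> compact K ->
  (forall x, ~ K x -> f x = 0) -> @sqint _ L R mu Omega f.
Proof.
move=> cf cK fK; have [r r0 Kr] := compact_ball cK.
have [M hM] : exists M, forall x, `|f x| <= M.
  have [K0|K0] := pselect (K !=set0); last first.
    by exists 0 => x; rewrite fK ?normr0// => Kx; apply: K0; exists x.
  have cnf : {within K, continuous (fun x => `|f x|)}.
    by apply: continuous_subspaceT => x; apply: continuous_comp; [exact: cf|exact: norm_continuous].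
  have [x0 Kx0 hx0] := EVT_max_rV K0 cK cnf.
  exists `|f x0| => x; have [Kx|Kx] := pselect (K x); last by rewrite fK ?normr0.
  by apply: hx0; exact/mem_set.
apply: (@sqint_bounded_support _ L R mu Omega measurable_Omega (ball 0 r) f M) => //.
- exact: borel_lebesgue_measurable (measurable_rV_ball _ _).
- exact: lebesgue_ball_lty.
- exact: lebesgue_continuous_measurable.
by move=> x Qx; apply: fK => /Kr.
Qed.

Lemma rtest_continuous f : rtest f -> continuous f.
Proof. by move=> [/(_ [::])[]]. Qed.

Lemma rtest_sqint f : rtest f -> @sqint _ L R mu Omega f.
Proof.
move=> tf; have [_ [K [cK _ fK]]] := tf.
exact: continuous_support_sqint (rtest_continuous tf) cK fK.
Qed.

Lemma fundamental_lemma_le f : @sqint _ L R mu Omega f ->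
  (forall phi, rtest phi -> \int[mu]_(x in Omega) (f x * phi x) = 0) ->
  ae_on Omega (fun x => f x <= 0).
Proof.
move=> sf h; apply: ae_open_ball => c r r0 cO.
have mQ := borel_lebesgue_measurable (measurable_rV_ball c r).
have QO : ball c r `<=` Omega.
  apply: subset_trans cO; apply: le_ball; lra.
pose A : set L := ball c r `&` [set x | 0 < f x].
have mf : measurable_fun (ball c r : set L) (f : L -> R).
  exact: measurable_funS measurable_Omega QO sf.1.
have mA : measurable A.
  have -> : A = ball c r `&` (f : L -> R) @^-1` `]0, +oo[%classic.
    by apply/seteqP; split=> x /= [? h0]; split=> //; move: h0; rewrite in_itv/= andbT.
  by apply: mf => //; exact: measurable_itv.
have : {ae mu, forall x, ~ A x}.
  apply: (@sqint_orthogonal_ae _ L R mu Omega measurable_Omega A f) => //.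
  - by move=> x [/QO].
  - by apply: le_lt_trans (lebesgue_ball_lty c r0); rewrite le_measure ?inE// => x [].
  - by move=> x [].
  move=> e e0; have [phi cp hp] := cutoff_approx r0 mA (fun x (Ax : A x) => Ax.1) e0.
  have [mp p01 _] := cutoff_unit cp.
  exists phi; split => //; first exact: cutoff_sqint cp.
  by apply: h; exact: cutoff_rtest cp.
apply: (@filterS L (almost_everywhere mu) _) => x Ax Qx; rewrite leNgt; apply/negP => fx; exact: Ax.
Qed.

Lemma fundamental_lemma f : @sqint _ L R mu Omega f ->
  (forall phi, rtest phi -> \int[mu]_(x in Omega) (f x * phi x) = 0) ->
  ae_on Omega (fun x => f x = 0).
Proof.
move=> sf h; have h1 := fundamental_lemma_le sf h.
have sN : @sqint _ L R mu Omega (fun x => - 1 * f x) by exact: (sqintZ measurable_Omega).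
have h2 : ae_on Omega (fun x => - 1 * f x <= 0).
  apply: fundamental_lemma_le => // phi tp.
  transitivity (- 1 * \int[mu]_(x in (Omega : set L)) (f x * phi x)); last by rewrite h// mulr0.
  have sp := rtest_sqint tp.
  have := @RintegralZl _ L R mu Omega _ (-1) measurable_Omega (sqint_mul measurable_Omega sf sp).
  by under eq_Rintegral do rewrite mulrA.
apply: ae_onW2 h1 h2 => x Ox h1 h2; apply/eqP; rewrite eq_le h1//=.
by move: h2; rewrite mulN1r oppr_le0.
Qed.

(** If the bound [- kappa < f] fails on [Omega], it fails on some admissible cube, where the set
    [f <= - kappa] has positive finite measure; a cutoff close to its indicator is the test
    function. *)
Lemma negative_test f (M kappa : R) : Lmeasurable Omega f ->
  ae_on Omega (fun x => `|f x| <= M) -> 0 < kappa ->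
  ~ ae_on Omega (fun x => - kappa < f x) ->
  exists2 phi, rtest phi & \int[mu]_(x in Omega) (f x * phi x ^+ 2) < 0.
Proof.
move=> mf fM k0 nae.
have [c [r [r0 cO ncr]]] : exists c r, [/\ 0 < r, ball c (2 * r) `<=` Omega &
    ~ {ae mu, forall x, ball c r x -> - kappa < f x}].
  apply: contrapT => h; apply: nae; apply: ae_open_ball => c r r0 cO.
  by apply: contrapT => h'; apply: h; exists c, r.
have mQ := borel_lebesgue_measurable (measurable_rV_ball c r).
have QO : ball c r `<=` Omega by apply: subset_trans cO; apply: le_ball; lra.
pose A : set L := ball c r `&` [set x | f x <= - kappa].
have mfQ : measurable_fun (ball c r : set L) (f : L -> R).
  exact: measurable_funS measurable_Omega QO mf.
have mA : measurable A.
  have -> : A = ball c r `&` (f : L -> R) @^-1` `]-oo, - kappa]%classic.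
    by apply/seteqP; split=> x /= [? h0]; split=> //; move: h0; rewrite in_itv.
  by apply: mfQ => //; exact: measurable_itv.
have A0 : (0 < mu A)%E.
  rewrite lt0e measure_ge0 andbT; apply/negP => /eqP A0; apply: ncr.
  exists A; split => // x /= h; apply: contrapT => Ax; apply: h => Qx.
  by rewrite ltNge; apply/negP => fx; apply: Ax.
have Aoo : (mu A < +oo)%E.
  by apply: le_lt_trans (lebesgue_ball_lty c r0); rewrite le_measure ?inE// => x [].
have AO : A `<=` Omega by move=> x [/QO].
have [e e0 he] := @bounded_negative_direction _ L R mu Omega measurable_Omega
  A f M kappa mf fM mA AO A0 Aoo k0 (fun x (Ax : A x) => Ax.2).
have [phi cp hp] := cutoff_approx r0 mA (fun x (Ax : A x) => Ax.1) e0.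
have [mp p01 _] := cutoff_unit cp.
by exists phi; [exact: cutoff_rtest cp | exact: he].
Qed.

End real_test_functions.

(** * Integration by parts *)

Section dominated_zero.
Context d (T : measurableType d) (R : realType) (mu : {measure set T -> \bar R}).

Lemma integrable_bounded_support (Q : set T) (f : T -> R) M : measurable Q ->
  (mu Q < +oo)%E -> measurable_fun setT f -> (forall x, `|f x| <= M * \1_Q x) ->
  mu.-integrable setT (EFin \o f).
Proof.
move=> mQ Qoo mf fM.
have int1 : mu.-integrable setT (EFin \o (\1_Q : T -> R)).
  apply/integrableP; split; first by apply/measurable_EFinP; exact: measurable_indic.
  by under eq_integral do rewrite /= ger0_norm//; rewrite integral_indic// setIT.
apply: le_integrable (integrableZl measurableT M int1) => //.
  exact/measurable_EFinP.
by move=> x _ /=; rewrite lee_fin; apply: le_trans (fM x) (ler_norm _).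
Qed.

Lemma Rintegral_dominated_eq0 (Q : set T) (f_ : nat -> T -> R) (f : T -> R) M : measurable Q ->
  (mu Q < +oo)%E -> (forall k, measurable_fun setT (f_ k)) -> measurable_fun setT f ->
  (forall k x, `|f_ k x| <= M * \1_Q x) -> (forall x, f_ ^~ x @ \oo --> f x) ->
  (forall k, \int[mu]_x f_ k x = 0) -> \int[mu]_x f x = 0.
Proof.
move=> mQ Qoo mf_ mf fQ cf I0.
have int1 : mu.-integrable setT (EFin \o (fun x => M * \1_Q x)).
  apply: (@integrable_bounded_support Q _ `|M|) => //.
    by apply: measurable_funM; [exact: measurable_cst|exact: measurable_indic].
  by move=> x; rewrite normrM; case: (x \in Q); rewrite ler_wpM2l// ger0_norm.
have [||||_ _] := @dominated_convergence _ _ _ mu setT measurableT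
  (fun k => EFin \o f_ k) (EFin \o f) _ _ _ _ int1 _.
- by move=> k; exact/measurable_EFinP.
- exact/measurable_EFinP.
- by apply: aeW => x _; apply: cvg_EFin; [near=> k|exact: cf].
- by apply: aeW => x k _ /=; rewrite lee_fin.
move=> h; rewrite /Rintegral -(cvg_lim _ h)//.
rewrite (_ : [sequence _]_n = cst 0%E) ?lim_cst//.
apply/funext => k /=; rewrite -[LHS]fineK.
  by have := I0 k; rewrite /Rintegral => ->.
by rewrite integrable_fin_num//; exact: integrable_bounded_support (fQ k).
Unshelve. all: by end_near. Qed.

End dominated_zero.

(** * Translation invariance of Lebesgue measure *)

Section translation_invariance.
Context (R : realType).

Lemma measurable_shift (c : R) :
  measurable_fun setT (fun x : measurableTypeR R => x + c : measurableTypeR R).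
Proof. by apply: continuous_measurable_fun => x; apply: cvgD; [exact: cvg_id|exact: cvg_cst]. Qed.

Lemma lebesgue_measure_shift (c : R) (A : set (measurableTypeR R)) : measurable A ->
  lebesgue_measure ((fun x => x + c) @^-1` A) = lebesgue_measure A :> \bar R.
Proof.
pose m2 := measure_function_pushforward__canonical__measure_function_Measure
  (@lebesgue_measure R) (measurable_shift c).
move=> mA; rewrite -[LHS]/(m2 A); apply/esym; apply: lebesgue_measure_unique => //.
move=> X /ocitvP[->|[[a b] /= ab ->]]; first by rewrite !measure0.
rewrite /m2 /= /pushforward.
rewrite (_ : _ @^-1` _ = `]a - c, b - c]%classic); last first.
  by apply/seteqP; split => x /=; rewrite !in_itv/= ltrBlDr lerBrDr.
rewrite !lebesgue_measure_itv/= !lte_fin ltrD2r; case: ifP => // _.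
by rewrite -!EFinB opprB addrA subrK.
Qed.

Context (n : nat).
Local Notation E := 'rV[R]_n.

Lemma measurable_shift_rV (v : E) : measurable_fun setT (fun x : E => x + v).
Proof.
apply: measurable_fun_rV => i.
rewrite (_ : _ \o _ = (fun t : measurableTypeR R => t + v ord0 i : measurableTypeR R) \o
  (fun x : E => x ord0 i : measurableTypeR R)); last by apply/funext => x /=; rewrite mxE.
apply: measurableT_comp; [exact: measurable_shift | exact: measurable_coord].
Qed.

Definition rV_box (A : 'I_n -> set (measurableTypeR R)) : set E :=
  [set x | forall i, A i (x ord0 i)].

(** Uniqueness of measures on the boxes, which are stable under intersection; on a box the product
    formula reduces the claim to the line. *)
Lemma borel_lebesgue_shift (v : E) (A : set E) : measurable A ->
  borel_lebesgue R n ((fun x => x + v) @^-1` A) = borel_lebesgue R n A.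
Proof.
move=> mA.
pose m2 := measure_function_pushforward__canonical__measure_function_Measure
  (borel_lebesgue R n) (measurable_shift_rV v).
pose G := [set B : set E | exists2 F, (forall i, measurable (F i)) & B = rV_box F].
rewrite -[LHS]/(m2 A); apply/esym.
have mbox F : (forall i, measurable (F i)) -> measurable (rV_box F).
  move=> mF; rewrite (_ : rV_box F = \big[setI/setT]_(i < n) [set x : E | F i (x ord0 i)]).
    by apply: bigsetI_measurable => i _; rewrite -[X in measurable X]setTI; exact: measurable_coord.
  rewrite -bigcap_seq; apply/seteqP; split => x /= h i; first by move=> _; exact: h.
  by apply: h; rewrite /= mem_index_enum.
apply: (@measure_unique _ R E G (fun k => rV_box (fun=> `]- k%:R, k%:R[%classic))) => //.
- apply/seteqP; split; last first.
    apply: smallest_sub; first exact: sigma_algebra_measurable.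
    by move=> _ [F mF ->]; exact: mbox.
  apply: smallest_sub; first exact: smallest_sigma_algebra.
  move=> B; rewrite -bigcup_seq => -[i _ [Y mY <-]]; rewrite setTI.
  apply: sub_sigma_algebra; exists (fun j => if j == i then Y else setT).
    by move=> j; case: ifP.
  apply/seteqP; split => x /=; first by move=> h j; case: eqP => [->|].
  by move=> /(_ i); rewrite eqxx.
- move=> _ _ [F mF ->] [F' mF' ->]; exists (fun i => F i `&` F' i).
    by move=> i; exact: measurableI.
  apply/seteqP; split => x; first by move=> [h h'] i; split; [exact: h|exact: h'].
  by move=> h; split=> i; case: (h i).
- by move=> k; exists (fun=> `]- k%:R, k%:R[%classic).
- apply/seteqP; split => // x _.
  have [k hk] : exists k : nat, forall i, `|x ord0 i| < k%:R.
    exists (Num.truncn (\sum_i `|x ord0 i|)).+1 => i.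
    apply: le_lt_trans (truncnS_gt _).
    by rewrite (bigD1 i)//= lerDl sumr_ge0.
  by exists k => // i /=; rewrite in_itv/= -ltr_norml.
- move=> _ [F mF ->]; rewrite /m2 /= /pushforward.
  rewrite [RHS](_ : _ = borel_lebesgue R n
      (rV_box (fun i => (fun t => t + v ord0 i) @^-1` F i))); last first.
    by congr (borel_lebesgue R n _); apply/seteqP; split => x h i; have := h i; rewrite /= !mxE.
  rewrite !borel_lebesgue_box//.
    by apply: eq_bigr => i _; rewrite lebesgue_measure_shift.
  by move=> i; rewrite -[X in measurable X]setTI; exact: measurable_shift.
- move=> k; pose I := (`](- k%:R : R), k%:R[%classic)%R.
  suff h : (borel_lebesgue R n (rV_box (fun=> I)) < +oo)%E by exact: h.
  have -> : borel_lebesgue R n (rV_box (fun=> I)) = (\prod_(i < n) lebesgue_measure I)%E.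
    by apply: (@borel_lebesgue_box R n (fun=> I)) => i; exact: measurable_itv.
  suff -> : (\prod_(i < n) lebesgue_measure I = (\prod_(i < n) (k%:R + k%:R)%R)%:E)%E by exact: ltry.
  rewrite -prodEFin; apply: eq_bigr => i _.
  rewrite /I lebesgue_measure_itv/= lte_fin; case: ifPn; first by rewrite -EFinB opprK.
  by rewrite -leNgt => h; congr (_%:E); have : 0 <= (k%:R : R) by []; lra.
Qed.

(** Both sides are integrals against pushforwards of Lebesgue measure to the Borel sets, by the
    identity and by the translation, and these two agree. Continuity makes [f] Borel. *)
Lemma lebesgue_integral_shift (v : E) (f : E -> R) : continuous f ->
  (lebesgue R n).-integrable (setT : set (lebesgue_space R n)) (EFin \o f) ->
  (lebesgue R n).-integrable (setT : set (lebesgue_space R n)) (EFin \o (fun x => f (x + v))) ->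
  \int[lebesgue R n]_x f (x + v) = \int[lebesgue R n]_x f x.
Proof.
move=> cf intf intfv; rewrite /Rintegral; congr fine.
have mid : measurable_fun (setT : set (lebesgue_space R n)) (id : lebesgue_space R n -> E).
  by move=> _ Y mY; rewrite setTI; exact: borel_lebesgue_measurable.
have msh : measurable_fun (setT : set (lebesgue_space R n))
    ((fun x => x + v) : lebesgue_space R n -> E).
  by move=> _ Y mY; rewrite setTI; apply: borel_lebesgue_measurable;
    rewrite -[X in measurable X]setTI; exact: measurable_shift_rV.
have mf : measurable_fun setT (EFin \o (f : E -> measurableTypeR R)).
  by apply/measurable_EFinP; exact: continuous_measurable_rV.
have e1 := @integral_pushforward _ _ _ _ _ _ mid (lebesgue R n) setT (EFin \o f) mf intf measurableT.
have e2 := @integral_pushforward _ _ _ _ _ _ msh (lebesgue R n) setT (EFin \o f) mf intfv measurableT.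
rewrite /= in e1 e2; rewrite -e1 -e2; apply: eq_measure_integral => A mA _.
rewrite /= /pushforward !lebesgueE//; last first.
  by rewrite -[X in measurable X]setTI; exact: measurable_shift_rV.
by rewrite borel_lebesgue_shift.
Qed.

End translation_invariance.

Section integration_by_parts.
Context (R : realType) (n : nat).
Local Notation E := 'rV[R]_n.
Local Notation mu := (lebesgue R n).
Local Notation L := (lebesgue_space R n).

Lemma is_derive_line (F : E -> R) (x v : E) : (forall y, derivable F y v) ->
  forall s : R, is_derive s 1 (fun s => F (s *: v + x)) ('D_v F (s *: v + x)).
Proof.
move=> dF s.
have e : (fun h : R => h^-1 *: (((fun s => F (s *: v + x)) \o shift s) (h *: (1 : R)) - F (s *: v + x))) =
    (fun h : R => h^-1 *: ((F \o shift (s *: v + x)) (h *: v) - F (s *: v + x))).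
  by apply/funext => h /=; rewrite [h *: 1]mulr1 scalerDl addrA.
have d := dF (s *: v + x); rewrite /derivable -e in d.
by apply: DeriveDef => //; rewrite /derive -e.
Qed.

Lemma mean_value_line (F : E -> R) (x v : E) (M h : R) :
  (forall y, derivable F y v) -> (forall y, `|'D_v F y| <= M) -> 0 < h ->
  `|F (x + h *: v) - F x| <= M * h.
Proof.
move=> dF hM h0.
have D := is_derive_line x dF.
have [s _ es] := @MVT R (fun s => F (s *: v + x)) (fun s => 'D_v F (s *: v + x)) 0 h h0
  (fun s _ => D s) (continuous_subspaceT (fun s => differentiable_continuous
    ((derivable1_diffP _ _).1 (@ex_derive _ _ _ _ _ _ _ (D s))))).
have -> : F (x + h *: v) - F x = 'D_v F (s *: v + x) * (h - 0).
  by rewrite -es scale0r add0r (addrC x).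
by rewrite subr0 normrM (gtr0_norm h0) ler_wpM2r// ltW.
Qed.

Lemma continuous_bounded (f : E -> R) (K : set E) : continuous f -> compact K ->
  (forall x, ~ K x -> f x = 0) -> exists2 M, 0 <= M & forall x, `|f x| <= M.
Proof.
move=> cf cK fK.
have [K0|K0] := pselect (K !=set0); last first.
  by exists 0 => // x; rewrite fK ?normr0// => Kx; apply: K0; exists x.
have cnf : {within K, continuous (fun x => `|f x|)}.
  by apply: continuous_subspaceT => x; apply: continuous_comp; [exact: cf|exact: norm_continuous].
have [x0 Kx0 hx0] := EVT_max_rV K0 cK cnf.
exists `|f x0| => // x; have [Kx|Kx] := pselect (K x); last by rewrite fK ?normr0.
by apply: hx0; exact/mem_set.
Qed.

Lemma partial_support (f : E -> R) (K : set E) j : compact K ->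
  (forall x, ~ K x -> f x = 0) -> forall x, ~ K x -> partial j f x = 0.
Proof.
move=> cK fK x Kx; rewrite /partial.
rewrite (@near_eq_derive _ _ _ f (cst 0)); first by rewrite derive_cst.
have cl : closed K by apply: compact_closed => //; exact: norm_hausdorff.
have : nbhs x (~` K) by apply: open_nbhs_nbhs; split => //; exact: closed_openC.
by apply: filterS => y Ky; rewrite fK.
Qed.

Lemma harmonic_dnbhs0 : (fun k : nat => k.+1%:R^-1 : R) @ \oo --> (0 : R)^'.
Proof.
move=> A [e /= e0 hA]; have /cvgrPdist_lt/(_ _ e0) h := @cvg_harmonic R.
by apply: filterS h => k /= h; apply: hA => //=.
Qed.

(** Difference quotients have integral 0 by translation invariance and converge to the partial
    derivative, dominated through the mean value theorem. *)
Lemma Rintegral_partial_eq0 (F : E -> R) (K : set E) j : continuous F ->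
  (forall x, derivable F x (delta_mx ord0 j)) -> continuous (partial j F) ->
  compact K -> (forall x, ~ K x -> F x = 0) -> \int[mu]_x partial j F x = 0.
Proof.
move=> cF dF cdF cK FK; set v : E := delta_mx ord0 j.
have [M M0 hM] := continuous_bounded cdF cK (partial_support j cK FK).
have [MF MF0 hMF] := continuous_bounded cF cK FK.
have [r r0 Kr] := compact_ball cK.
(* The increments [hk k] are at most 1, so this cube contains the supports of all translates. *)
pose Q : set L := ball (0 : E) (r + 1).
have mQ : measurable Q by exact: borel_lebesgue_measurable (measurable_rV_ball _ _).
have Qoo : (mu Q < +oo)%E by apply: lebesgue_ball_lty; rewrite addr_gt0.
have m_cont (f : E -> R) : continuous f -> measurable_fun (setT : set L) (f : L -> R).
  by move=> cf; exact: lebesgue_continuous_measurable openT cf.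
pose hk (k : nat) : R := k.+1%:R^-1.
have hk0 k : 0 < hk k by rewrite invr_gt0.
have hk1 k : hk k <= 1 by rewrite invf_le1// ler1n.
have v1 i : `|v ord0 i| <= 1.
  by rewrite /v mxE eqxx/=; case: (i == j); rewrite ?normr1 ?normr0.
have KQ x k : ~ Q x -> ~ K x /\ ~ K (x + hk k *: v).
  move=> Qx; split=> Kx; apply: Qx; have /rV_ball[_ h] := Kr _ Kx; apply/rV_ball.
    by split=> [|i]; [rewrite addr_gt0 | apply: lt_trans (h i) _; rewrite ltrDl].
  split=> [|i]; first by rewrite addr_gt0.
  have := h i; rewrite !mxE !sub0r !normrN => hi.
  have hv : `|hk k * v ord0 i| <= 1.
    by rewrite normrM (gtr0_norm (hk0 k)) mulr_ile1// ltW.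
  have := ler_normB (x ord0 i + hk k * v ord0 i) (hk k * v ord0 i).
  by rewrite addrK; move: hi hv; rewrite !mxE; lra.
have cFs (w : E) : continuous (fun x : E => F (x + w)).
  move=> x; apply: (@continuous_comp _ _ _ (fun y : E => y + w) F); last exact: cF.
  apply: (@continuousD _ E E id (cst w)); last exact: cst_continuous.
  by move=> A; apply.
have intF (w : E) k : w = 0 \/ w = hk k *: v -> mu.-integrable (setT : set L) (EFin \o (fun x : E => F (x + w))).
  move=> hw; apply: (@integrable_bounded_support _ L R mu Q _ MF mQ Qoo (m_cont _ (cFs w))) => x.
  rewrite indicE; have [Qx|Qx] := pselect (Q x); first by rewrite mem_set// mulr1.
  rewrite memNset// mulr0; have [k1 k2] := KQ x k Qx.
  by case: hw => ->; rewrite ?addr0 FK ?normr0.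
pose f_ (k : nat) (x : E) : R := (hk k)^-1 * (F (x + hk k *: v) - F x).
have mf_ k : measurable_fun (setT : set L) (f_ k : L -> R).
  apply: m_cont; rewrite /f_ => x.
  apply: (@continuousM R E (fun=> (hk k)^-1) (fun x => F (x + hk k *: v) - F x) x).
    exact: cst_continuous.
  by apply: continuousB; [exact: cFs | exact: cF].
apply: (@Rintegral_dominated_eq0 _ L R mu Q f_ _ M mQ Qoo mf_ (m_cont _ cdF)).
- move=> k x; rewrite indicE /f_; have [Qx|Qx] := pselect (Q x).
    rewrite mem_set// mulr1 normrM gtr0_norm ?invr_gt0// ler_pdivrMl// mulrC.
    exact: mean_value_line.
  by have [k1 k2] := KQ x k Qx; rewrite memNset// mulr0 !FK// subrr mulr0 normr0.
- move=> x; have d := dF x; rewrite /partial /derive.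
  have : (fun h : R => h^-1 *: ((F \o shift x) (h *: v) - F x)) @ (0 : R)^' -->
      'D_v F x by exact: d.
  move=> /(cvg_comp _ _ harmonic_dnbhs0); apply: cvg_trans; apply: near_eq_cvg; near=> k.
  by rewrite /f_ /= (addrC x).
- move=> k; rewrite /f_.
  have i1 := intF (hk k *: v) k (or_intror erefl).
  have i0 : mu.-integrable (setT : set L) (EFin \o F).
    by have := intF 0 k (or_introl erefl); under eq_fun do rewrite addr0.
  rewrite (@RintegralZl _ L R mu setT (fun x => F (x + hk k *: v) - F x) (hk k)^-1 measurableT).
    rewrite (@RintegralB _ L R mu setT (fun x => F (x + hk k *: v)) F measurableT i1 i0).
    by rewrite lebesgue_integral_shift// subrr mulr0.
  exact: (@integrableB _ L R mu setT measurableT _ _ i1 i0).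
Unshelve. all: by end_near. Qed.

Context (Omega : set E).
Hypothesis oO : open Omega.

Lemma Rintegral_support (h : E -> R) : (forall x, ~ Omega x -> h x = 0) ->
  \int[mu]_(x in Omega) h x = \int[mu]_x h x.
Proof.
move=> hO; rewrite Rintegral_mkcond; congr Rintegral; apply/funext => x.
by rewrite patchE; case: ifPn => // /negP; rewrite inE => /hO ->.
Qed.

Lemma rtest_partial (f : E -> R) j : rtest Omega f -> rtest Omega (partial j f).
Proof.
move=> [sf [K [cK KO fK]]]; split; first exact: smooth_partial.
by exists K; split => //; exact: partial_support.
Qed.

Lemma integration_by_parts (f g : E -> R) j : rtest Omega f -> rtest Omega g ->
  \int[mu]_(x in Omega) (f x * partial j g x) =
  - \int[mu]_(x in Omega) (partial j f x * g x).
Proof.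
move=> tf tg; have mO := measurable_Omega oO.
have sf := rtest_sqint oO tf; have sg := rtest_sqint oO tg.
have sdf := rtest_sqint oO (rtest_partial j tf).
have sdg := rtest_sqint oO (rtest_partial j tg).
have [smf [K [cK KO fK]]] := tf; have [smg _] := tg.
have [cf df] := smf [::]; have [cg dg] := smg [::].
have [cdf _] := smf [:: j]; have [cdg _] := smg [:: j].
have e x : partial j (fun x => f x * g x) x = f x * partial j g x + g x * partial j f x.
  by rewrite /partial (deriveM (df x j) (dg x j)).
have := @Rintegral_partial_eq0 (fun x => f x * g x) K j.
have hc : continuous (fun x => f x * g x).
  by move=> x; apply: (@continuousM R E f g x); [exact: cf|exact: cg].
have hd x : derivable (fun x => f x * g x) x (delta_mx ord0 j).
  exact: (derivableM (df x j) (dg x j)).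
have hcd : continuous (partial j (fun x => f x * g x)).
  rewrite (_ : partial _ _ = fun x => f x * partial j g x + g x * partial j f x); last exact/funext.
  move=> x; apply: (@continuousD R R E (fun x => f x * partial j g x) (fun x => g x * partial j f x) x).
    by apply: (@continuousM R E f (partial j g) x); [exact: cf|exact: cdg].
  by apply: (@continuousM R E g (partial j f) x); [exact: cg|exact: cdf].
have h0 x : ~ K x -> f x * g x = 0 by move=> /fK ->; rewrite mul0r.
move=> /(_ hc hd hcd cK h0).
rewrite -Rintegral_support; last first.
  move=> x Ox; apply: (partial_support j cK h0) => Kx; apply: Ox; exact: KO.
under eq_Rintegral do rewrite e.
rewrite (@RintegralD _ L R mu Omega _ _ mO (sqint_mul mO sf sdg) (sqint_mul mO sg sdf)).
by move/eqP; rewrite addr_eq0 => /eqP ->; congr (- _); apply: eq_Rintegral => x _; rewrite mulrC.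
Qed.

End integration_by_parts.

(** * Weighted pairings and vector-valued square-integrable functions *)

Section submodule.
Context (R : realType) (V : lmodType R) (S : {pred V}).

(** The closedness proof is an argument of the type, so that the module structure can be inferred
    from it. *)
Definition submodule of submod_closed S := {x : V | x \in S}.

Variable hS : submod_closed S.
Local Notation sub := (submodule hS).

HB.instance Definition _ := GRing.isSubmodClosed.Build R V S hS.
HB.instance Definition _ := SubType.on sub.
HB.instance Definition _ := [Choice of sub by <:].
HB.instance Definition _ := [SubChoice_isSubLmodule of sub by <:].

Lemma submoduleD (u v : sub) : val (u + v) = val u + val v. Proof. by []. Qed.
Lemma submoduleN (u : sub) : val (- u) = - val u. Proof. by []. Qed.
Lemma submoduleZ c (u : sub) : val (c *: u) = c *: val u. Proof. by []. Qed.

Lemma submodule_semi_ip (ip : V -> V -> R) :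
  (forall u v, u \in S -> v \in S -> ip u v = ip v u) ->
  (forall u v w, u \in S -> v \in S -> w \in S -> ip (u + v) w = ip u w + ip v w) ->
  (forall c u v, u \in S -> v \in S -> ip (c *: u) v = c * ip u v) ->
  (forall u, u \in S -> 0 <= ip u u) ->
  semi_ip (fun u v : sub => ip (val u) (val v)).
Proof.
move=> hC hD hZ h0; split.
- by move=> u v; apply: hC; exact: valP.
- by move=> u v w; rewrite submoduleD; apply: hD; exact: valP.
- by move=> c u v; rewrite submoduleZ; apply: hZ; exact: valP.
- by move=> u; apply: h0; exact: valP.
Qed.

Lemma semi_ip_restrict (ip : V -> V -> R) :
  semi_ip ip -> semi_ip (fun u v : sub => ip (val u) (val v)).
Proof.
by move=> h; apply: submodule_semi_ip => *; [exact: ipC|exact: ipDl|exact: ipZl|exact: ip_ge0].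
Qed.

End submodule.

(** * Criteria for geometric completeness, and closed submodules *)

Section completeness.
Context (R : realType) (V : lmodType R) (N : V -> R).
Hypothesis hN : seminorm N.

Lemma geo_steps (u : nat -> V) C : (forall k, N (u k.+1 - u k) <= C / 2 ^+ k) ->
  forall k m, N (u (k + m)%N - u k) <= 2 * C / 2 ^+ k.
Proof.
move=> hu k m.
have C0 : 0 <= C by have := hu 0%N; rewrite expr0 divr1; exact: le_trans (seminorm_ge0 hN _).
suff H : N (u (k + m)%N - u k) <= 2 * C / 2 ^+ k - 2 * C / 2 ^+ (k + m).
  by apply: le_trans H _; rewrite lerBlDr lerDl divr_ge0 ?mulr_ge0 ?exprn_ge0.
elim: m => [|m IH]; first by rewrite addn0 !subrr (seminorm0 hN).
rewrite addnS; apply: le_trans (seminorm_tri hN (u (k + m)%N) _ _) _.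
apply: le_trans (lerD (hu _) IH) _.
have P : (0 : R) < 2 ^+ (k + m) by rewrite exprn_gt0.
have : C / 2 ^+ (k + m) = 2 * (C / 2 ^+ (k + m).+1).
  by rewrite exprS; field; rewrite gt_eqF.
rewrite -!mulrA; set a := C / 2 ^+ (k + m); set b := _ / _ ^+ (_).+1; set c := C / 2 ^+ k.
lra.
Qed.

(** A limit without any rate suffices: the rate [2 * C / 2 ^+ k] is that of the tails of the
    geometric increments. *)
Lemma geo_completeI : (forall u C, (forall k, N (u k.+1 - u k) <= C / 2 ^+ k) ->
    exists w, forall e : R, 0 < e -> exists k0, forall k, (k0 <= k)%N -> N (w - u k) <= e) ->
  geo_complete N.
Proof.
move=> h u C hu; have [w hw] := h u C hu; exists w => k.
apply/ler_addgt0Pr => e e0; have [k0 hk] := hw e e0.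
apply: le_trans (seminorm_tri hN (u (k + k0)%N) _ _) _.
by rewrite addrC lerD ?geo_steps// hk// leq_addl.
Qed.

Lemma geo_complete_equiv (N' : V -> R) c c' : seminorm N' -> 0 <= c' ->
  (forall u, N u <= c * N' u) -> (forall u, N' u <= c' * N u) ->
  geo_complete N' -> geo_complete N.
Proof.
move=> hN' c'0 h h' cN'; apply: geo_completeI => u C hu.
have [|w hw] := cN' u (c' * C).
  by move=> k; apply: le_trans (h' _) _; rewrite -mulrA ler_wpM2l.
exists w => e e0; have [k0 hk] := geo_small (`|c| * (2 * (c' * C))) e0.
exists k0 => k kk; apply: le_trans (h _) _.
apply: (@le_trans _ _ (`|c| * N' (w - u k))).
  by rewrite ler_wpM2r ?ler_norm ?seminorm_ge0.
apply: (@le_trans _ _ (`|c| * (2 * (c' * C) / 2 ^+ k))); first by rewrite ler_wpM2l.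
apply: le_trans _ (ltW hk); rewrite -[leRHS]mulrA ler_wpM2l//.
have C0 : 0 <= C.
  by have := hu 0%N; rewrite expr0 divr1; exact: le_trans (seminorm_ge0 hN _).
rewrite ler_wpM2l ?mulr_ge0// lef_pV2 ?posrE ?exprn_gt0//.
by rewrite ler_weXn2l// ler1n.
Qed.

End completeness.

Section closure.
Context (R : realType) (V : lmodType R) (N : V -> R) (J : V -> Prop).
Hypothesis hN : seminorm N.
Hypothesis J0 : J 0.
Hypothesis JD : forall c u v, J u -> J v -> J (c *: u + v).

Definition subclosure : {pred V} := fun u =>
  `[< forall e : R, 0 < e -> exists2 j, J j & N (u - j) < e >].

Lemma subclosureP u :
  reflect (forall e : R, 0 < e -> exists2 j, J j & N (u - j) < e) (u \in subclosure).
Proof. exact: asboolP. Qed.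

Lemma mem_subclosure u : J u -> u \in subclosure.
Proof. by move=> Ju; apply/subclosureP => e e0; exists u; rewrite ?subrr ?seminorm0. Qed.

Lemma subclosure_closed u :
  (forall e : R, 0 < e -> exists2 j, j \in subclosure & N (u - j) < e) ->
  u \in subclosure.
Proof.
move=> h; apply/subclosureP => e e0.
have [j /subclosureP hj hu] := h (e / 2) ltac:(lra).
have [k Jk hk] := hj (e / 2) ltac:(lra); exists k => //.
by apply: le_lt_trans (seminorm_tri hN j _ _) _; lra.
Qed.

Lemma subclosure_submod_closed : submod_closed subclosure.
Proof.
split; first exact: mem_subclosure.
move=> c u v /subclosureP hu /subclosureP hv; apply/subclosureP => e e0.
have c0 : 0 < 2 * (`|c| + 1) by rewrite mulr_gt0 ?ltr_wpDl.
have [j Jj hj] := hu (e / (2 * (`|c| + 1))) ltac:(by rewrite divr_gt0).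
have [k Jk hk] := hv (e / 2) ltac:(lra).
exists (c *: j + k); first exact: JD.
rewrite opprD addrACA -scalerBr; apply: le_lt_trans (seminormD hN _ _) _.
rewrite seminormZ//; suff : `|c| * N (u - j) <= e / 2 by lra.
apply: (@le_trans _ _ (`|c| * (e / (2 * (`|c| + 1))))); first by rewrite ler_wpM2l// ltW.
rewrite mulrA ler_pdivrMr// mulrC -subr_ge0.
rewrite (_ : _ - _ = e); first exact: ltW.
by field.
Qed.

Lemma submodule_complete (h : submod_closed subclosure) :
  geo_complete N -> geo_complete (fun u : submodule h => N (val u)).
Proof.
move=> cN u C hu; have [|w hw] := cN (fun k => val (u k)) C; first exact: hu.
have wS : w \in subclosure.
  apply: subclosure_closed => e e0; have [k hk] := geo_small (2 * C) e0.
  by exists (val (u k)); [exact: valP|exact: le_lt_trans (hw k) hk].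
by exists (exist _ w wS) => k; exact: hw.
Qed.

End closure.

Section weighted_pairing.
Context d (T : measurableType d) (R : realType) (mu : {measure set T -> \bar R}).
Variable D : set T.
Hypothesis mD : measurable D.
Local Notation sqint := (sqint mu D).

Definition ess_bounded (M : R) (m : T -> R) :=
  measurable_fun D m /\ {ae mu, forall x, D x -> `|m x| <= M}.

Definition wpair (m f g : T -> R) : R := \int[mu]_(x in D) (m x * f x * g x).

Local Notation pair := (wpair (fun=> 1)).

Lemma wpair1E f g : pair f g = \int[mu]_(x in D) (f x * g x).
Proof. by apply: eq_Rintegral => x _; rewrite mul1r. Qed.

Lemma ess_bounded_cst c : ess_bounded `|c| (fun=> c).
Proof. by split; [exact: measurable_cst|exact: aeW]. Qed.

Lemma wpair_integrable M m f g : ess_bounded M m -> sqint f -> sqint g ->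
  mu.-integrable D (EFin \o (fun x => m x * f x * g x)).
Proof.
by move=> [mm hm] hf hg; apply: sqint_mul => //; exact: (sqint_bounded_mul mD mm hm).
Qed.

Lemma wpair_measurable M m f g : ess_bounded M m -> sqint f -> sqint g ->
  measurable_fun D (fun x => m x * f x * g x).
Proof. by move=> [mm _] [mf _] [mg _]; apply: measurable_funM => //; exact: measurable_funM. Qed.

Lemma wpairC m f g : wpair m f g = wpair m g f.
Proof. by apply: eq_Rintegral => x _; rewrite mulrAC. Qed.

Lemma wpairDl M m f g h : ess_bounded M m -> sqint f -> sqint g -> sqint h ->
  wpair m (fun x => f x + g x) h = wpair m f h + wpair m g h.
Proof.
move=> mm hf hg hh; rewrite /wpair -RintegralD//; last 2 first.
- exact: (wpair_integrable mm hf hh).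
- exact: (wpair_integrable mm hg hh).
by apply: eq_Rintegral => x _ /=; ring.
Qed.

Lemma wpairZl M m c f h : ess_bounded M m -> sqint f -> sqint h ->
  wpair m (fun x => c * f x) h = c * wpair m f h.
Proof.
move=> mm hf hh; rewrite /wpair -RintegralZl//; last exact: (wpair_integrable mm hf hh).
by apply: eq_Rintegral => x _ /=; ring.
Qed.

Lemma sqint_sum (I : Type) (s : seq I) (f : I -> T -> R) : (forall i, sqint (f i)) ->
  sqint (fun x => \sum_(i <- s) f i x).
Proof.
move=> hf; elim: s => [|i s ih].
  by under eq_fun do rewrite big_nil; exact: sqint0.
by under eq_fun do rewrite big_cons; exact: sqintD.
Qed.

Lemma wpair_suml M m (I : Type) (s : seq I) (f : I -> T -> R) h : ess_bounded M m ->
  (forall i, sqint (f i)) -> sqint h ->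
  wpair m (fun x => \sum_(i <- s) f i x) h = \sum_(i <- s) wpair m (f i) h.
Proof.
move=> mm hf hh; elim: s => [|i s ih].
  rewrite big_nil -[RHS](mul0r (wpair m h h)) -(wpairZl 0 mm hh hh); congr (wpair _ _ _).
  by apply/funext => x; rewrite big_nil mul0r.
rewrite big_cons -ih -(wpairDl mm (hf i) (sqint_sum s hf) hh); congr (wpair _ _ _).
by apply/funext => x; rewrite big_cons.
Qed.

Lemma wpairDw M M' m m' f g : ess_bounded M m -> ess_bounded M' m' ->
  sqint f -> sqint g ->
  wpair (fun x => m x + m' x) f g = wpair m f g + wpair m' f g.
Proof.
move=> mm mm' hf hg; rewrite /wpair -RintegralD//; last 2 first.
- exact: (wpair_integrable mm hf hg).
- exact: (wpair_integrable mm' hf hg).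
by apply: eq_Rintegral => x _ /=; ring.
Qed.

Lemma wpairZw M c m f g : ess_bounded M m -> sqint f -> sqint g ->
  wpair (fun x => c * m x) f g = c * wpair m f g.
Proof.
move=> mm hf hg; rewrite /wpair -RintegralZl//; last exact: (wpair_integrable mm hf hg).
by apply: eq_Rintegral => x _ /=; ring.
Qed.

Lemma wpair_ge0 M m f : ess_bounded M m -> {ae mu, forall x, D x -> 0 <= m x} ->
  sqint f -> 0 <= wpair m f f.
Proof.
move=> mm m0 hf; rewrite -[leLHS](_ : \int[mu]_(x in D) 0 = 0); last first.
  by rewrite /Rintegral integral0.
apply: ae_le_Rintegral => //; first exact: integrable0.
  exact: (wpair_integrable mm hf hf).
by apply: filterS m0 => x h Dx; rewrite -mulrA -expr2 mulr_ge0 ?sqr_ge0 ?h.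
Qed.

Lemma wpair_ae_eq M m f f' g : ess_bounded M m -> sqint f -> sqint f' -> sqint g ->
  {ae mu, forall x, D x -> f x = f' x} -> wpair m f g = wpair m f' g.
Proof.
move=> mm hf hf' hg ff; apply: Rintegral_ae_eq => //.
- by case: mm => mm _; case: hf => mf _; case: hg => mg _; do !apply: measurable_funM.
- by case: mm => mm _; case: hf' => mf _; case: hg => mg _; do !apply: measurable_funM.
by apply: filterS ff => x h Dx; rewrite h.
Qed.

Lemma wpair_sqr M m c f g : ess_bounded M m -> sqint f -> sqint g ->
  wpair m (fun x => f x + c * g x) (fun x => f x + c * g x) =
  wpair m f f + 2 * c * wpair m f g + c ^+ 2 * wpair m g g.
Proof.
move=> mm hf hg; have hcg := sqintZ mD c hg; have hs := sqintD mD hf hcg.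
have e u : sqint u -> wpair m (fun x => f x + c * g x) u = wpair m f u + c * wpair m g u.
  by move=> hu; rewrite (wpairDl mm hf hcg hu) (wpairZl c mm hg hu).
rewrite (e _ hs) ![wpair m _ (fun x => f x + _)]wpairC (e _ hf) (e _ hg).
rewrite (wpairC m g f); ring.
Qed.

Lemma wpair_cst c f g : sqint f -> sqint g -> wpair (fun=> c) f g = c * pair f g.
Proof.
move=> hf hg; rewrite -(wpairZw c (ess_bounded_cst 1) hf hg).
by apply: eq_Rintegral => x _; rewrite mulr1.
Qed.

Lemma pair_ge0 f : sqint f -> 0 <= pair f f.
Proof. by apply: wpair_ge0; [exact: ess_bounded_cst|exact: aeW]. Qed.

Lemma pair_abs f : pair (fun x => `|f x|) (fun x => `|f x|) = pair f f.
Proof. by apply: eq_Rintegral => x _; rewrite !mul1r -normrM ger0_norm// -expr2 sqr_ge0. Qed.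

Lemma sqint_abs f : sqint f -> sqint (fun x => `|f x|).
Proof.
move=> [mf hf]; split; first exact: measurableT_comp.
by rewrite (_ : _ \o _ = EFin \o (fun x => f x ^+ 2))//; apply/funext => x /=;
  rewrite real_normK ?num_real.
Qed.

Lemma pair_eq0_ae f : sqint f -> pair f f = 0 -> {ae mu, forall x, D x -> f x = 0}.
Proof.
move=> [mf hf] f0.
have mff : measurable_fun D (EFin \o (fun x => f x ^+ 2)) by exact: measurable_int hf.
have : (\int[mu]_(x in D) `|(EFin \o (fun x => f x ^+ 2)%R) x| = 0)%E.
  transitivity (\int[mu]_(x in D) (f x ^+ 2)%:E)%E.
    by apply: eq_integral => x _ /=; rewrite ger0_norm ?sqr_ge0.
  rewrite -(fineK (integrable_fin_num mD hf)); congr (_%:E); rewrite -[RHS]f0.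
  by congr fine; apply: eq_integral => x _; rewrite /= mul1r -expr2.
move/(ae_eq_integral_abs mu mD mff); apply: filterS => x h Dx.
by have := h Dx => -[/eqP]; rewrite sqrf_eq0 => /eqP.
Qed.

Lemma pair_le_add q f g : sqint q -> sqint f -> sqint g ->
  {ae mu, forall x, D x -> `|q x| <= `|f x| + `|g x|} ->
  pair q q <= 2 * (pair f f + pair g g).
Proof.
move=> hq hf hg h; have int u (hu : sqint u) := wpair_integrable (ess_bounded_cst 1) hu hu.
have int2 := integrableD mD (int f hf) (int g hg).
rewrite /wpair -RintegralD//; [|exact: int|exact: int].
rewrite -RintegralZl//; apply: ae_le_Rintegral => //; first exact: int.
  exact: (integrableZl mD 2 int2).
apply: filterS h => x + Dx => /(_ Dx) /=; rewrite !mul1r -!expr2.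
rewrite -(real_normK (num_real (q x))) -(real_normK (num_real (f x))) -(real_normK (num_real (g x))).
have := normr_ge0 (q x); have := normr_ge0 (f x); have := normr_ge0 (g x).
have := sqr_ge0 (`|f x| - `|g x|).
move: `|q x| `|f x| `|g x| => s t u; rewrite !expr2; nra.
Qed.

Lemma sqint_sum_sqr f g : sqint f /\ sqint g <->
  [/\ measurable_fun D f, measurable_fun D g &
    (\int[mu]_(x in D) (f x ^+ 2 + g x ^+ 2)%:E < +oo)%E].
Proof.
split=> [[[mf hf] [mg hg]]|[mf mg foo]].
  split => //; have := integrable_lty mD (integrableD mD hf hg).
  by congr (_ < _)%E; apply: eq_integral => x _; rewrite /= EFinD.
have mf2 : measurable_fun D (fun x => (f x ^+ 2)%:E).
  by apply/measurable_EFinP; exact: measurable_funX.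
have mg2 : measurable_fun D (fun x => (g x ^+ 2)%:E).
  by apply/measurable_EFinP; exact: measurable_funX.
have mfg : measurable_fun D (fun x => (f x ^+ 2 + g x ^+ 2)%:E).
  by apply/measurable_EFinP; apply: measurable_funD; exact: measurable_funX.
split; apply: sqint_lty => //; apply: le_lt_trans foo; apply: ge0_le_integral => //=.
- by move=> x _; rewrite lee_fin sqr_ge0.
- by move=> x _; rewrite lee_fin lerDl sqr_ge0.
- by move=> x _; rewrite lee_fin sqr_ge0.
- by move=> x _; rewrite lee_fin lerDr sqr_ge0.
Qed.

Lemma Rintegral_sum_sqr f g : sqint f -> sqint g ->
  \int[mu]_(x in D) (f x ^+ 2 + g x ^+ 2) = pair f f + pair g g.
Proof.
move=> hf hg; have c1 := ess_bounded_cst 1; rewrite -RintegralD//.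
- by apply: eq_Rintegral => x _ /=; rewrite !mul1r !expr2.
- exact: (wpair_integrable c1 hf hf).
- exact: (wpair_integrable c1 hg hg).
Qed.

Lemma sqint_ae_eq f g : measurable_fun D f -> sqint g ->
  {ae mu, forall x, D x -> f x = g x} -> sqint f.
Proof.
move=> mf [mg hg] fg; apply: sqint_lty => //; apply: le_lt_trans (integrable_lty mD hg).
rewrite le_eqVlt; apply/orP; left; apply/eqP; apply: ae_eq_integral => //.
- by apply/measurable_EFinP; exact: measurable_funX.
- by apply/measurable_EFinP; exact: measurable_funX.
by apply: filterS fg => x h Dx /=; rewrite h.
Qed.

Lemma sqintB f g : sqint f -> sqint g -> sqint (fun x => f x - g x).
Proof.
move=> hf hg; under eq_fun do rewrite -mulN1r.
by apply: sqintD => //; exact: sqintZ.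
Qed.

Lemma wpairBl M m f g h : ess_bounded M m -> sqint f -> sqint g -> sqint h ->
  wpair m (fun x => f x - g x) h = wpair m f h - wpair m g h.
Proof.
move=> mm hf hg hh; under eq_fun do rewrite -[- g _]mulN1r.
by rewrite (wpairDl mm hf (sqintZ mD (-1) hg) hh) (wpairZl (-1) mm hg hh) mulN1r.
Qed.

Definition sqint_pred : {pred T -> R} := fun f => `[< sqint f >].

Lemma sqint_submod_closed : submod_closed sqint_pred.
Proof.
split; first by apply/asboolP; exact: sqint0.
move=> c f g /asboolP hf /asboolP hg; apply/asboolP.
by apply: sqintD => //; exact: sqintZ.
Qed.

Lemma pair_semi_ip :
  semi_ip (fun u v : submodule sqint_submod_closed => pair (val u) (val v)).
Proof.
apply: submodule_semi_ip.
- by move=> u v _ _; exact: wpairC.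
- by move=> u v w /asboolP hu /asboolP hv /asboolP hw; apply: wpairDl hu hv hw; exact: ess_bounded_cst.
- by move=> c u v /asboolP hu /asboolP hv; apply: wpairZl hu hv; exact: ess_bounded_cst.
- by move=> u /asboolP hu; exact: pair_ge0.
Qed.

Lemma pair_CS f g : sqint f -> sqint g ->
  `|pair f g| <= Num.sqrt (pair f f) * Num.sqrt (pair g g).
Proof.
move=> hf hg; have hf' : f \in sqint_pred by exact/asboolP.
have hg' : g \in sqint_pred by exact/asboolP.
exact: (ip_CS pair_semi_ip (exist _ f hf') (exist _ g hg')).
Qed.

Lemma wpair_bound M m f g : 0 <= M -> ess_bounded M m -> sqint f -> sqint g ->
  `|wpair m f g| <= M * (Num.sqrt (pair f f) * Num.sqrt (pair g g)).
Proof.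
move=> M0 mm hf hg; have af := sqint_abs hf; have ag := sqint_abs hg.
apply: le_trans (le_normr_Rintegral mD (wpair_integrable mm hf hg)) _.
apply: (@le_trans _ _ (M * pair (fun x => `|f x|) (fun x => `|g x|))); last first.
  rewrite ler_wpM2l// (le_trans (ler_norm _))// (le_trans (pair_CS af ag))//.
  by rewrite !pair_abs.
have intp := wpair_integrable (ess_bounded_cst 1) af ag.
rewrite /wpair -RintegralZl//; apply: ae_le_Rintegral => //.
- exact: (integrable_norm (wpair_integrable mm hf hg)).
- exact: (integrableZl mD M intp).
case: mm => _; apply: filterS => x h Dx.
by rewrite !normrM mul1r -mulrA ler_wpM2r ?mulr_ge0 ?h.
Qed.

Lemma wpair_ess_bounded_sqint M m f : ess_bounded M m -> sqint f -> sqint (fun x => m x * f x).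
Proof. by move=> [mm hm]; exact: (sqint_bounded_mul mD mm hm). Qed.

Lemma pair_mul_le M m f : ess_bounded M m -> sqint f ->
  pair (fun x => m x * f x) (fun x => m x * f x) <= M ^+ 2 * pair f f.
Proof.
move=> mm hf; have hm := wpair_ess_bounded_sqint mm hf; have c1 := ess_bounded_cst 1.
have hff := wpair_integrable c1 hf hf.
rewrite /wpair -RintegralZl//; apply: ae_le_Rintegral => //.
- exact: (wpair_integrable c1 hm hm).
- exact: (integrableZl mD (M ^+ 2) hff).
case: mm => _; apply: filterS => x + Dx => /(_ Dx) h.
rewrite !mul1r -!expr2 exprMn ler_wpM2r ?sqr_ge0// -(real_normK (num_real (m x))).
by rewrite lerXn2r ?nnegrE//; apply: le_trans h.
Qed.

Lemma wpair1 m f g : wpair m f g = pair (fun x => m x * f x) g.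
Proof. by apply: eq_Rintegral => x _; rewrite mul1r. Qed.

End weighted_pairing.

Section bounded_bilinear.
Context (R : realType) (V : lmodType R) (N : V -> R).

Record bounded_bilinear (B : V -> V -> R) : Prop := BoundedBilinear {
  bilDl : forall u v w, B (u + v) w = B u w + B v w;
  bilZl : forall c u v, B (c *: u) v = c * B u v;
  bilDr : forall u v w, B w (u + v) = B w u + B w v;
  bilZr : forall c u v, B u (c *: v) = c * B u v;
  bil_bound : exists2 C, 0 <= C & forall u v, `|B u v| <= C * (N u * N v) }.

Lemma bilNl B (hB : bounded_bilinear B) u v : B (- u) v = - B u v.
Proof. by rewrite -scaleN1r bilZl// mulN1r. Qed.

Lemma bilNr B (hB : bounded_bilinear B) u v : B u (- v) = - B u v.
Proof. by rewrite -scaleN1r bilZr// mulN1r. Qed.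

Lemma bounded_bilinearD B B' : bounded_bilinear B -> bounded_bilinear B' ->
  bounded_bilinear (fun u v => B u v + B' u v).
Proof.
move=> hB hB'; split.
- by move=> u v w; rewrite !bilDl// addrACA.
- by move=> c u v; rewrite !bilZl// mulrDr.
- by move=> u v w; rewrite !bilDr// addrACA.
- by move=> c u v; rewrite !bilZr// mulrDr.
have [C C0 hC] := bil_bound hB; have [C' C'0 hC'] := bil_bound hB'.
exists (C + C'); first exact: addr_ge0.
by move=> u v; rewrite mulrDl; apply: le_trans (ler_normD _ _) (lerD _ _).
Qed.

Lemma bounded_bilinearZ c B : bounded_bilinear B ->
  bounded_bilinear (fun u v => c * B u v).
Proof.
move=> hB; split.
- by move=> u v w; rewrite !bilDl// mulrDr.
- by move=> c' u v; rewrite !bilZl// mulrCA.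
- by move=> u v w; rewrite !bilDr// mulrDr.
- by move=> c' u v; rewrite !bilZr// mulrCA.
have [C C0 hC] := bil_bound hB.
exists (`|c| * C); first exact: mulr_ge0.
by move=> u v; rewrite normrM -mulrA ler_wpM2l.
Qed.

Lemma bounded_bilinear_sum (I : finType) (B : I -> V -> V -> R) :
  seminorm N -> (forall i, bounded_bilinear (B i)) ->
  bounded_bilinear (fun u v => \sum_i B i u v).
Proof.
move=> hN hB; split.
- by move=> u v w; rewrite -big_split/=; apply: eq_bigr => i _; rewrite bilDl.
- by move=> c u v; rewrite mulr_sumr; apply: eq_bigr => i _; rewrite bilZl.
- by move=> u v w; rewrite -big_split/=; apply: eq_bigr => i _; rewrite bilDr.
- by move=> c u v; rewrite mulr_sumr; apply: eq_bigr => i _; rewrite bilZr.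
have /choice[C hC] : forall i, exists C, 0 <= C /\ forall u v, `|B i u v| <= C * (N u * N v).
  by move=> i; have [C C0 h] := bil_bound (hB i); exists C.
exists (\sum_i C i); first by apply: sumr_ge0 => i _; case: (hC i).
move=> u v; rewrite mulr_suml; apply: le_trans (ler_norm_sum _ _ _) _.
by apply: ler_sum => i _; case: (hC i).
Qed.

End bounded_bilinear.

Lemma bounded_bilinear_restrict (R : realType) (V : lmodType R) (N : V -> R) (S : {pred V}) (hS : submod_closed S) B :
  bounded_bilinear N B ->
  @bounded_bilinear R (submodule hS) (fun u => N (val u)) (fun u v => B (val u) (val v)).
Proof.
move=> hB; split.
- by move=> u v w; rewrite submoduleD (bilDl hB).
- by move=> c u v; rewrite submoduleZ (bilZl hB).
- by move=> u v w; rewrite submoduleD (bilDr hB).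
- by move=> c u v; rewrite submoduleZ (bilZr hB).
by have [C C0 hC] := bil_bound hB; exists C.
Qed.

Lemma sum_option (R : nmodType) (I : finType) (F : option I -> R) :
  \sum_k F k = F None + \sum_i F (Some i).
Proof.
rewrite (bigD1 None)//=; congr (_ + _).
rewrite (reindex_omap Some id); last by case.
by apply: eq_bigl => i; rewrite /= eqxx.
Qed.

Lemma pairE d (T : measurableType d) (R : realType) (mu : {measure set T -> \bar R})
  (D : set T) (f : T -> R) : wpair mu D (fun=> 1) f f = \int[mu]_(x in D) f x ^+ 2.
Proof. by apply: eq_Rintegral => x _; rewrite mul1r expr2. Qed.

Lemma wpair_eq0 d (T : measurableType d) (R : realType) (mu : {measure set T -> \bar R})
  (D : set T) (m f g : T -> R) : (forall x, f x = 0) -> wpair mu D m f g = 0.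
Proof.
move=> f0; rewrite /wpair /Rintegral (_ : (fun x => _) = cst 0%E) ?integral0//.
by apply/funext => x; rewrite f0 mulr0 mul0r.
Qed.

(** * Finite families of square-integrable functions *)

Section vector_L2.
Context d (T : measurableType d) (R : realType) (mu : {measure set T -> \bar R}).
Variables (D : set T) (K : finType).
Hypothesis mD : measurable D.
Local Notation sqint := (sqint mu D).
Local Notation pair := (wpair mu D (fun=> 1)).
Local Notation wpair := (wpair mu D).

Definition L2vec_pred : {pred K -> T -> R} := fun U => `[< forall k, sqint (U k) >].

Lemma L2vec_submod_closed : submod_closed L2vec_pred.
Proof.
split; first by apply/asboolP => k; exact: sqint0.
move=> c f g /asboolP hf /asboolP hg; apply/asboolP => k.
by apply: sqintD => //; exact: sqintZ.
Qed.

Local Notation L2vec := (submodule L2vec_submod_closed).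

Lemma L2vec_sqint (U : L2vec) k : sqint (val U k).
Proof. by have /asboolP := valP U. Qed.

Lemma L2vecD (U V : L2vec) k : val (U + V) k = (fun x => val U k x + val V k x).
Proof. by rewrite submoduleD. Qed.

Lemma L2vecZ c (U : L2vec) k : val (c *: U) k = (fun x => c * val U k x).
Proof. by rewrite submoduleZ. Qed.

Lemma L2vecN (U : L2vec) k : val (- U) k = (fun x => - val U k x).
Proof. by rewrite submoduleN. Qed.

Definition toL2vec (f : K -> T -> R) (hf : forall k, sqint (f k)) : L2vec :=
  exist _ f (introT (asboolP _) hf).

Definition L2ip (U V : L2vec) : R := \sum_k pair (val U k) (val V k).
Local Notation norm := (ipnorm L2ip).

Lemma L2ip_semi_ip : semi_ip L2ip.
Proof.
split.
- by move=> U V; apply: eq_bigr => k _; exact: wpairC.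
- move=> U V W; rewrite /L2ip -big_split; apply: eq_bigr => k _.
  by rewrite L2vecD (wpairDl mD (ess_bounded_cst _ _ 1)) //; exact: L2vec_sqint.
- move=> c U V; rewrite /L2ip mulr_sumr; apply: eq_bigr => k _.
  by rewrite L2vecZ (wpairZl mD c (ess_bounded_cst _ _ 1)) //; exact: L2vec_sqint.
- by move=> U; apply: sumr_ge0 => k _; apply: pair_ge0 => //; exact: L2vec_sqint.
Qed.

Lemma component_le (U : L2vec) k : Num.sqrt (pair (val U k) (val U k)) <= norm U.
Proof.
rewrite ler_wsqrtr// /L2ip (bigD1 k)//= lerDl sumr_ge0// => i _.
by apply: pair_ge0 => //; exact: L2vec_sqint.
Qed.

Lemma wpair_bounded_bilinear M m k l : 0 <= M -> ess_bounded mu D M m ->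
  bounded_bilinear norm (fun U V : L2vec => wpair m (val U k) (val V l)).
Proof.
move=> M0 mm; split.
- by move=> U V W; rewrite L2vecD (wpairDl mD mm) //; exact: L2vec_sqint.
- by move=> c U V; rewrite L2vecZ (wpairZl mD c mm) //; exact: L2vec_sqint.
- move=> U V W; rewrite L2vecD ![wpair m (val W k) _]wpairC.
  by rewrite (wpairDl mD mm) //; exact: L2vec_sqint.
- move=> c U V; rewrite L2vecZ ![wpair m (val U k) _]wpairC.
  by rewrite (wpairZl mD c mm) //; exact: L2vec_sqint.
exists M => // U V; apply: le_trans (wpair_bound mD M0 mm _ _) _; try exact: L2vec_sqint.
by rewrite ler_wpM2l// ler_pM ?component_le.
Qed.

(** Every second term is kept, so that the squared increments decay like [1 / 16 ^+ m], as
    [sqint_complete] requires; the omitted terms follow by [geo_steps]. *)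
Lemma L2vec_complete : geo_complete norm.
Proof.
have hN := ipnorm_seminorm L2ip_semi_ip.
apply: geo_completeI => // u C hu.
have C0 : 0 <= C.
  by have := hu 0%N; rewrite expr0 divr1; exact: le_trans (seminorm_ge0 hN _).
have step m k : \int[mu]_(x in D) (val (u m.+1.*2) k x - val (u m.*2) k x) ^+ 2
    <= 4 * C ^+ 2 / 16 ^+ m.
  have := geo_steps hN hu m.*2 2; rewrite addn2 => h.
  have := le_trans (component_le (u m.+1.*2 - u m.*2) k) h.
  have c0 : 0 <= 2 * C / 2 ^+ m.*2 by rewrite divr_ge0 ?mulr_ge0 ?exprn_ge0.
  move: (L2vec_sqint (u m.+1.*2 - u m.*2) k).
  rewrite L2vecD L2vecN => hd h'; rewrite -pairE -[leLHS]sqr_sqrtr ?pair_ge0//.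
  move: h' c0; set p := Num.sqrt _; set q := _ / _ => h' c0.
  rewrite (_ : 4 * _ / _ = q ^+ 2); first by rewrite lerXn2r ?nnegrE ?sqrtr_ge0.
  rewrite /q {h' c0 p q}.
  rewrite expr_div_n exprMn -exprM -mul2n mulnAC exprM.
  by congr (_ * _ / _ ^+ _); rewrite -natrX.
have hg k : exists gc : (T -> R) * R, [/\ sqint gc.1, 0 <= gc.2 &
    forall m, pair (fun x => gc.1 x - val (u m.*2) k x) (fun x => gc.1 x - val (u m.*2) k x)
      <= gc.2 / 4 ^+ m].
  have [|g [C' [hg hC _]]] := sqint_complete mD _ (step^~ k).
    by move=> m; exact: L2vec_sqint.
  exists (g, `|C'|); split => //= m; rewrite pairE; apply: le_trans (hC m) _.
  by rewrite ler_wpM2r ?ler_norm// invr_ge0 exprn_ge0.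
have /choice[gc hgc] := hg.
have [w hw] : exists w : L2vec, forall k, val w k = (gc k).1.
  have h k : sqint (gc k).1 by case: (hgc k).
  by exists (toL2vec h).
pose S := \sum_k (gc k).2.
have S0 : 0 <= S by apply: sumr_ge0 => k _; case: (hgc k).
have even m : norm (w - u m.*2) <= Num.sqrt S / 2 ^+ m.
  have -> : Num.sqrt S / 2 ^+ m = Num.sqrt (S / 4 ^+ m).
    rewrite sqrtrM// (_ : 4 ^+ m = (2 ^+ m) ^+ 2 :> R); last first.
      by rewrite exprAC; congr (_ ^+ m); rewrite -natrX.
    by rewrite sqrtrV ?sqr_ge0// sqrtr_sqr ger0_norm// exprn_ge0.
  rewrite ler_wsqrtr// /L2ip /S mulr_suml; apply: ler_sum => k _.
  by rewrite L2vecD L2vecN hw; case: (hgc k).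
exists w => e e0; have [k0 hk] := geo_small (Num.sqrt S + 2 * C) e0.
exists k0 => k kk; apply: le_trans (seminorm_tri hN (u k.*2) _ _) _.
have := geo_steps hN hu k k; rewrite addnn => h.
apply: le_trans (lerD (even k) h) _; rewrite -mulrDl; apply: le_trans _ (ltW hk).
rewrite ler_wpM2l ?addr_ge0 ?mulr_ge0 ?sqrtr_ge0// lef_pV2 ?posrE ?exprn_gt0//.
by rewrite ler_weXn2l// ler1n.
Qed.

End vector_L2.

Section test_space.
Context (R : realType) (n : nat) (Omega : set 'rV[R]_n).
Local Notation E := 'rV[R]_n.
Local Notation mu := (lebesgue R n).
Local Notation L := (lebesgue_space R n).
Local Notation sqint := (@sqint _ L R mu Omega).
Hypothesis oO : open Omega.

Lemma rtest0 : rtest Omega (fun=> 0).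
Proof.
split; first by apply: smooth_alg_smooth; exact: smooth_alg_cst.
by exists set0; split => //; exact: compact0.
Qed.

Lemma rtest_linear c (f g : E -> R) : rtest Omega f -> rtest Omega g ->
  rtest Omega (fun x => c * f x + g x).
Proof.
move=> [sf [K [cK KO fK]]] [sg [K' [cK' K'O gK]]]; split.
  exact: (smoothD (smoothZ c sf) sg).
exists (K `|` K'); split; first exact: compactU.
  by move=> x [/KO|/K'O].
by move=> x /not_orP[/fK-> /gK->]; rewrite mulr0 addr0.
Qed.

Lemma smooth_partial_linear c (f g : E -> R) j x : smooth f -> smooth g ->
  partial j (fun x => c * f x + g x) x = c * partial j f x + partial j g x.
Proof.
move=> sf sg; have [_ df] := sf [::]; have [_ dg] := sg [::].
rewrite /partial deriveD//; last exact: (derivableZ (df x j)).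
by congr (_ + _); apply: (deriveZ c (df x j)).
Qed.

Lemma Linfty_ess_bounded a : Linfty Omega a -> exists2 M, 0 <= M & @ess_bounded _ L R mu Omega M a.
Proof.
move=> [ma aoo].
have [M M0 hM] : exists2 M : R, 0 <= M & (ess_sup_on Omega (fun x => `|a x|%R) <= M%:E)%E.
  move: aoo; case: (ess_sup_on _ _) => [r _|//|_]; last by exists 0; rewrite ?leNye.
  by exists `|r| => //; rewrite lee_fin ler_norm.
exists M => //; split => //.
have /ess_supP := hM; apply: (@filterS L (almost_everywhere mu) _) => x /= + Ox.
by rewrite mem_set// lee_fin.
Qed.

Lemma Linfty_loc_bounded b K : Linfty_loc Omega b -> compact K -> K `<=` Omega ->
  exists2 M, 0 <= M & {ae mu, forall x, K x -> `|b x| <= M}.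
Proof.
move=> [mb h] cK KO; have {h} boo := h K cK KO.
have [M M0 hM] : exists2 M : R, 0 <= M & (ess_sup_on K (fun x => `|b x|%R) <= M%:E)%E.
  move: boo; case: (ess_sup_on _ _) => [r _|//|_]; last by exists 0; rewrite ?leNye.
  by exists `|r| => //; rewrite lee_fin ler_norm.
exists M => //; have /ess_supP := hM.
apply: (@filterS L (almost_everywhere mu) _) => x /= + Ox.
by rewrite mem_set// lee_fin.
Qed.

Lemma bmin_le b : (-oo < ess_inf_on Omega b)%E -> ae_on Omega (fun x => bmin Omega b <= b x).
Proof.
move=> hb; have := @ess_inf_le _ L R mu (fun x => if x \in Omega then (b x)%:E else +oo%E).
apply: (@filterS L (almost_everywhere mu) _) => x /= + Ox.
rewrite mem_set//; rewrite /bmin; move: hb; rewrite /ess_inf_on.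
by case: (ess_inf _ _) => [r| |].
Qed.

Lemma compact_measurable (K : set E) : compact K -> measurable (K : set L).
Proof.
move=> cK; rewrite -(setCK K); apply: measurableC; apply: borel_lebesgue_measurable.
by apply: open_measurable_rV; rewrite openC; apply: compact_closed.
Qed.

(** The weight may be unbounded away from [K]; as [phi] vanishes there, it can be multiplied by the
    indicator of [K]. *)
Lemma sqint_local m phi (M : R) K : measurable_fun (Omega : set L) (m : L -> R) ->
  compact K -> K `<=` Omega -> {ae mu, forall x, K x -> `|m x| <= M} ->
  rtest Omega phi -> (forall x, ~ K x -> phi x = 0) -> sqint (fun x => m x * phi x).
Proof.
move=> mm cK KO mM tp pK.
rewrite (_ : (fun x => _) = (fun x => (\1_K x * m x) * phi x)); last first.
  apply/funext => x; rewrite indicE; have [Kx|Kx] := pselect (K x).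
    by rewrite mem_set// mul1r.
  by rewrite pK// !mulr0.
have M0 : {ae mu, forall x, Omega x -> `|\1_K x * m x| <= Num.max M 0}.
  move: mM; apply: (@filterS L (almost_everywhere mu) _) => x h Ox.
  rewrite indicE; have [Kx|Kx] := pselect (K x).
    by rewrite mem_set// mul1r le_max h.
  by rewrite memNset// mul0r normr0 le_max lexx orbT.
apply: (@sqint_bounded_mul _ L R mu Omega (measurable_Omega oO) _ _ _ _ M0).
  by apply: measurable_funM => //; exact/measurable_indic/compact_measurable.
exact: rtest_sqint.
Qed.

End test_space.

(** * The energy space *)

Section energy_space.
Context (R : realType) (n : nat) (Omega : set 'rV[R]_n) (b : 'rV[R]_n -> R).
Local Notation E := 'rV[R]_n.
Local Notation mu := (lebesgue R n).
Local Notation L := (lebesgue_space R n).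
Local Notation sqint := (@sqint _ L R mu Omega).
Local Notation pair := (@wpair _ L R mu Omega (fun=> 1)).
Local Notation wpair := (@wpair _ L R mu Omega).
Hypothesis oO : open Omega.
Hypothesis hb : Linfty_loc Omega b.

Definition root_weight (x : E) : R := Num.sqrt (b x - bmin Omega b).
Local Notation beta := root_weight.

Lemma root_weight_measurable : measurable_fun (Omega : set L) (beta : L -> R).
Proof.
have [mb _] := hb; apply: (measurableT_comp (f := @Num.sqrt R)).
  by apply: continuous_measurable_fun; exact: sqrt_continuous.
by apply: measurable_funB => //; exact: measurable_cst.
Qed.

Lemma root_weight_sqint phi : rtest Omega phi -> sqint (fun x => beta x * phi x).
Proof.
move=> tp; have [sp [K [cK KO pK]]] := tp.
have [M M0 hM] := Linfty_loc_bounded hb cK KO.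
apply: (sqint_local (M := Num.sqrt (M + `|bmin Omega b|)) oO root_weight_measurable cK KO) => //.
move: hM; apply: (@filterS L (almost_everywhere mu) _) => x h Kx.
rewrite ger0_norm ?sqrtr_ge0// ler_wsqrtr//.
by apply: le_trans (ler_norm _) _; apply: le_trans (ler_normB _ _) _; rewrite lerD2r h.
Qed.

Lemma potential_sqint phi : rtest Omega phi -> sqint (fun x => b x * phi x).
Proof.
move=> tp; have [sp [K [cK KO pK]]] := tp; have [mb _] := hb.
have [M M0 hM] := Linfty_loc_bounded hb cK KO.
exact: (sqint_local oO mb cK KO hM tp pK).
Qed.

(* A state is a real-valued pair (position [w], velocity [v]), stored together
   with [sqrt (b - bmin) w] and the partial derivatives of [w], so that the energy
   is the plain [L^2] norm of a vector-valued function. *)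
Definition state_index := option (option (option 'I_n)).
Definition velocity : state_index := None.
Definition position : state_index := Some None.
Definition root_position : state_index := Some (Some None).
Definition gradient j : state_index := Some (Some (Some j)).

Definition state_fun (chi phi : E -> R) (k : state_index) : E -> R :=
  match k with
  | None => chi
  | Some None => phi
  | Some (Some None) => fun x => beta x * phi x
  | Some (Some (Some j)) => partial j phi
  end.

Local Notation L2v := (submodule (@L2vec_submod_closed _ L R mu Omega state_index (measurable_Omega oO))).
Local Notation L2N := (ipnorm (@L2ip _ L R mu Omega state_index (measurable_Omega oO))).

(** The velocity [chi] is left arbitrary because velocities range over all of [L^2]; only positions
    have to be limits of test functions. *)
Definition test_state (U : L2v) :=
  exists chi phi, rtest Omega phi /\ val U = state_fun chi phi.

Lemma L2N_seminorm : seminorm L2N.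
Proof. exact (ipnorm_seminorm (@L2ip_semi_ip _ L R mu Omega state_index (measurable_Omega oO))). Qed.

Lemma test_state0 : test_state 0.
Proof.
exists (fun=> 0), (fun=> 0); split; first exact: rtest0.
apply/funext => -[[[j|]|]|] //; apply/funext => x /=; last by rewrite mulr0.
by rewrite /partial derive_cst.
Qed.

Lemma test_state_linear c U V : test_state U -> test_state V -> test_state (c *: U + V).
Proof.
move=> [chi [phi [tp hU]]] [chi' [phi' [tp' hV]]].
exists (fun x => c * chi x + chi' x), (fun x => c * phi x + phi' x).
split; first exact: rtest_linear.
rewrite submoduleD submoduleZ hU hV; apply/funext => -[[[j|]|]|] //; apply/funext => x /=.
- by rewrite smooth_partial_linear//; [case: tp|case: tp'].
- by rewrite [LHS](_ : _ = c * (beta x * phi x) + beta x * phi' x)//; ring.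
Qed.

Lemma energy_submod_closed : submod_closed (subclosure L2N test_state).
Proof. exact: subclosure_submod_closed L2N_seminorm test_state0 test_state_linear. Qed.
Local Notation X := (submodule energy_submod_closed).

Definition component (U : X) (k : state_index) : E -> R := val (val U) k.
Local Notation cmp := component.

Definition energy_ip (U V : X) : R := L2ip (val U) (val V).
Local Notation N := (ipnorm energy_ip).

Lemma energy_ipE U V : energy_ip U V = \sum_k pair (cmp U k) (cmp V k).
Proof. by []. Qed.

Lemma energy_normE U : N U = L2N (val U).
Proof. by []. Qed.

Lemma energy_semi_ip : semi_ip energy_ip.
Proof.
exact (semi_ip_restrict energy_submod_closed
  (@L2ip_semi_ip _ L R mu Omega state_index (measurable_Omega oO))).
Qed.

Lemma energy_seminorm : seminorm N. Proof. exact (ipnorm_seminorm energy_semi_ip). Qed.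

Lemma energy_complete : geo_complete N.
Proof.
apply: (submodule_complete L2N_seminorm (h := energy_submod_closed)).
exact: L2vec_complete.
Qed.

Lemma component_sqint U k : sqint (cmp U k). Proof. exact: L2vec_sqint. Qed.

Lemma componentD U V k : cmp (U + V) k = (fun x => cmp U k x + cmp V k x).
Proof. by rewrite /cmp (submoduleD U V) (L2vecD (val U) (val V)). Qed.

Lemma componentZ c U k : cmp (c *: U) k = (fun x => c * cmp U k x).
Proof. by rewrite /cmp (submoduleZ c U) (L2vecZ c (val U)). Qed.

Lemma componentN U k : cmp (- U) k = (fun x => - cmp U k x).
Proof. by rewrite /cmp (submoduleN U) (L2vecN (val U)). Qed.

Lemma componentB U V k : cmp (U - V) k = (fun x => cmp U k x - cmp V k x).
Proof. by rewrite componentD componentN. Qed.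

Lemma component_norm_le U k : Num.sqrt (pair (cmp U k) (cmp U k)) <= N U.
Proof. exact: (@component_le _ L R mu Omega state_index (measurable_Omega oO)). Qed.

Lemma component_sq_le U k : pair (cmp U k) (cmp U k) <= energy_ip U U.
Proof.
have p0 := pair_ge0 (measurable_Omega oO) (component_sqint U k).
rewrite -(sqr_ipnorm energy_semi_ip) -[leLHS](sqr_sqrtr p0).
by rewrite lerXn2r ?nnegrE ?sqrtr_ge0// component_norm_le.
Qed.

Lemma energy_bounded_bilinear M m k l : 0 <= M -> @ess_bounded _ L R mu Omega M m ->
  bounded_bilinear N (fun U V => wpair m (cmp U k) (cmp V l)).
Proof.
move=> M0 hm; exact (bounded_bilinear_restrict energy_submod_closed
  (@wpair_bounded_bilinear _ L R mu Omega state_index (measurable_Omega oO) M m k l M0 hm)).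
Qed.

Lemma test_state_sqint chi phi k : sqint chi -> rtest Omega phi -> sqint (state_fun chi phi k).
Proof.
move=> hchi tphi; case: k => [[[j|]|]|].
- exact (rtest_sqint oO (rtest_partial j tphi)).
- exact (root_weight_sqint tphi).
- exact (rtest_sqint oO tphi).
exact hchi.
Qed.

(** The sum omits the velocity, which every approximating test state can match exactly. *)
Lemma energy_state (f : state_index -> E -> R) : (forall k, sqint (f k)) ->
  (forall e : R, 0 < e -> exists2 phi, rtest Omega phi &
    \sum_(k : option (option 'I_n)) pair (fun x => f (Some k) x - state_fun (f None) phi (Some k) x)
       (fun x => f (Some k) x - state_fun (f None) phi (Some k) x) < e) ->
  exists U, cmp U = f.
Proof.
move=> hf happ; pose u : L2v := toL2vec (measurable_Omega oO) hf.
suff hu : u \in subclosure L2N test_state by exists (exist _ u hu).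
apply/subclosureP => e e0; have [phi tphi hphi] := happ (e ^+ 2) ltac:(by rewrite exprn_gt0).
pose v : L2v := toL2vec (measurable_Omega oO) (fun k => test_state_sqint k (hf None) tphi).
exists v; first by exists (f None), phi.
rewrite /ipnorm -(ger0_norm (ltW e0)) -sqrtr_sqr ltr_sqrt ?exprn_gt0//.
rewrite /L2ip sum_option.
have d k : val (u - v) k = fun x => f k x - state_fun (f None) phi k x.
  by rewrite L2vecD L2vecN.
rewrite d [X in X + _](_ : _ = 0); last first.
  by apply: wpair_eq0 => x; exact: subrr.
by rewrite add0r; under eq_bigr do rewrite d.
Qed.

Lemma energy_test_state chi phi : sqint chi -> rtest Omega phi ->
  exists U, cmp U = state_fun chi phi.
Proof.
move=> hchi tphi; apply: energy_state => [k|e e0]; first exact: test_state_sqint.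
exists phi => //; rewrite big1// => k _.
by apply: wpair_eq0 => x; exact: subrr.
Qed.

Lemma energy_approx U (e : R) : 0 < e ->
  exists V chi phi, [/\ rtest Omega phi, cmp V = state_fun chi phi & N (U - V) < e].
Proof.
move=> e0; have /subclosureP/(_ e e0)[j tj hj] := valP U.
have [chi [phi [tphi hv]]] := tj.
have jS := mem_subclosure L2N_seminorm tj.
have [V hV] : exists V : X, val V = j by exists (exist _ j jS).
exists V, chi, phi; split; [exact: tphi|by rewrite /component hV|].
by rewrite energy_normE (submoduleD U) (submoduleN V) hV.
Qed.

(** Velocity and position vary independently. The resolvent equation uses this to impose a velocity,
    and to test with velocity 0. *)
Lemma energy_set_velocity U chi : sqint chi ->
  exists V, cmp V velocity = chi /\ forall k, cmp V (Some k) = cmp U (Some k).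
Proof.
move=> hchi.
have [||V hV] := @energy_state (fun k => if k is Some k' then cmp U (Some k') else chi).
- by move=> [k|]//; exact: component_sqint.
- move=> e e0; have [V [chi' [phi [tphi hV hUV]]]] := energy_approx U (e := Num.sqrt e) ltac:(by rewrite sqrtr_gt0).
  exists phi => //; move: hUV; rewrite /ipnorm ltr_sqrt//; apply: le_lt_trans.
  rewrite energy_ipE [leRHS]sum_option -[leLHS]add0r; apply: lerD.
    exact (pair_ge0 (measurable_Omega oO) (component_sqint (U - V) velocity)).
  apply: ler_sum => k _; rewrite componentB hV.
  by case: k => [[j|]|].
by exists V; rewrite hV.
Qed.

(* Multiplying by [exp (- beta)] makes the unbounded weight [beta] harmless in the
   passage to the limit. *)
Lemma energy_root_position U :
  ae_on Omega (fun x => cmp U root_position x = beta x * cmp U position x).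
Proof.
have quarter (s t e : R) : s <= e / 4 -> t <= e / 4 -> 2 * (s + t) <= e by lra.
have mO := measurable_Omega oO; have mb := root_weight_measurable.
pose g x := expR (- beta x).
have mg : measurable_fun (Omega : set L) (g : L -> R).
  apply: (measurableT_comp (f := @expR R)); first exact: measurable_expR.
  by apply: measurable_funN.
have b0 x : 0 <= beta x by exact: sqrtr_ge0.
have g0 x : 0 < g x by exact: expR_gt0.
have g1 x : `|g x| <= 1 by rewrite gtr0_norm// expR_le1 oppr_le0.
have gb1 x : `|g x * beta x| <= 1.
  rewrite ger0_norm ?mulr_ge0 ?(ltW (g0 x))// /g expRN mulrC ler_pdivrMr ?expR_gt0// mul1r.
  by apply: le_trans _ (expR_ge1Dx _); rewrite lerDr.
pose q V x := g x * cmp V root_position x - (g x * beta x) * cmp V position x.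
have sq V : sqint (q V).
  have h1 : sqint (fun x => g x * cmp V root_position x).
    apply: (@sqint_bounded_mul _ L R mu Omega mO 1 _ _ mg); last exact: component_sqint.
    exact: aeW.
  have h2 : sqint (fun x => (g x * beta x) * cmp V position x).
    apply: (@sqint_bounded_mul _ L R mu Omega mO 1 _ _ _); last exact: component_sqint.
      exact: measurable_funM.
    exact: aeW.
  have h3 := @sqintZ _ L R mu Omega mO (-1) _ h2.
  have -> : q V = fun x => g x * cmp V root_position x + -1 * ((g x * beta x) * cmp V position x).
    by apply/funext => x; rewrite /q mulN1r.
  exact (@sqintD _ L R mu Omega mO _ _ h1 h3).
suff : pair (q U) (q U) = 0.
  move=> /(@pair_eq0_ae _ L R mu Omega mO _ (sq U)).
  apply: ae_onW => x Ox; rewrite /q -mulrA -mulrBr => /eqP.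
  by rewrite mulf_eq0 gt_eqF//= subr_eq0 => /eqP.
apply/eqP; rewrite eq_le; apply/andP; split; last exact: pair_ge0.
apply/ler_addgt0Pr => e e0; rewrite add0r.
have [V [chi [phi [tphi hV hUV]]]] := energy_approx U (e := Num.sqrt (e / 4)) ltac:(by rewrite sqrtr_gt0 divr_gt0).
have qE x : q U x = g x * cmp (U - V) root_position x - (g x * beta x) * cmp (U - V) position x.
  by rewrite !componentB hV /q /=; ring.
move: hUV; rewrite /ipnorm ltr_sqrt ?divr_gt0// => hUV.
set dr := cmp (U - V) root_position in qE; set dp := cmp (U - V) position in qE.
have hr := component_sqint (U - V) root_position; have hp := component_sqint (U - V) position.
have br : pair dr dr <= e / 4 := le_trans (component_sq_le _ _) (ltW hUV).
have bp : pair dp dp <= e / 4 := le_trans (component_sq_le _ _) (ltW hUV).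
apply: le_trans (pair_le_add mO (sq U) hr hp _) (quarter _ _ _ br bp).
apply: aeW => x _; rewrite qE; apply: le_trans (ler_normB _ _) _.
rewrite normrM [X in _ + X]normrM; apply: lerD; apply: ler_piMl; [exact: normr_ge0| |exact: normr_ge0|].
  exact: g1.
exact: gb1.
Qed.

(** Integration by parts holds on test states, and both sides are continuous in the energy norm. *)
Lemma energy_weak_derivative U j phi : rtest Omega phi ->
  pair (cmp U position) (partial j phi) = - pair (cmp U (gradient j)) phi.
Proof.
move=> tphi; have mO := measurable_Omega oO.
have tj := rtest_partial j tphi.
have sphi := rtest_sqint oO tphi; have sj := rtest_sqint oO tj.
have c1 := @ess_bounded_cst _ L R mu Omega 1.
apply/eqP; rewrite -subr_eq0 opprK -normr_le0; apply/ler_addgt0Pr => e e0; rewrite add0r.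
set C := Num.sqrt (pair (partial j phi) (partial j phi)) + Num.sqrt (pair phi phi).
have C0 : 0 <= C by rewrite addr_ge0 ?sqrtr_ge0.
have C1 : 0 < C + 1 by rewrite ltr_wpDl.
have [V [chi [psi [tpsi hV hUV]]]] := energy_approx U (e := e / (C + 1)) ltac:(by rewrite divr_gt0).
have split k f : sqint f -> pair (cmp U k) f = pair (cmp (U - V) k) f + pair (cmp V k) f.
  move=> sf; rewrite -(wpairDl mO c1 (component_sqint _ _) (component_sqint _ _) sf).
  by congr (wpair _ _ f); apply/funext => x; rewrite componentB subrK.
rewrite (split _ _ sj) (split _ _ sphi) addrACA.
have -> : pair (cmp V position) (partial j phi) + pair (cmp V (gradient j)) phi = 0.
  rewrite hV /=; apply/eqP; rewrite addr_eq0; apply/eqP.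
  by rewrite !wpair1E; exact (integration_by_parts oO j tpsi tphi).
rewrite addr0; apply: le_trans (ler_normD _ _) _.
have bd k f : sqint f -> `|pair (cmp (U - V) k) f| <= e / (C + 1) * Num.sqrt (pair f f).
  move=> sf; apply: le_trans (pair_CS mO (component_sqint _ _) sf) _.
  rewrite ler_wpM2r ?sqrtr_ge0//.
  exact: le_trans (component_norm_le _ _) (ltW hUV).
apply: le_trans (lerD (bd _ _ sj) (bd _ _ sphi)) _.
rewrite -mulrDr -/C mulrAC ler_pdivrMr// ler_wpM2l ?(ltW e0)//.
by rewrite lerDl.
Qed.

End energy_space.

(** * The damped operator *)

Section damped_operator.
Context (R : realType) (n : nat) (Omega : set 'rV[R]_n) (b : 'rV[R]_n -> R).
Local Notation E := 'rV[R]_n.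
Local Notation mu := (lebesgue R n).
Local Notation L := (lebesgue_space R n).
Local Notation sqint := (@sqint _ L R mu Omega).
Local Notation pair := (@wpair _ L R mu Omega (fun=> 1)).
Local Notation wpair := (@wpair _ L R mu Omega).
Local Notation vel := (velocity n).
Local Notation pos := (position n).
Local Notation rpos := (root_position n).
Hypothesis oO : open Omega.
Hypothesis hb : Linfty_loc Omega b.
Hypothesis b_ge : ae_on Omega (fun x => bmin Omega b <= b x).

Local Notation X := (submodule (energy_submod_closed b oO)).
Local Notation cmp := (@component R n Omega b oO).
Local Notation ip := (@energy_ip R n Omega b oO).
Local Notation N := (ipnorm ip).

Definition cpair m k l (U V : X) := wpair m (cmp U k) (cmp V l).
Local Notation p := (cpair (fun=> 1)).

(** The form [s0] on positions: since [b = beta^2 + bmin], the potential term becomes a pairing of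
    stored [L^2] components. *)
Definition energy_form (U V : X) :=
  (\sum_j p (gradient j) (gradient j) U V + p rpos rpos U V) + bmin Omega b * p pos pos U V.
Local Notation form := energy_form.

Variables (g : E -> R) (M lam : R).
Hypothesis M_ge0 : 0 <= M.
Hypothesis g_bounded : @ess_bounded _ L R mu Omega M g.
Hypothesis lam_gt0 : 0 < lam.
Hypothesis g_ge : ae_on Omega (fun x => 0 <= 2 * lam + g x).

Local Notation G := (cpair g).

Let hN : seminorm N := energy_seminorm b oO.

Lemma cpair_bilinear M' m k l : 0 <= M' -> @ess_bounded _ L R mu Omega M' m ->
  bounded_bilinear N (cpair m k l).
Proof. exact: energy_bounded_bilinear. Qed.

Let one_bounded := @ess_bounded_cst _ L R mu Omega 1.

Lemma p_bilinear k l : bounded_bilinear N (p k l).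
Proof. exact (cpair_bilinear k l (normr_ge0 1) one_bounded). Qed.

Lemma G_bilinear k l : bounded_bilinear N (G k l).
Proof. exact (cpair_bilinear k l M_ge0 g_bounded). Qed.

Lemma form_bilinear : bounded_bilinear N form.
Proof.
apply: bounded_bilinearD; last exact (bounded_bilinearZ _ (p_bilinear _ _)).
apply: bounded_bilinearD; last exact (p_bilinear _ _).
by apply: bounded_bilinear_sum => // j; exact (p_bilinear _ _).
Qed.

Lemma cpairC m k l U V : cpair m k l U V = cpair m l k V U.
Proof. exact: wpairC. Qed.

Lemma formC U V : form U V = form V U.
Proof.
rewrite /form (cpairC _ rpos) (cpairC _ pos); congr (_ + _ + _).
by apply: eq_bigr => j _; exact: cpairC.
Qed.

Lemma form_ip U V : ip U V = p vel vel U V + (1 - bmin Omega b) * p pos pos U V + form U V.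
Proof. by rewrite energy_ipE !sum_option /form /cpair; ring. Qed.

(* [V] is the time derivative of the state [U], in weak form: the position of [V]
   is the velocity [v] of [U], and the velocity of [V] is [- g v - S0 w] for [w]
   the position of [U]. *)
Definition damped (U V : X) :=
  ae_on Omega (fun x => cmp V pos x = cmp U vel x) /\
  forall Z, form Z U = - (p pos vel Z V + G pos vel Z U).

Lemma cpair_ae M' m k k' l U U' V : @ess_bounded _ L R mu Omega M' m ->
  ae_on Omega (fun x => cmp U k x = cmp U' k' x) ->
  cpair m k l U V = cpair m k' l U' V.
Proof.
move=> hm h; apply: (wpair_ae_eq (measurable_Omega oO) hm) => //; exact: component_sqint.
Qed.

Lemma dampedD U V U' V' : damped U V -> damped U' V' -> damped (U + U') (V + V').
Proof.
move=> [e f] [e' f']; split=> [|Z].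
  by move: e e'; apply: ae_onW2 => x _ h h'; rewrite !componentD h h'.
rewrite (bilDr form_bilinear) f f' (bilDr (p_bilinear _ _)) (bilDr (G_bilinear _ _)); ring.
Qed.

Lemma dampedZ c U V : damped U V -> damped (c *: U) (c *: V).
Proof.
move=> [e f]; split=> [|Z].
  by move: e; apply: ae_onW => x _ h; rewrite !componentZ h.
rewrite (bilZr form_bilinear) f (bilZr (p_bilinear _ _)) (bilZr (G_bilinear _ _)); ring.
Qed.

(* With [w] and [v] the position and velocity of [U], the quadratic form is
   [|v - lam w|^2 + s0(w, w) + lam^2 |w|^2 + lam (g w, w)], chosen so that
   [Q(U, V) - lam Q(U, U) = - ((g + 2 lam) z, z)] for [z = v - lam w] along
   [damped U V]. *)
Definition growth_form (U V : X) := p vel vel U V - lam * (p vel pos U V + p pos vel U V)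
  + 2 * lam ^+ 2 * p pos pos U V + form U V + lam * G pos pos U V.

Lemma growth_form_bilinear : bounded_bilinear N growth_form.
Proof.
apply: bounded_bilinearD; last exact (bounded_bilinearZ _ (G_bilinear _ _)).
apply: bounded_bilinearD; last exact form_bilinear.
apply: bounded_bilinearD; last exact (bounded_bilinearZ _ (p_bilinear _ _)).
apply: bounded_bilinearD; first exact (p_bilinear _ _).
have -> : (fun u v => - (lam * (p vel pos u v + p pos vel u v))) =
  (fun u v => - lam * (p vel pos u v + p pos vel u v)).
  by apply/funext => u; apply/funext => v; rewrite mulNr.
by apply: bounded_bilinearZ; apply: bounded_bilinearD; exact (p_bilinear _ _).
Qed.

Lemma growth_formC U V : growth_form U V = growth_form V U.
Proof.
rewrite /growth_form formC (cpairC _ vel vel U V) (cpairC _ vel pos U V) (cpairC _ pos vel U V).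
by rewrite (cpairC (fun=> 1) pos pos U V) (cpairC g pos pos U V) (addrC (p pos vel V U)).
Qed.

Lemma growth_form_damped U V : damped U V -> growth_form U V <= lam * growth_form U U.
Proof.
move=> [e f]; rewrite -subr_ge0.
have eqp l W : p pos l V W = p vel l U W by exact: cpair_ae one_bounded e.
have eqG l W : G pos l V W = G vel l U W by exact: cpair_ae g_bounded e.
set h := fun x => cmp U vel x + - lam * cmp U pos x.
have mO := measurable_Omega oO.
have hz : sqint h.
  exact (@sqintD _ L R mu Omega mO _ _ (component_sqint U vel)
    (@sqintZ _ L R mu Omega mO (- lam) _ (component_sqint U pos))).
have gb : @ess_bounded _ L R mu Omega (`|2 * lam| + M) (fun x => 2 * lam + g x).
  have [mg hg] := g_bounded; split.
    by apply: measurable_funD => //; exact: measurable_cst.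
  move: hg; apply: ae_onW => x _ hg; apply: le_trans (ler_normD _ _) _.
  by rewrite lerD2l.
(* The number [((2 lam + g) z, z)], expanded in velocity and position, is exactly the difference to
   be shown nonnegative. *)
have := wpair_ge0 mO gb g_ge hz.
rewrite (wpairDw mO (ess_bounded_cst _ _ _) g_bounded hz hz) (wpair_cst mO _ hz hz).
rewrite /h (wpair_sqr mO _ one_bounded) ?(wpair_sqr mO _ g_bounded); try exact: component_sqint.
rewrite -!/(cpair _ _ _ U U).
have fVU := f V; have fUU := f U; rewrite (formC V U) eqp eqG in fVU.
rewrite (cpairC _ vel pos U U) (cpairC g vel pos U U).
rewrite /growth_form fVU fUU (cpairC _ vel pos U V) eqp (cpairC _ pos pos U V) eqp.
rewrite (cpairC g pos pos U V) eqG (cpairC _ vel pos U U) (cpairC g vel pos U U).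
move=> H; apply: le_trans H _; rewrite le_eqVlt; apply/orP; left; apply/eqP.
ring.
Qed.

Lemma cpair_le M' m k l U V : 0 <= M' -> @ess_bounded _ L R mu Omega M' m ->
  `|cpair m k l U V| <= M' * (N U * N V).
Proof.
move=> M'0 hm; have mO := measurable_Omega oO.
apply: le_trans (wpair_bound mO M'0 hm (component_sqint U k) (component_sqint V l)) _.
by rewrite ler_wpM2l// ler_pM ?sqrtr_ge0// component_norm_le.
Qed.

Let hip : semi_ip ip := energy_semi_ip b oO.

Definition growth_bound := `|1 - bmin Omega b| + M.

(** Testing the weak equation with [V] cancels the velocity pairing against the form. What remains
    is [(1 - bmin) (w, v) - (g v, v)], hence the constant. *)
Lemma damped_ip U V : damped U V -> ip U V <= growth_bound * ip U U.
Proof.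
move=> [e f].
have eqp l W : p pos l V W = p vel l U W by exact: cpair_ae one_bounded e.
have eqG l W : G pos l V W = G vel l U W by exact: cpair_ae g_bounded e.
have fVU := f V; rewrite (formC V U) eqp eqG in fVU.
rewrite form_ip fVU (cpairC _ pos pos U V) eqp -(sqr_ipnorm hip U).
have h1 := cpair_le vel pos U U (normr_ge0 1) one_bounded.
have h2 := cpair_le vel vel U U M_ge0 g_bounded.
apply: (@le_trans _ _ (`|1 - bmin Omega b| * `|p vel pos U U| + `|G vel vel U U|)).
  rewrite -normrM.
  have := ler_norm ((1 - bmin Omega b) * p vel pos U U); have := ler_norm (- G vel vel U U).
  rewrite normrN; lra.
rewrite /growth_bound mulrDl expr2 lerD// ler_wpM2l//.
by rewrite -[leRHS]mul1r -{2}(normr1 R).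
Qed.

(** Cauchy-Schwarz for [U] and [U - h V], divided by [N U]. *)
Lemma damped_dissipative (h : R) U V : 0 <= h -> damped U V ->
  (1 - h * growth_bound) * N U <= N (U - h *: V).
Proof.
move=> h0 A; have [->|NU] := eqVneq (N U) 0; first by rewrite mulr0 seminorm_ge0.
have NU0 : 0 < N U by rewrite lt_neqAle eq_sym NU seminorm_ge0.
rewrite -(ler_pM2r NU0) -mulrA -expr2.
apply: le_trans (le_trans (ler_norm _) (ip_CS hip _ _)).
rewrite (sqr_ipnorm hip) !(ipE hip) (ipC hip V U).
have := ler_wpM2l h0 (damped_ip A); lra.
Qed.

Lemma damped_closed U V :
  (forall e : R, 0 < e -> exists U' V', [/\ damped U' V', N (U - U') < e & N (V - V') < e]) ->
  damped U V.
Proof.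
have quarter (s t e : R) : s < e / 4 -> t < e / 4 -> 2 * (s + t) <= e by lra.
move=> hcl; have mO := measurable_Omega oO; split=> [|Z].
  pose h x := cmp V pos x + -1 * cmp U vel x.
  have hh : sqint h.
    exact (@sqintD _ L R mu Omega mO _ _ (component_sqint V pos)
      (@sqintZ _ L R mu Omega mO (-1) _ (component_sqint U vel))).
  suff /(pair_eq0_ae mO hh) : pair h h = 0.
    by apply: ae_onW => x _ /eqP; rewrite /h mulN1r subr_eq0 => /eqP.
  apply/eqP; rewrite eq_le pair_ge0// andbT; apply/ler_addgt0Pr => e e0; rewrite add0r.
  have [U' [V' [[e' _] hU hV]]] := hcl (Num.sqrt (e / 4)) ltac:(by rewrite sqrtr_gt0 divr_gt0).
  have hu := component_sqint (U - U') vel; have hv := component_sqint (V - V') pos.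
  apply: le_trans (pair_le_add mO hh hv hu _) _.
    move: e'; apply: ae_onW => x _ hx; rewrite (_ : h x = cmp (V - V') pos x - cmp (U - U') vel x).
      exact: ler_normB.
    by rewrite !componentB hx /h; ring.
  move: hU hV; rewrite /ipnorm !ltr_sqrt ?divr_gt0// => hU hV.
  exact: quarter (le_lt_trans (component_sq_le (V - V') pos) hV)
    (le_lt_trans (component_sq_le (U - U') vel) hU).
have [C1 C10 h1] := bil_bound form_bilinear.
have [C2 C20 h2] := bil_bound (p_bilinear pos vel).
have [C3 C30 h3] := bil_bound (G_bilinear pos vel).
apply/eqP; rewrite -subr_eq0 opprK -normr_le0; apply/ler_addgt0Pr => e e0; rewrite add0r.
set C := (C1 + C2 + C3) * N Z.
have C0 : 0 <= C by apply: mulr_ge0; [do 2 apply: addr_ge0 => //|exact: seminorm_ge0].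
have [U' [V' [[_ f'] hU hV]]] := hcl (e / (C + 1)) ltac:(by rewrite divr_gt0// ltr_wpDl).
have -> : form Z U + (p pos vel Z V + G pos vel Z U) =
   form Z (U - U') + (p pos vel Z (V - V') + G pos vel Z (U - U')).
  rewrite (bilDr form_bilinear) (bilNr form_bilinear) f'.
  rewrite (bilDr (p_bilinear _ _)) (bilNr (p_bilinear _ _)).
  by rewrite (bilDr (G_bilinear _ _)) (bilNr (G_bilinear _ _)); ring.
apply: le_trans (ler_normD _ _) _; apply: le_trans (lerD (h1 _ _) (ler_normD _ _)) _.
apply: le_trans (lerD (lexx _) (lerD (h2 _ _) (h3 _ _))) _.
apply: (@le_trans _ _ (C * (e / (C + 1)))).
  move: hU hV; set eta := e / (C + 1) => hU hV.
  rewrite (_ : C * eta = C1 * (N Z * eta) + (C2 * (N Z * eta) + C3 * (N Z * eta))); last first.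
    by rewrite /C; ring.
  by apply: lerD; [|apply: lerD]; rewrite ler_wpM2l// ler_wpM2l ?seminorm_ge0// ltW.
by rewrite mulrCA ger_pMr// ler_pdivrMr ?ltr_wpDl// mul1r lerDl ler01.
Qed.

(** * The resolvent equation *)

Section resolvent.
Variables (h : R) (F : X).
Hypothesis h_gt0 : 0 < h.
Hypothesis h_lt : h * (1 + growth_bound) < 1.

(* Eliminating the velocity from [U - h V = F] leaves the coercive problem
   [w + h g w + h^2 S0 w = h v_F + w_F + h g w_F] for the position [w]. *)
Let q (U V : X) := h ^+ 2 * form U V + (p pos pos U V + (h * G pos pos U V + p vel vel U V)).

Let q_bilinear : bounded_bilinear N q.
Proof.
apply: bounded_bilinearD; first exact (bounded_bilinearZ _ form_bilinear).
apply: bounded_bilinearD; first exact (p_bilinear _ _).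
apply: bounded_bilinearD; last exact (p_bilinear _ _).
exact (bounded_bilinearZ _ (G_bilinear _ _)).
Qed.

Let coercive_arith (be K pv pw G0 : R) : 0 <= K -> be <= K -> h * (1 + (K + M)) < 1 ->
  0 <= pv -> 0 <= pw -> - (M * pw) <= G0 ->
  0 <= (1 - h ^+ 2) * pv + (1 - h ^+ 2 * be) * pw + h * G0.
Proof.
have M0 := M_ge0; have h0 := h_gt0; move=> K0 bK hK pv0 pw0 G0M.
have hK0 : 0 <= h * (K + M) by rewrite mulr_ge0 ?addr_ge0// ltW.
have h1 : h < 1 by move: hK hK0; rewrite mulrDr mulr1; lra.
have hh : h ^+ 2 <= h by rewrite expr2 ger_pMr// ltW.
have e1 : h ^+ 2 * be <= h * K.
  apply: (@le_trans _ _ (h ^+ 2 * K)); first by rewrite ler_wpM2l// sqr_ge0.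
  by rewrite ler_wpM2r.
have e2 : - (h * M * pw) <= h * G0 by rewrite -mulrA -mulrN ler_wpM2l// ltW.
have e3 : 0 <= (1 - h ^+ 2) * pv by rewrite mulr_ge0// subr_ge0; lra.
have e4 : 0 <= (1 - h ^+ 2 * be - h * M) * pw.
  rewrite mulr_ge0//; move: hK; rewrite !mulrDr mulr1; lra.
move: e4; rewrite !mulrBl; lra.
Qed.

(** The form cancels in the difference, leaving [(1 - h^2) |v|^2 + (1 - h^2 (1 - bmin)) |w|^2 + h (g
    w, w)], which is nonnegative for small [h]. *)
Let q_coercive U : h ^+ 2 * ip U U <= q U U.
Proof.
rewrite -subr_ge0 form_ip /q.
have pv0 := pair_ge0 (measurable_Omega oO) (component_sqint U vel).
have pw0 := pair_ge0 (measurable_Omega oO) (component_sqint U pos).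
have sU := component_sqint U pos.
have Gb := wpair_bound (measurable_Omega oO) M_ge0 g_bounded sU sU.
rewrite -expr2 sqr_sqrtr// in Gb.
have GM : - (M * p pos pos U U) <= G pos pos U U.
  by move: Gb; rewrite ler_norml => /andP[].
have := coercive_arith (normr_ge0 (1 - bmin Omega b)) (ler_norm _) h_lt pv0 pw0 GM.
rewrite -/(cpair _ vel vel U U) -/(cpair _ pos pos U U).
by move=> H; apply: le_trans H _; rewrite le_eqVlt; apply/orP; left; apply/eqP; ring.
Qed.

Let q_semi_ip : semi_ip q.
Proof.
split.
- move=> U V; rewrite /q formC (cpairC _ vel vel U V) (cpairC _ pos pos U V).
  by rewrite (cpairC g pos pos U V).
- exact: (bilDl q_bilinear).
- exact: (bilZl q_bilinear).
- move=> U; apply: le_trans (q_coercive U).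
  by rewrite mulr_ge0 ?sqr_ge0// (ip_ge0 hip).
Qed.

Let energy_le_q U : N U <= h^-1 * ipnorm q U.
Proof.
rewrite mulrC ler_pdivlMr// mulrC /ipnorm -{1}(ger0_norm (ltW h_gt0)) -sqrtr_sqr.
by rewrite -sqrtrM ?sqr_ge0// ler_wsqrtr.
Qed.

Lemma damped_range : exists U V, damped U V /\ U - h *: V = F.
Proof.
have h0 : h != 0 by rewrite gt_eqF.
have qN := ipnorm_seminorm q_semi_ip.
pose l Z := h * p pos vel Z F + (p pos pos Z F + h * G pos pos Z F).
have l_bil : bounded_bilinear N (fun Z F => h * p pos vel Z F + (p pos pos Z F + h * G pos pos Z F)).
  apply: bounded_bilinearD; first exact (bounded_bilinearZ _ (p_bilinear _ _)).
  apply: bounded_bilinearD; first exact (p_bilinear _ _).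
  exact (bounded_bilinearZ _ (G_bilinear _ _)).
(* The norm of [q] is equivalent to [N], by boundedness on one side and [q_coercive] on the
   other. *)
have q_complete : geo_complete (ipnorm q).
  have [C C0 hC] := bil_bound q_bilinear.
  apply: (geo_complete_equiv qN hN (c := Num.sqrt C) (c' := h^-1)).
  - by rewrite invr_ge0 ltW.
  - move=> U; rewrite [leLHS]/ipnorm -(ger0_norm (seminorm_ge0 hN U)) -sqrtr_sqr -sqrtrM//.
    rewrite ler_wsqrtr//; apply: le_trans (ler_norm _) _; rewrite expr2; exact: hC.
  - exact: energy_le_q.
  - exact: energy_complete.
have [W hW] : exists W, forall Z, q W Z = l Z.
  have [C C0 hC] := bil_bound l_bil.
  apply: (riesz q_semi_ip (C := C * N F * h^-1)) => //.
  - by move=> U V; exact: (bilDl l_bil).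
  - by move=> c U; exact: (bilZl l_bil).
  move=> U; apply: le_trans (hC U F) _; rewrite -!mulrA ler_wpM2l// mulrC ler_wpM2l//.
  exact: seminorm_ge0.
have chi_sq : sqint (fun x => h^-1 * (cmp W pos x + -1 * cmp F pos x)).
  have mO := measurable_Omega oO.
  exact (@sqintZ _ L R mu Omega mO _ _ (@sqintD _ L R mu Omega mO _ _ (component_sqint W pos)
      (@sqintZ _ L R mu Omega mO (-1) _ (component_sqint F pos)))).
(* The Riesz vector supplies the position [w]; the position component of [U - h V = F] forces the
   velocity [(w - w_F) / h]. *)
have [U [Uv Uk]] := energy_set_velocity hb W chi_sq.
pose V := h^-1 *: (U - F); exists U, V; split; last first.
  by rewrite /V scalerA mulfV// scale1r opprB addrC subrK.
have Y : cmp U vel = cmp (h^-1 *: (W - F)) pos.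
  by rewrite Uv componentZ componentB; apply/funext => x; rewrite mulN1r.
have UY m k Z : bounded_bilinear N (cpair m k pos) ->
    cpair m k vel Z U = h^-1 * (cpair m k pos Z W - cpair m k pos Z F).
  by move=> hm; rewrite -(bilNr hm) -(bilDr hm) -(bilZr hm) /cpair Y.
split=> [|Z].
  apply: ae_onW g_ge => x _ _.
  by rewrite /V componentZ componentB Y componentZ componentB (Uk None).
(* A test vector with velocity 0 removes the velocity pairing, which [q] contains only to be
   coercive on whole states. *)
have [Z0 [Z0v Z0k]] := energy_set_velocity hb Z (sqint0 mu (measurable_Omega oO)).
have fZU : form Z U = form W Z0.
  by rewrite formC /form /cpair; congr (_ + _ + _); [apply: eq_bigr => j _| |];
    rewrite Uk Z0k.
have := hW Z0; rewrite /q /l -fZU [p vel vel W Z0](_ : _ = 0); last first.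
  by rewrite cpairC; apply: wpair_eq0 => x; rewrite Z0v.
rewrite (cpairC _ pos pos W Z0) (cpairC g pos pos W Z0).
have e m k W' : cpair m pos k Z0 W' = cpair m pos k Z W' by rewrite /cpair (Z0k None).
rewrite !e addr0 (UY g pos Z (G_bilinear _ _)).
rewrite /V (bilZr (p_bilinear _ _)) (bilDr (p_bilinear _ _)) (bilNr (p_bilinear _ _)).
rewrite (UY (fun=> 1) pos Z (p_bilinear _ _)).
move: (form _ _) (p _ _ _ _) (p _ _ _ _) (G _ _ _ _) (p _ _ _ _) (G _ _ _ _) => f s1 s2 s3 s4 s5 H.
have -> : f = (h * s2 + (s1 + h * s3) - (s4 + h * s5)) / h ^+ 2 by rewrite -H; field.
by field.
Qed.

End resolvent.

(** The derivative is explicit: position [c phi] and velocity [Delta phi - b phi - c g phi], square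
    integrable because [b] is bounded on the support of [phi]. *)
Lemma damped_test_state c phi : rtest Omega phi ->
  exists U V, damped U V /\ cmp U = state_fun Omega b (fun x => c * phi x) phi.
Proof.
move=> tphi; have mO := measurable_Omega oO.
have tc : rtest Omega (fun x => c * phi x).
  have := rtest_linear c tphi (rtest0 Omega); congr (rtest _ _).
  by apply/funext => x; rewrite addr0.
have sphi := rtest_sqint oO tphi; have sc := rtest_sqint oO tc.
have sl j : sqint (partial j (partial j phi)).
  exact (rtest_sqint oO (rtest_partial j (rtest_partial j tphi))).
have ssl : sqint (fun x => \sum_j partial j (partial j phi) x).
  exact (@sqint_sum _ L R mu Omega mO _ _ _ sl).
have sb := potential_sqint oO hb tphi.
have sg : sqint (fun x => g x * (c * phi x)) by exact (wpair_ess_bounded_sqint mO g_bounded sc).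
have sbg : sqint (fun x => b x * phi x + g x * (c * phi x)).
  exact (@sqintD _ L R mu Omega mO _ _ sb sg).
have sbg' : sqint (fun x => -1 * (b x * phi x + g x * (c * phi x))).
  exact (@sqintZ _ L R mu Omega mO (-1) _ sbg).
pose S x := \sum_j partial j (partial j phi) x + -1 * (b x * phi x + g x * (c * phi x)).
have sS : sqint S by exact (@sqintD _ L R mu Omega mO _ _ ssl sbg').
have [U hU] := energy_test_state oO hb sc tphi; have [V hV] := energy_test_state oO hb sS tc.
exists U, V; split => //; split=> [|Z].
  by apply: ae_onW g_ge => x _ _; rewrite hU hV.
have zw := component_sqint Z pos.
rewrite /form /cpair hU hV /=.
rewrite [pair _ S]wpairC (wpairDl mO one_bounded ssl sbg' zw) (wpairZl mO (-1) one_bounded sbg zw).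
rewrite (wpairDl mO one_bounded sb sg zw) (wpair_suml mO _ one_bounded sl zw).
rewrite [wpair g _ _]wpairC [wpair g _ _]wpair1.
have -> : \sum_j pair (partial j (partial j phi)) (cmp Z pos) =
    - \sum_j pair (cmp Z (gradient j)) (partial j phi).
  rewrite -sumrN; apply: eq_bigr => j _; rewrite wpairC.
  exact (energy_weak_derivative Z j (rtest_partial j tphi)).
(* The splitting [b = beta^2 + bmin] again, with one factor [beta] moved onto the position of [Z] by
   [energy_root_position]. *)
have -> : pair (fun x => b x * phi x) (cmp Z pos) =
    pair (cmp Z rpos) (fun x => root_weight Omega b x * phi x)
    + bmin Omega b * pair (cmp Z pos) phi.
  have sbm : sqint (fun x => b x * phi x + - bmin Omega b * phi x).
    exact (@sqintD _ L R mu Omega mO _ _ sb (@sqintZ _ L R mu Omega mO (- bmin Omega b) _ sphi)).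
  have srp := root_weight_sqint oO hb tphi; have zr := component_sqint Z rpos.
  have -> : pair (cmp Z rpos) (fun x => root_weight Omega b x * phi x) =
      pair (fun x => b x * phi x + - bmin Omega b * phi x) (cmp Z pos).
    rewrite !wpair1E; apply: (Rintegral_ae_eq mO).
    - exact: measurable_funM zr.1 srp.1.
    - exact: measurable_funM sbm.1 zw.1.
    move: (energy_root_position hb Z) b_ge; apply: ae_onW2 => x _ -> hbx.
    have rr : root_weight Omega b x ^+ 2 = b x - bmin Omega b.
      by rewrite sqr_sqrtr ?subr_ge0.
    by transitivity (root_weight Omega b x ^+ 2 * (cmp Z pos x * phi x)); [ring|rewrite rr; ring].
  have sbz := @sqintZ _ L R mu Omega mO (- bmin Omega b) _ sphi.
  rewrite (wpairDl mO one_bounded sb sbz zw) (wpairZl mO _ one_bounded sphi zw).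
  by rewrite [pair (cmp Z pos) phi]wpairC; ring.
ring.
Qed.

(** This is [s0(phi, phi)]. *)
Definition test_energy phi := \sum_j pair (partial j phi) (partial j phi)
  + pair (fun x => root_weight Omega b x * phi x) (fun x => root_weight Omega b x * phi x)
  + bmin Omega b * pair phi phi.

Lemma damped_instability phi : rtest Omega phi ->
  lam ^+ 2 * pair phi phi + test_energy phi + lam * wpair g phi phi < 0 ->
  exists u v : R -> X,
  [/\ forall t, 0 <= t -> damped (u t) (v t),
      forall T, exists2 K, 0 <= K & forall s t, 0 <= s -> s <= t -> t <= T ->
        N (u t - u s - (t - s) *: v s) <= K * (t - s) ^+ 2 /\
        N (v t - v s) <= K * (t - s) &
      forall C, exists2 T, 0 <= T & C < N (u T)].
Proof.
move=> tphi neg; have mO := measurable_Omega oO.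
have [U [V [A hU]]] := damped_test_state lam tphi.
have QU : growth_form U U < 0.
  apply: le_lt_trans neg; rewrite le_eqVlt; apply/orP; left; apply/eqP.
  have sphi := rtest_sqint oO tphi.
  have sl := @sqintZ _ L R mu Omega mO lam _ sphi.
  rewrite /growth_form /form /cpair hU /= (wpairZl mO lam one_bounded sphi sl).
  rewrite (wpairZl mO lam one_bounded sphi sphi) ![pair phi (fun x => _ * _)]wpairC.
  by rewrite (wpairZl mO lam one_bounded sphi sphi) /test_energy; ring.
have gb0 : 0 <= growth_bound by rewrite addr_ge0.
have [C C0 hC] := bil_bound growth_form_bilinear.
have h0 : 0 < (1 + growth_bound)^-1 by rewrite invr_gt0 ltr_wpDr.
have [|u [v [uA ue u0 uQ]]] := abstract_instability hN (@energy_complete _ _ _ b oO) dampedD dampedZ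
  gb0 damped_dissipative h0 _ damped_closed growth_formC (bilDl growth_form_bilinear)
  (bilZl growth_form_bilinear) hC lam_gt0 growth_form_damped A QU.
  move=> h F /andP[hh hlt]; apply: damped_range => //.
  by rewrite -ltr_pdivlMr ?div1r// ltr_wpDr.
exists u, v; split=> // D.
have NQ T : 0 <= T -> (1 + lam * T) * - growth_form (u 0) (u 0) <= C * N (u T) ^+ 2.
  move=> T0; have := hC (u T) (u T); rewrite -expr2 => /ler_normlP[h _].
  apply: le_trans h; rewrite mulrN lerN2; exact: uQ.
set k := - growth_form (u 0) (u 0) in NQ; have k0 : 0 < k by rewrite oppr_gt0.
(* At this time [(1 + lam * T) * k = k + C * D ^+ 2], which exceeds [C * N (u T) ^+ 2] as soon as
   [N (u T) <= D]. *)
set T := C * D ^+ 2 / (lam * k).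
have T0 : 0 <= T by apply: divr_ge0; rewrite mulr_ge0 ?sqr_ge0// ltW.
exists T => //.
rewrite ltNge; apply/negP => ND.
have := NQ T T0; rewrite leNgt => /negP; apply.
have -> : (1 + lam * T) * k = k + C * D ^+ 2.
  by rewrite /T; field; rewrite !gt_eqF.
apply: (@le_lt_trans _ _ (C * D ^+ 2)); last by rewrite ltrDr.
rewrite ler_wpM2l// lerXn2r ?nnegrE ?seminorm_ge0//.
by apply: le_trans ND; exact: seminorm_ge0.
Qed.

End damped_operator.

(** * Complex-valued functions and the form domain *)

Section complex_functions.
Context (R : realType) (n : nat) (Omega : set 'rV[R]_n).
Local Notation E := 'rV[R]_n.
Local Notation mu := (lebesgue R n).
Local Notation L := (lebesgue_space R n).
Local Notation sqint := (@sqint _ L R mu Omega).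
Local Notation pair := (@wpair _ L R mu Omega (fun=> 1)).
Local Notation wpair := (@wpair _ L R mu Omega).
Hypothesis oO : open Omega.
Let mO := measurable_Omega oO.
Implicit Types (u v : E -> R[i]) (f g : E -> R).

Definition re_fun u x : R := complex.Re (u x).
Definition im_fun u x : R := complex.Im (u x).
Definition real_fun f : E -> R[i] := fun x => ((f x)%:C)%C.
Local Notation re := re_fun.
Local Notation im := im_fun.

Lemma L2_sqint u : L2 Omega u <-> sqint (re u) /\ sqint (im u).
Proof. by rewrite (@sqint_sum_sqr _ L R mu Omega mO). Qed.

Lemma L2norm_pair u : L2 Omega u ->
  L2norm Omega u ^+ 2 = pair (re u) (re u) + pair (im u) (im u).
Proof.
move=> /L2_sqint[hr hi]; rewrite -(Rintegral_sum_sqr mO hr hi) /L2norm sqr_sqrtr//.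
by apply: Rintegral_ge0 => x _; rewrite addr_ge0 ?sqr_ge0.
Qed.

Lemma L2inner_pair u v : L2 Omega u -> L2 Omega v -> L2inner Omega u v =
  ((pair (re u) (re v) + pair (im u) (im v)) +i* (pair (re u) (im v) - pair (im u) (re v)))%C.
Proof.
move=> /L2_sqint[ur ui] /L2_sqint[vr vi]; have c1 := @ess_bounded_cst _ L R mu Omega 1.
rewrite /L2inner /cintegral; congr (_ +i* _)%C.
  rewrite -(RintegralD mO (wpair_integrable mO c1 ur vr) (wpair_integrable mO c1 ui vi)).
  apply: eq_Rintegral => x _; rewrite !mul1r /re /im.
  by case: (u x) (v x) => [a b] [c d] /=; ring.
rewrite -(RintegralB mO (wpair_integrable mO c1 ur vi) (wpair_integrable mO c1 ui vr)).
apply: eq_Rintegral => x _; rewrite !mul1r /re /im.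
by case: (u x) (v x) => [a b] [c d] /=; ring.
Qed.

Lemma cintegral_mul u v : L2 Omega u -> L2 Omega v -> cintegral Omega (fun x => u x * v x) =
  ((pair (re u) (re v) - pair (im u) (im v)) +i* (pair (re u) (im v) + pair (im u) (re v)))%C.
Proof.
move=> /L2_sqint[ur ui] /L2_sqint[vr vi]; have c1 := @ess_bounded_cst _ L R mu Omega 1.
rewrite /cintegral; congr (_ +i* _)%C.
  rewrite -(RintegralB mO (wpair_integrable mO c1 ur vr) (wpair_integrable mO c1 ui vi)).
  apply: eq_Rintegral => x _; rewrite !mul1r /re /im.
  by case: (u x) (v x) => [a b] [c d] /=; ring.
rewrite -(RintegralD mO (wpair_integrable mO c1 ur vi) (wpair_integrable mO c1 ui vr)).
apply: eq_Rintegral => x _; rewrite !mul1r /re /im.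
by case: (u x) (v x) => [a b] [c d] /=; ring.
Qed.

Lemma Cc_rtest phi : Cc_smooth Omega phi <-> rtest Omega (re phi) /\ rtest Omega (im phi).
Proof.
split=> [[sr si [K [cK KO fK]]]|[[sr [K [cK KO fK]]] [si [K' [cK' KO' fK']]]]].
  by split; split=> //; exists K; split=> // x /fK; rewrite /re /im => ->.
split => //; exists (K `|` K'); split; first exact: compactU.
  by move=> x [/KO|/KO'].
move=> x /not_orP[/fK + /fK']; rewrite /re /im.
by case: (phi x) => [a b] /= -> ->.
Qed.

Lemma Cc_L2 phi : Cc_smooth Omega phi -> L2 Omega phi.
Proof.
by move=> /Cc_rtest[tr ti]; apply/L2_sqint; split; [exact (rtest_sqint oO tr)|exact (rtest_sqint oO ti)].
Qed.

Lemma Cc_partial j phi : Cc_smooth Omega phi -> Cc_smooth Omega (cpartial j phi).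
Proof. by move=> /Cc_rtest[tr ti]; apply/Cc_rtest; split; exact: rtest_partial. Qed.

Lemma Cc_real f : rtest Omega f -> Cc_smooth Omega (real_fun f).
Proof. by move=> tf; apply/Cc_rtest; split => //; exact: rtest0. Qed.

Definition real_weak_partial j f g := forall phi, rtest Omega phi ->
  pair f (partial j phi) = - pair g phi.

Lemma pair0r f : pair f (fun=> 0) = 0.
Proof. by rewrite wpairC; apply: wpair_eq0. Qed.

(** The pairing in the definition is bilinear over the complex numbers, so real test functions are
    enough and the two parts of [u] separate. *)
Lemma is_weak_partialP j u v : L2 Omega u -> L2 Omega v ->
  is_weak_partial Omega j u v <->
  real_weak_partial j (re u) (re v) /\ real_weak_partial j (im u) (im v).
Proof.
move=> hu hv; split=> [h|[hr hi] phi cphi].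
  suff H phi : rtest Omega phi -> pair (re u) (partial j phi) = - pair (re v) phi /\
      pair (im u) (partial j phi) = - pair (im v) phi.
    by split=> phi /H[].
  move=> tphi; have cphi := Cc_real tphi.
  have := h _ cphi; rewrite (cintegral_mul hu (Cc_L2 (Cc_partial j cphi))).
  rewrite (cintegral_mul hv (Cc_L2 cphi)).
  rewrite [im (cpartial j _)](_ : _ = fun=> 0); last first.
    by apply/funext => x; rewrite /im /= /partial derive_cst.
  rewrite [im (real_fun _)](_ : _ = fun=> 0)// !pair0r !subr0 !add0r.
  by move=> [-> ->].
rewrite (cintegral_mul hu (Cc_L2 (Cc_partial j cphi))) (cintegral_mul hv (Cc_L2 cphi)).
have [tr ti] := (Cc_rtest phi).1 cphi.
rewrite (hr _ tr) (hr _ ti) (hi _ tr) (hi _ ti).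
by apply/eqP; rewrite eq_complex /= opprD opprK addrC opprD eqxx /=; apply/eqP; ring.
Qed.

Lemma real_weak_partialB j f f' g g' : sqint f -> sqint f' -> sqint g -> sqint g' ->
  real_weak_partial j f g -> real_weak_partial j f' g' ->
  real_weak_partial j (fun x => f x - f' x) (fun x => g x - g' x).
Proof.
move=> sf sf' sg sg' h h' phi tphi; have c1 := @ess_bounded_cst _ L R mu Omega 1.
have sphi := rtest_sqint oO tphi; have sj := rtest_sqint oO (rtest_partial j tphi).
by rewrite (wpairBl mO c1 sf sf' sj) (wpairBl mO c1 sg sg' sphi) h// h'// opprB opprK addrC.
Qed.

Lemma real_weak_partial_rtest j f : rtest Omega f -> real_weak_partial j f (partial j f).
Proof.
by move=> tf phi tphi; rewrite !wpair1E; exact (integration_by_parts oO j tf tphi).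
Qed.

Lemma real_weak_partial_unique j f g g' : sqint g -> sqint g' ->
  real_weak_partial j f g -> real_weak_partial j f g' -> ae_on Omega (fun x => g x = g' x).
Proof.
move=> hg hg' h h'; have c1 := @ess_bounded_cst _ L R mu Omega 1.
have hn := @sqintZ _ L R mu Omega mO (-1) _ hg'.
have hd := @sqintD _ L R mu Omega mO _ _ hg hn.
have := fundamental_lemma oO hd; rewrite -/(ae_on _ _) => H.
suff : ae_on Omega (fun x => g x + -1 * g' x = 0).
  by apply: ae_onW => x _ /eqP; rewrite mulN1r subr_eq0 => /eqP.
apply: H => phi tphi; have sphi := rtest_sqint oO tphi.
rewrite -wpair1E (wpairDl mO c1 hg hn sphi) (wpairZl mO (-1) c1 hg' sphi).
by rewrite -[pair g phi]opprK -h// h'//; ring.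
Qed.

End complex_functions.

(** * The form domain in terms of pairs of states *)

Section form_domain.
Context (R : realType) (n : nat) (Omega : set 'rV[R]_n) (b : 'rV[R]_n -> R).
Local Notation E := 'rV[R]_n.
Local Notation mu := (lebesgue R n).
Local Notation L := (lebesgue_space R n).
Local Notation sqint := (@sqint _ L R mu Omega).
Local Notation pair := (@wpair _ L R mu Omega (fun=> 1)).
Local Notation vel := (velocity n).
Local Notation pos := (position n).
Local Notation rpos := (root_position n).
Local Notation re := re_fun.
Local Notation im := im_fun.
Local Notation beta := (root_weight Omega b).
Hypothesis oO : open Omega.
Hypothesis hb : Linfty_loc Omega b.
Let mO := measurable_Omega oO.
Let c1 := @ess_bounded_cst _ L R mu Omega 1.

Local Notation X := (submodule (energy_submod_closed b oO)).
Local Notation cmp := (@component R n Omega b oO).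
Local Notation ip := (@energy_ip R n Omega b oO).
Local Notation N := (ipnorm ip).
Implicit Types (u v : E -> R[i]) (U V : X).

Lemma weak_partialP u j : H1 Omega u ->
  L2 Omega (weak_partial Omega j u) /\ is_weak_partial Omega j u (weak_partial Omega j u).
Proof.
move=> [_ /(_ j)[v hv hw]]; rewrite /weak_partial.
exact: (@xgetPex _ (fun=> 0) [set v | L2 Omega v /\ is_weak_partial Omega j u v] (ex_intro _ v (conj hv hw))).
Qed.

Lemma weak_partial_real u j : H1 Omega u ->
  [/\ sqint (re (weak_partial Omega j u)), sqint (im (weak_partial Omega j u)),
  real_weak_partial Omega j (re u) (re (weak_partial Omega j u)) &
  real_weak_partial Omega j (im u) (im (weak_partial Omega j u))].
Proof.
move=> hu; have [hw hp] := weak_partialP j hu; have [hr hi] := (L2_sqint oO _).1 hw.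
have [|w1 w2] := (is_weak_partialP oO j (proj1 hu) hw).1; first exact: hp.
by split.
Qed.

Lemma pair_ae_eq f f' : sqint f -> sqint f' -> ae_on Omega (fun x => f x = f' x) ->
  pair f f = pair f' f'.
Proof.
move=> hf hf' h; rewrite (wpair_ae_eq mO c1 hf hf' hf h) wpairC.
by rewrite (wpair_ae_eq mO c1 hf hf' hf' h).
Qed.

Section derivatives_given.
Variables (u : E -> R[i]) (gr gi : 'I_n -> E -> R).
Hypothesis (hr : sqint (re u)) (hi : sqint (im u)).
Hypothesis (sgr : forall j, sqint (gr j)) (sgi : forall j, sqint (gi j)).
Hypothesis hgr : forall j, real_weak_partial Omega j (re u) (gr j).
Hypothesis hgi : forall j, real_weak_partial Omega j (im u) (gi j).

Lemma H1_of_real : H1 Omega u.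
Proof.
have hu : L2 Omega u by apply/(L2_sqint oO); split.
split => // j; pose v x := (gr j x +i* gi j x)%C.
have hv : L2 Omega v by apply/(L2_sqint oO); split; [exact: sgr|exact: sgi].
by exists v => //; exact/(is_weak_partialP oO).
Qed.

(** The term [weak_partial] is a chosen representative; uniqueness of weak derivatives identifies it
    with any given one almost everywhere. *)
Lemma weak_partial_ae j :
  ae_on Omega (fun x => re (weak_partial Omega j u) x = gr j x) /\
  ae_on Omega (fun x => im (weak_partial Omega j u) x = gi j x).
Proof.
have [s1 s2 w1 w2] := weak_partial_real j H1_of_real.
split; [exact (real_weak_partial_unique oO s1 (sgr j) w1 (@hgr j))|].
exact (real_weak_partial_unique oO s2 (sgi j) w2 (@hgi j)).
Qed.

Lemma L2norm_weak_partial j :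
  L2norm Omega (weak_partial Omega j u) ^+ 2 = pair (gr j) (gr j) + pair (gi j) (gi j).
Proof.
have [s1 s2 w1 w2] := weak_partial_real j H1_of_real.
have [hw _] := weak_partialP j H1_of_real; have [e1 e2] := weak_partial_ae j.
by rewrite (L2norm_pair oO hw) (pair_ae_eq s1 (sgr j) e1) (pair_ae_eq s2 (sgi j) e2).
Qed.

Lemma weighted_re : re (weighted Omega b u) = fun x => beta x * re u x.
Proof. by apply/funext => x; rewrite /re /weighted; case: (u x) => a c /=; rewrite mul0r subr0. Qed.

Lemma weighted_im : im (weighted Omega b u) = fun x => beta x * im u x.
Proof. by apply/funext => x; rewrite /im /weighted; case: (u x) => a c /=; rewrite mul0r addr0. Qed.

Lemma s0norm_real : sqint (fun x => beta x * re u x) -> sqint (fun x => beta x * im u x) ->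
  s0norm Omega b u ^+ 2 =
  (\sum_j (pair (gr j) (gr j) + pair (gi j) (gi j)) + (pair (re u) (re u) + pair (im u) (im u)))
  + (pair (fun x => beta x * re u x) (fun x => beta x * re u x) +
     pair (fun x => beta x * im u x) (fun x => beta x * im u x)).
Proof.
move=> br bi; have hu : L2 Omega u by apply/(L2_sqint oO); split.
have hw : L2 Omega (weighted Omega b u).
  by apply/(L2_sqint oO); rewrite weighted_re weighted_im; split.
rewrite /s0norm sqr_sqrtr ?addr_ge0 ?sqr_ge0//.
rewrite (L2norm_pair oO hw) weighted_re weighted_im; congr (_ + _).
rewrite /H1norm sqr_sqrtr; last first.
  by rewrite addr_ge0 ?sqr_ge0// sumr_ge0// => j _; exact: sqr_ge0.
rewrite (L2norm_pair oO hu); congr (_ + _).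
by apply: eq_bigr => j _; exact: L2norm_weak_partial.
Qed.

End derivatives_given.
Definition position_energy U := \sum_k pair (cmp U (Some k)) (cmp U (Some k)).

Lemma energy_split U : ip U U = pair (cmp U vel) (cmp U vel) + position_energy U.
Proof. by rewrite energy_ipE sum_option. Qed.

Lemma position_energyE U : position_energy U =
  \sum_j pair (cmp U (gradient j)) (cmp U (gradient j)) + pair (cmp U pos) (cmp U pos)
  + pair (cmp U rpos) (cmp U rpos).
Proof. by rewrite /position_energy !sum_option addrA addrC addrA. Qed.

Lemma position_energy_le U : position_energy U <= ip U U.
Proof. by rewrite energy_split lerDr; exact (pair_ge0 mO (component_sqint U vel)). Qed.

Lemma root_position_sqint U : sqint (fun x => beta x * cmp U pos x).
Proof.
have h := energy_root_position hb U; have sr := component_sqint U rpos.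
have mr : measurable_fun (Omega : set L) (fun x : L => beta x * cmp U pos x).
  apply: measurable_funM; first exact (root_weight_measurable hb).
  exact (component_sqint U pos).1.
by apply: (sqint_ae_eq mO mr sr); apply: ae_onW h => x _ ->.
Qed.

Section state_given.
Variables (u : E -> R[i]) (U V : X).
Hypothesis (hU : re u = cmp U pos) (hV : im u = cmp V pos).

Let hr : sqint (re u). Proof. by rewrite hU; exact: component_sqint. Qed.
Let hi : sqint (im u). Proof. by rewrite hV; exact: component_sqint. Qed.
Let hgr j : real_weak_partial Omega j (re u) (cmp U (gradient j)).
Proof. by rewrite hU => phi tphi; exact: energy_weak_derivative. Qed.
Let hgi j : real_weak_partial Omega j (im u) (cmp V (gradient j)).
Proof. by rewrite hV => phi tphi; exact: energy_weak_derivative. Qed.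

Lemma state_weak_partial j : L2 Omega (weak_partial Omega j u) /\
  (ae_on Omega (fun x => re (weak_partial Omega j u) x = cmp U (gradient j) x) /\
  ae_on Omega (fun x => im (weak_partial Omega j u) x = cmp V (gradient j) x)).
Proof.
have sU k := component_sqint U (gradient k); have sV k := component_sqint V (gradient k).
have hH := H1_of_real hr hi sU sV hgr hgi.
split; first by have [] := weak_partialP j hH.
exact: (weak_partial_ae hr hi sU sV hgr hgi j).
Qed.

Lemma s0norm_state : s0norm Omega b u ^+ 2 = position_energy U + position_energy V.
Proof.
have sU k := component_sqint U (gradient k); have sV k := component_sqint V (gradient k).
have bU := root_position_sqint U; have bV := root_position_sqint V.
rewrite (s0norm_real hr hi sU sV hgr hgi) ?hU ?hV//.
rewrite !position_energyE big_split /=.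
have sym (f g : E -> R) : ae_on Omega (fun x => f x = g x) -> ae_on Omega (fun x => g x = f x).
  by apply: ae_onW => x _ ->.
rewrite (pair_ae_eq bU (component_sqint U rpos) (sym _ _ (energy_root_position hb U))).
rewrite (pair_ae_eq bV (component_sqint V rpos) (sym _ _ (energy_root_position hb V))).
ring.
Qed.

Lemma H1_state : H1 Omega u.
Proof.
have sU k := component_sqint U (gradient k); have sV k := component_sqint V (gradient k).
exact (H1_of_real hr hi sU sV hgr hgi).
Qed.

Lemma weighted_state : L2 Omega (weighted Omega b u).
Proof.
apply/(L2_sqint oO); rewrite weighted_re weighted_im hU hV.
by split; exact: root_position_sqint.
Qed.

Lemma s0norm_state_lt e : N U < e -> N V < e -> s0norm Omega b u < 2 * e.
Proof.
move=> lU lV; have hip := energy_semi_ip b oO.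
have e0 : 0 < e by apply: le_lt_trans lU; exact: sqrtr_ge0.
have sq W : N W < e -> position_energy W <= e ^+ 2.
  move=> lW; apply: le_trans (position_energy_le W) _.
  by rewrite -(sqr_ipnorm hip) lerXn2r ?nnegrE ?sqrtr_ge0 ?ltW.
rewrite -(@ltr_pXn2r _ 2)// ?nnegrE ?sqrtr_ge0 ?mulr_ge0 ?ltW//.
rewrite s0norm_state; apply: le_lt_trans (lerD (sq _ lU) (sq _ lV)) _.
by have : 0 < e ^+ 2; [rewrite exprn_gt0|rewrite exprMn; lra].
Qed.

End state_given.

(** Real and imaginary part are positions of two separate states, whose approximating test functions
    combine into a complex one. *)
Lemma dom_s0_state u U V : re u = cmp U pos -> im u = cmp V pos -> dom_s0 Omega b u.
Proof.
move=> hU hV.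
split; [exact: H1_state hU hV|exact: weighted_state hU hV|move=> e e0].
have [U' [chi [phi [tphi hU' lU]]]] := energy_approx U (e := e / 2) ltac:(by rewrite divr_gt0).
have [V' [chi' [psi [tpsi hV' lV]]]] := energy_approx V (e := e / 2) ltac:(by rewrite divr_gt0).
exists (fun x => (phi x +i* psi x)%C); first exact/Cc_rtest.
rewrite (_ : e = 2 * (e / 2)); last by field.
apply: (s0norm_state_lt (U := U - U') (V := V - V')) lU lV.
  rewrite componentB hU' -hU; apply/funext => x /=.
  by rewrite /re /=; case: (u x).
rewrite componentB hV' -hV; apply/funext => x /=.
by rewrite /im /=; case: (u x).
Qed.

(** The converse is needed because [is_S0] quantifies over all complex elements of the form
    domain. *)
Lemma dom_s0_states u : dom_s0 Omega b u ->
  exists U V, re u = cmp U pos /\ im u = cmp V pos.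
Proof.
move=> [hH hw happ]; have [hu _] := hH; have [ur ui] := (L2_sqint oO u).1 hu.
have [] := (L2_sqint oO _).1 hw; rewrite weighted_re weighted_im => bur bui.
pose st (f : E -> R) (g : 'I_n -> E -> R) (k : state_index n) : E -> R := match k with
  | None => fun=> 0 | Some None => f | Some (Some None) => fun x => beta x * f x
  | Some (Some (Some j)) => g j end.
pose fr := st (re u) (fun j => re (weak_partial Omega j u)).
pose fi := st (im u) (fun j => im (weak_partial Omega j u)).
pose gap (f : state_index n -> E -> R) phi := \sum_(k : option (option 'I_n))
  pair (fun x => f (Some k) x - state_fun Omega b (f None) phi (Some k) x)
       (fun x => f (Some k) x - state_fun Omega b (f None) phi (Some k) x).
have add6 (s1 s2 s3 s4 s5 s6 : R) :
  s1 + s2 + (s3 + s4) + (s5 + s6) = s1 + s3 + s5 + (s2 + s4 + s6) by ring.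
have gapE f g phi : gap (st f g) phi =
    \sum_j pair (fun x => g j x - partial j phi x) (fun x => g j x - partial j phi x)
    + pair (fun x => f x - phi x) (fun x => f x - phi x)
    + pair (fun x => beta x * f x - beta x * phi x) (fun x => beta x * f x - beta x * phi x).
  by rewrite /gap !sum_option addrA addrC addrA.
have sr k : sqint (fr k).
  case: k => [[[j|]|]|]; [by have [] := weak_partial_real j hH|exact: bur|exact: ur|].
  exact (sqint0 mu mO).
have si k : sqint (fi k).
  case: k => [[[j|]|]|]; [by have [] := weak_partial_real j hH|exact: bui|exact: ui|].
  exact (sqint0 mu mO).
have gap_ge0 f phi : (forall k, sqint (f k)) -> rtest Omega phi -> 0 <= gap f phi.
  move=> sf tphi; apply: sumr_ge0 => k _; apply: (pair_ge0 mO).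
  exact (sqintB mO (sf _) (test_state_sqint oO hb (Some k) (sf None) tphi)).
(* The squared form norm of [u - phi] is the sum of the gaps of the real and the imaginary part, so
   one complex approximation makes both small. *)
have key (e : R) : 0 < e -> exists phi psi, [/\ rtest Omega phi, rtest Omega psi &
    gap fr phi + gap fi psi < e].
  move=> e0; have [phi cphi lphi] := happ (Num.sqrt e) ltac:(by rewrite sqrtr_gt0).
  have [tr ti] := (Cc_rtest Omega phi).1 cphi; exists (re phi), (im phi); split => //.
  have <- : s0norm Omega b (u \- phi) ^+ 2 = gap fr (re phi) + gap fi (im phi).
    have sphr := rtest_sqint oO tr; have sphi := rtest_sqint oO ti.
    have rw : re (u \- phi) = fun x => re u x - re phi x.
      by apply/funext => x; rewrite /re /=; case: (u x) (phi x) => [? ?] [? ?].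
    have iw : im (u \- phi) = fun x => im u x - im phi x.
      by apply/funext => x; rewrite /im /=; case: (u x) (phi x) => [? ?] [? ?].
    have brw : (fun x => beta x * re (u \- phi) x) = fun x => beta x * re u x - beta x * re phi x.
      by rewrite rw; apply/funext => x; rewrite mulrBr.
    have biw : (fun x => beta x * im (u \- phi) x) = fun x => beta x * im u x - beta x * im phi x.
      by rewrite iw; apply/funext => x; rewrite mulrBr.
    have sj j := rtest_sqint oO (rtest_partial j tr).
    have sj' j := rtest_sqint oO (rtest_partial j ti).
    have wj j := weak_partial_real j hH.
    rewrite (@s0norm_real (u \- phi)
      (fun j x => re (weak_partial Omega j u) x - partial j (re phi) x)
      (fun j x => im (weak_partial Omega j u) x - partial j (im phi) x)).
    - rewrite brw biw rw iw !gapE big_split.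
      exact: add6.
    - by rewrite rw; exact (sqintB mO ur sphr).
    - by rewrite iw; exact (sqintB mO ui sphi).
    - by move=> j; have [w1 _ _ _] := wj j; exact (sqintB mO w1 (sj j)).
    - by move=> j; have [_ w1 _ _] := wj j; exact (sqintB mO w1 (sj' j)).
    - move=> j; have [w1 _ w2 _] := wj j; rewrite rw.
      exact (real_weak_partialB oO ur sphr w1 (sj j) w2 (real_weak_partial_rtest oO j tr)).
    - move=> j; have [_ w1 _ w2] := wj j; rewrite iw.
      exact (real_weak_partialB oO ui sphi w1 (sj' j) w2 (real_weak_partial_rtest oO j ti)).
    - by rewrite brw; exact (sqintB mO bur (root_weight_sqint oO hb tr)).
    - by rewrite biw; exact (sqintB mO bui (root_weight_sqint oO hb ti)).
  rewrite -[ltRHS](sqr_sqrtr (ltW e0)) ltr_pXn2r// nnegrE sqrtr_ge0//.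
have [U hU] : exists U, cmp U = fr.
  apply: (energy_state oO hb sr) => e e0; have [phi [psi [tphi tpsi l]]] := key e e0.
  by exists phi => //; apply: le_lt_trans l; rewrite lerDl gap_ge0.
have [V hV] : exists V, cmp V = fi.
  apply: (energy_state oO hb si) => e e0; have [phi [psi [tphi tpsi l]]] := key e e0.
  by exists psi => //; apply: le_lt_trans l; rewrite lerDr gap_ge0.
by exists U, V; rewrite hU hV.
Qed.

End form_domain.

(** * The operator associated with the form, on real positions *)

Section form_operator.
Context (R : realType) (n : nat) (Omega : set 'rV[R]_n) (b : 'rV[R]_n -> R).
Local Notation E := 'rV[R]_n.
Local Notation mu := (lebesgue R n).
Local Notation L := (lebesgue_space R n).
Local Notation sqint := (@sqint _ L R mu Omega).
Local Notation pair := (@wpair _ L R mu Omega (fun=> 1)).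
Local Notation vel := (velocity n).
Local Notation pos := (position n).
Local Notation rpos := (root_position n).
Local Notation re := re_fun.
Local Notation im := im_fun.
Local Notation beta := (root_weight Omega b).
Hypothesis oO : open Omega.
Hypothesis hb : Linfty_loc Omega b.
Hypothesis b_ge : ae_on Omega (fun x => bmin Omega b <= b x).
Let mO := measurable_Omega oO.
Let c1 := @ess_bounded_cst _ L R mu Omega 1.

Local Notation X := (submodule (energy_submod_closed b oO)).
Local Notation cmp := (@component R n Omega b oO).
Local Notation form := (@energy_form R n Omega b oO).
Implicit Types (u v : E -> R[i]) (U V Z : X) (f g : E -> R).

Lemma pair0l f : pair (fun=> 0) f = 0. Proof. exact: wpair_eq0. Qed.

Lemma component0 k : cmp 0 k = fun=> 0.
Proof. by rewrite -(scale0r (0 : X)) componentZ; apply/funext => x; rewrite mul0r. Qed.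

Lemma re_real f : re (real_fun f) = f. Proof. by []. Qed.

Lemma im_real f : im (real_fun f) = fun=> 0. Proof. by []. Qed.

Lemma im_real_state f : im (real_fun f) = cmp 0 pos. Proof. by rewrite component0. Qed.

Lemma L2_real f : sqint f -> L2 Omega (real_fun f).
Proof. by move=> sf; apply/(L2_sqint oO); split => //; exact (sqint0 mu mO). Qed.

Lemma L2norm_real f : sqint f -> L2norm Omega (real_fun f) = Num.sqrt (pair f f).
Proof.
move=> sf; rewrite -[LHS]ger0_norm ?sqrtr_ge0// -sqrtr_sqr (L2norm_pair oO (L2_real sf)).
by rewrite re_real im_real pair0r addr0.
Qed.

Lemma pair_ae2 f f' g g' : sqint f -> sqint f' -> sqint g -> sqint g' ->
  ae_on Omega (fun x => f x = f' x) -> ae_on Omega (fun x => g x = g' x) -> pair f g = pair f' g'.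
Proof.
move=> sf sf' sg sg' ff gg; rewrite (wpair_ae_eq mO c1 sf sf' sg ff) wpairC.
by rewrite (wpair_ae_eq mO c1 sg sg' sf' gg) wpairC.
Qed.

(** The function [b w] need not be square integrable for a position [w], so the integrand is
    rewritten as a whole, almost everywhere. *)
Lemma potential_pair Z U : \int[mu]_(x in Omega) (cmp Z pos x * (b x * cmp U pos x)) =
  pair (cmp Z rpos) (cmp U rpos) + bmin Omega b * pair (cmp Z pos) (cmp U pos).
Proof.
have zp := component_sqint Z pos; have up := component_sqint U pos.
have zr := component_sqint Z rpos; have ur := component_sqint U rpos.
have sz := sqintZ mO (bmin Omega b) zp.
rewrite -(wpairZl mO (bmin Omega b) c1 zp up).
rewrite /wpair -(RintegralD mO (wpair_integrable mO c1 zr ur) (wpair_integrable mO c1 sz up)).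
apply: (Rintegral_ae_eq mO).
- by have [mb _] := hb; exact: measurable_funM zp.1 (measurable_funM mb up.1).
- exact (measurable_funD (wpair_measurable c1 zr ur) (wpair_measurable c1 sz up)).
move: (energy_root_position hb Z) (energy_root_position hb U) => hz hu.
have hzu := ae_onW2 (fun x _ h h' => conj h h') hz hu.
move: hzu b_ge; apply: ae_onW2 => x _ [-> ->] bx.
have rr : beta x ^+ 2 = b x - bmin Omega b by rewrite sqr_sqrtr ?subr_ge0.
transitivity (beta x ^+ 2 * (cmp Z pos x * cmp U pos x) + bmin Omega b * cmp Z pos x * cmp U pos x).
  by rewrite rr; ring.
ring.
Qed.

Lemma sum_complex (I : Type) (s : seq I) (F G : I -> R) :
  \sum_(i <- s) (F i +i* G i)%C = ((\sum_(i <- s) F i) +i* (\sum_(i <- s) G i))%C.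
Proof. by elim: s => [|i s ih]; rewrite ?big_nil ?big_cons ?ih. Qed.

Lemma s0_state phi Y Z U : re phi = cmp Y pos -> im phi = cmp Z pos ->
  s0 Omega b phi (real_fun (cmp U pos)) = (form Y U +i* (- form Z U))%C.
Proof.
move=> hY hZ; rewrite /s0.
have eY k := component_sqint Y k; have eZ k := component_sqint Z k; have eU k := component_sqint U k.
have grad j : L2inner Omega (weak_partial Omega j phi) (weak_partial Omega j (real_fun (cmp U pos)))
  = (pair (cmp Y (gradient j)) (cmp U (gradient j)) +i* - pair (cmp Z (gradient j)) (cmp U (gradient j)))%C.
  have [l1 [r1 i1]] := state_weak_partial hY hZ j.
  have [l2 [r2 i2]] := state_weak_partial (re_real (cmp U pos)) (im_real_state (cmp U pos)) j.
  have [lr1 li1] := (L2_sqint oO _).1 l1; have [lr2 li2] := (L2_sqint oO _).1 l2.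
  have s00 := component_sqint (0 : X) (gradient j).
  rewrite (L2inner_pair oO l1 l2).
  rewrite (pair_ae2 lr1 (eY _) lr2 (eU _) r1 r2) (pair_ae2 li1 (eZ _) li2 s00 i1 i2).
  rewrite (pair_ae2 lr1 (eY _) li2 s00 r1 i2) (pair_ae2 li1 (eZ _) lr2 (eU _) i1 r2).
  by rewrite component0 !pair0r addr0 sub0r.
under eq_bigr do rewrite grad.
rewrite sum_complex /L2inner /cintegral.
rewrite [X in _ + (X +i* _)%C](_ : _ = pair (cmp Y rpos) (cmp U rpos) + bmin Omega b * pair (cmp Y pos) (cmp U pos)); last first.
  rewrite -potential_pair; apply: eq_Rintegral => x _; rewrite -hY /re.
  by case: (phi x) => y z /=; ring.
(* The conjugation of the first argument is carried by the state [- Z]. *)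
rewrite [X in _ + (_ +i* X)%C](_ : _ = pair (cmp (- Z) rpos) (cmp U rpos) + bmin Omega b * pair (cmp (- Z) pos) (cmp U pos)); last first.
  rewrite -potential_pair; apply: eq_Rintegral => x _; rewrite componentN -hZ /im.
  by case: (phi x) => y z /=; ring.
have neg k : pair (cmp (- Z) k) (cmp U k) = - pair (cmp Z k) (cmp U k).
  by have h := p_bilinear b oO k k; exact: (bilNl h Z U).
rewrite !neg; apply/eqP; rewrite eq_complex /= /energy_form /cpair.
rewrite addrA eqxx /= sumrN mulrN -!opprD addrA; exact/eqP.
Qed.

Lemma is_S0_state U f : sqint f -> (forall Z, form Z U = pair (cmp Z pos) f) ->
  is_S0 Omega b (real_fun (cmp U pos)) (real_fun f).
Proof.
move=> sf h; split=> [|phi /(dom_s0_states oO hb)[Y [Z [hY hZ]]]]; first exact: L2_real.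
have lphi : L2 Omega phi by apply/(L2_sqint oO); rewrite hY hZ; split; exact: component_sqint.
rewrite (s0_state U hY hZ) (L2inner_pair oO lphi (L2_real sf)) hY hZ re_real im_real !pair0r.
by rewrite addr0 sub0r !h.
Qed.

(** [S0] is a chosen representative. Testing against real test functions identifies both of its
    parts through [fundamental_lemma]. *)
Lemma S0_state U f : sqint f -> (forall Z, form Z U = pair (cmp Z pos) f) ->
  [/\ L2 Omega (S0 Omega b (real_fun (cmp U pos))),
    ae_on Omega (fun x => re (S0 Omega b (real_fun (cmp U pos))) x = f x) &
    ae_on Omega (fun x => im (S0 Omega b (real_fun (cmp U pos))) x = 0)].
Proof.
move=> sf h; have hf := is_S0_state sf h.
have : is_S0 Omega b (real_fun (cmp U pos)) (S0 Omega b (real_fun (cmp U pos))).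
  by rewrite /S0; exact: (@xgetPex _ (fun=> 0) (is_S0 Omega b (real_fun (cmp U pos))) (ex_intro _ _ hf)).
set g := S0 _ _ _ => -[lg hg]; have [gr gi] := (L2_sqint oO g).1 lg.
have test phi : rtest Omega phi -> pair phi (re g) = pair phi f /\ pair phi (im g) = 0.
  move=> tphi; have sphi := rtest_sqint oO tphi.
  have [Y hY] := energy_test_state oO hb sphi tphi.
  have hre : re (real_fun phi) = cmp Y pos by rewrite hY.
  have dphi := dom_s0_state hb hre (im_real_state phi).
  have := hg _ dphi; rewrite (hf.2 _ dphi) (L2inner_pair oO (L2_real sphi) lg).
  rewrite (L2inner_pair oO (L2_real sphi) (L2_real sf)) !im_real !re_real.
  rewrite !pair0l !pair0r !addr0 !subr0.
  by move=> [-> ->].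
split=> //.
  have sd := sqintB mO gr sf.
  have := fundamental_lemma oO sd; rewrite -/(ae_on _ _) => H.
  suff : ae_on Omega (fun x => re g x - f x = 0).
    by apply: ae_onW => x _ /eqP; rewrite subr_eq0 => /eqP.
  apply: H => phi tphi; have sphi := rtest_sqint oO tphi.
  by rewrite -wpair1E (wpairBl mO c1 gr sf sphi) ![pair _ phi]wpairC (test phi tphi).1 subrr.
have := fundamental_lemma oO gi; apply => phi tphi.
by rewrite -wpair1E wpairC; exact: (test phi tphi).2.
Qed.

End form_operator.

(** * Solutions *)

Section lipschitz_curves.
Context (R : realType) (X : lmodType R) (N : X -> R) (u v : R -> X).
Hypothesis hN : seminorm N.
Hypothesis u_diff : forall T, exists2 K, 0 <= K & forall s t,
  0 <= s -> s <= t -> t <= T ->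
        N (u t - u s - (t - s) *: v s) <= K * (t - s) ^+ 2 /\
        N (v t - v s) <= K * (t - s).

(** The forward Taylor estimate becomes two-sided, as convergence at an interior time requires. *)
Lemma curve_lipschitz T : exists2 K, 0 <= K & forall s t, 0 <= s <= T -> 0 <= t <= T ->
  [/\ N (u t - u s) <= K * `|t - s|, N (v t - v s) <= K * `|t - s| &
      N (u t - u s - (t - s) *: v s) <= K * `|t - s| ^+ 2].
Proof.
have [K0 K00 hK] := u_diff T.
have [T0|T0] := leP 0 T; last first.
  by exists 0 => // s t /andP[s0 sT]; have := le_lt_trans (le_trans s0 sT) T0; rewrite ltxx.
pose B := N (v 0) + K0 * T.
have B0 : 0 <= B by rewrite addr_ge0 ?mulr_ge0 ?seminorm_ge0.
have vB s : 0 <= s <= T -> N (v s) <= B.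
  move=> /andP[s0 sT]; apply: le_trans (seminorm_le hN (v 0) _) _; rewrite lerD2l.
  by apply: le_trans (hK 0 s _ s0 sT).2 _; rewrite // subr0 ler_wpM2l.
pose K := 2 * K0 + K0 * T + B.
have KT : 0 <= K0 * T by rewrite mulr_ge0.
have KK0 : K0 <= K by rewrite /K; lra.
have K2 : 2 * K0 <= K by rewrite /K; lra.
have KB : K0 * T + B <= K by rewrite /K; lra.
have K0' : 0 <= K by apply: le_trans KK0.
have fwd s t : 0 <= s -> s <= t -> t <= T -> N (u t - u s) <= K * (t - s).
  move=> s0 st tT; have [h1 h2] := hK s t s0 st tT.
  have ts0 : 0 <= t - s by rewrite subr_ge0.
  rewrite -(subrK ((t - s) *: v s) (u t - u s)); apply: le_trans (seminormD hN _ _) _.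
  rewrite (seminormZ hN) ger0_norm//; apply: (@le_trans _ _ ((K0 * T + B) * (t - s))); last first.
    by rewrite ler_wpM2r.
  rewrite [leRHS]mulrDl; apply: lerD.
    apply: le_trans h1 _; rewrite expr2 mulrA ler_wpM2r// ler_wpM2l//; lra.
  by rewrite mulrC ler_wpM2r// vB// s0 (le_trans st).
exists K => // s t /andP[s0 sT] /andP[t0 tT]; have [st|/ltW ts] := leP s t.
  have ts0 : 0 <= t - s by rewrite subr_ge0.
  have [h1 h2] := hK s t s0 st tT; rewrite ger0_norm//; split; first exact: fwd.
    by apply: le_trans h2 _; rewrite ler_wpM2r.
  by apply: le_trans h1 _; rewrite ler_wpM2r ?sqr_ge0.
have ts0 : 0 <= s - t by rewrite subr_ge0.
have [h1 h2] := hK t s t0 ts sT; rewrite distrC ger0_norm// (seminorm_distC hN (u t) (u s)) (seminorm_distC hN (v t) (v s)).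
split; first exact: fwd.
  by apply: le_trans h2 _; rewrite ler_wpM2r.
(* The expansion at the right endpoint [s] is the one at the left endpoint [t] plus the increment of
   the velocity times the elapsed time. *)
have -> : u t - u s - (t - s) *: v s =
   - (u s - u t - (s - t) *: v t) - (s - t) *: (v t - v s).
  have -> : (t - s) *: v s = - ((s - t) *: v s) by rewrite -scaleNr opprB.
  by rewrite opprK scalerBr !opprB [RHS]addrC subrKA addrC.
apply: le_trans (seminormB hN _ _) _; rewrite seminormN// seminormZ// ger0_norm//.
apply: (@le_trans _ _ (2 * K0 * (s - t) ^+ 2)); last by rewrite ler_wpM2r ?sqr_ge0.
rewrite -mulrA mulr_natl mulr2n; apply: lerD; first exact: h1.
by rewrite expr2 mulrCA ler_wpM2l// (seminorm_distC hN).
Qed.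

End lipschitz_curves.

Lemma cvg0_lipschitz (R : realType) (F : set_system R) (f : R -> R) (t0 K : R) :
  Filter F -> F --> t0 -> 0 <= K -> (\forall t \near F, `|f t| <= K * `|t - t0|) ->
  f t @[t --> F] --> (0 : R).
Proof.
move=> FF Ft K0 hf; apply/cvgr0Pnorm_le => e e0.
have eK : 0 < e / (K + 1) by rewrite divr_gt0// ltr_wpDl.
have : \forall t \near F, `|t - t0| <= e / (K + 1).
  apply: Ft; apply: filterS (nbhsx_ballx t0 _ eK) => t.
  by rewrite /ball /= distrC => /ltW.
move: hf; apply: filterS2 => t h1 h2; apply: le_trans h1 _.
apply: le_trans (ler_wpM2l K0 h2) _.
by rewrite mulrCA ger_pMr// ler_pdivrMr ?ltr_wpDl// mul1r lerDl ler01.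
Qed.

Lemma graph_norm_arith (R : realType) (M x y A p v gu uu : R) : 0 <= M -> 0 <= x -> 0 <= y ->
  A <= 2 * (v + gu) -> gu <= M ^+ 2 * uu -> p <= x ^+ 2 -> v <= y ^+ 2 ->
  M ^+ 2 * uu <= M ^+ 2 * x ^+ 2 -> p + A <= ((2 + 2 * M) * (x + y)) ^+ 2.
Proof.
move=> M0 x0 y0 h1 h2 h3 h4 h5.
apply: (@le_trans _ _ (x ^+ 2 + 2 * y ^+ 2 + 2 * (M ^+ 2 * x ^+ 2))); first by lra.
rewrite -subr_ge0.
rewrite (_ : _ - _ = 3 * x ^+ 2 + 2 * y ^+ 2 + 8 * (x * y) + 8 * M * (x + y) ^+ 2
  + 4 * M ^+ 2 * (x * y *+ 2 + y ^+ 2) + 2 * (M ^+ 2 * x ^+ 2)); last by ring.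
by do !(apply: addr_ge0 || apply: mulr_ge0 || apply: mulrn_wge0 || exact: sqr_ge0 || exact: ler0n) => //.
Qed.

Section damped_solution.
Context (R : realType) (n : nat) (Omega : set 'rV[R]_n) (b : 'rV[R]_n -> R).
Local Notation E := 'rV[R]_n.
Local Notation mu := (lebesgue R n).
Local Notation L := (lebesgue_space R n).
Local Notation sqint := (@sqint _ L R mu Omega).
Local Notation pair := (@wpair _ L R mu Omega (fun=> 1)).
Local Notation vel := (velocity n).
Local Notation pos := (position n).
Hypothesis oO : open Omega.
Hypothesis hb : Linfty_loc Omega b.
Hypothesis b_ge : ae_on Omega (fun x => bmin Omega b <= b x).
Let mO := measurable_Omega oO.
Let c1 := @ess_bounded_cst _ L R mu Omega 1.

Local Notation X := (submodule (energy_submod_closed b oO)).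
Local Notation cmp := (@component R n Omega b oO).
Local Notation form := (@energy_form R n Omega b oO).
Local Notation ip := (@energy_ip R n Omega b oO).
Local Notation N := (ipnorm ip).
Variables (g : E -> R) (M : R).
Hypothesis M_ge0 : 0 <= M.
Hypothesis g_bounded : @ess_bounded _ L R mu Omega M g.
Local Notation damped := (@damped R n Omega b oO g).
Implicit Types (U V Z : X).

Let hN : seminorm N := energy_seminorm b oO.

Definition real_part U (k : state_index n) : E -> R[i] := real_fun (cmp U k).
Local Notation rp := real_part.

Lemma real_partB U V k : rp U k \- rp V k = rp (U - V) k.
Proof.
apply/funext => x; rewrite /real_part /real_fun componentB.
by apply/eqP; rewrite eq_complex /= subrr !eqxx.
Qed.

Lemma real_part_quotient (c : R) U V W k l :
  (fun x => (c%:C)%C * (rp U k x - rp V k x) - rp W l x) =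
  real_fun (fun x => c * (cmp U k x - cmp V k x) - cmp W l x).
Proof.
apply/funext => x; rewrite /real_part /real_fun.
by apply/eqP; rewrite eq_complex /=; apply/andP; split; apply/eqP; ring.
Qed.

Lemma component_quotient (c : R) U V W k :
  cmp (c *: (U - V) - W) k = fun x => c * (cmp U k x - cmp V k x) - cmp W k x.
Proof. by rewrite componentB componentZ componentB. Qed.

Lemma s0norm_sqr U : s0norm Omega b (rp U pos) ^+ 2 = position_energy U.
Proof.
rewrite (s0norm_state hb (re_real (cmp U pos)) (im_real_state b oO (cmp U pos))).
by rewrite [position_energy 0]big1 ?addr0// => k _; rewrite component0 pair0r.
Qed.

Lemma s0norm_le U : s0norm Omega b (rp U pos) <= N U.
Proof.
rewrite -(@ler_pXn2r _ 2)// ?nnegrE ?sqrtr_ge0// s0norm_sqr (sqr_ipnorm (energy_semi_ip b oO)).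
exact: position_energy_le.
Qed.

Lemma L2norm_le U k : L2norm Omega (rp U k) <= N U.
Proof. by rewrite (L2norm_real oO (component_sqint U k)); exact: component_norm_le. Qed.

(** The value that the wave equation prescribes for [S0] at the position of [U]: minus the
    acceleration, minus the damping term. *)
Definition damping_rhs U V x := -1 * (cmp V vel x + g x * cmp U vel x).

Lemma damping_rhs_sqint U V : sqint (damping_rhs U V).
Proof.
exact (sqintZ mO (-1) (sqintD mO (component_sqint V vel)
  (wpair_ess_bounded_sqint mO g_bounded (component_sqint U vel)))).
Qed.

Lemma damped_form U V : damped U V -> forall Z, form Z U = pair (cmp Z pos) (damping_rhs U V).
Proof.
move=> [_ h] Z; rewrite h wpairC /damping_rhs.
have sV := component_sqint V vel; have sU := component_sqint U vel; have sZ := component_sqint Z pos.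
have sgU := wpair_ess_bounded_sqint mO g_bounded sU.
rewrite (wpairZl mO (-1) c1 (sqintD mO sV sgU) sZ) (wpairDl mO c1 sV sgU sZ) mulN1r -wpair1.
by congr (- (_ + _)); exact: wpairC.
Qed.

Lemma damped_dom_S0 U V : damped U V -> dom_S0 Omega b (rp U pos).
Proof.
move=> h; split; first exact (dom_s0_state hb (re_real (cmp U pos)) (im_real_state b oO (cmp U pos))).
exists (real_fun (damping_rhs U V)).
exact (is_S0_state hb b_ge (damping_rhs_sqint U V) (damped_form h)).
Qed.

(** By the equation, [S0] at the position is controlled by [V] and by the velocity of [U].
    Continuity in the graph norm thus follows from the Lipschitz bounds for both curves. *)
Lemma S0norm_le U V : damped U V -> S0norm Omega b (rp U pos) <= (2 + 2 * M) * (N U + N V).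
Proof.
move=> h.
have [lS rS iS] := S0_state hb b_ge (damping_rhs_sqint U V) (damped_form h).
have [gr gi] := (L2_sqint oO _).1 lS; have sr := damping_rhs_sqint U V.
have sp := component_sqint U pos; have sV := component_sqint V vel; have sU := component_sqint U vel.
have sgU := wpair_ess_bounded_sqint mO g_bounded sU.
have hip := energy_semi_ip b oO.
rewrite -(@ler_pXn2r _ 2)// ?nnegrE ?sqrtr_ge0//; last first.
  by rewrite mulr_ge0 ?addr_ge0 ?mulr_ge0 ?sqrtr_ge0.
rewrite sqr_sqrtr ?addr_ge0 ?sqr_ge0// (L2norm_pair oO lS) (L2norm_pair oO (L2_real oO sp)).
rewrite re_real im_real pair0r addr0 (pair_ae_eq oO gr sr rS).
rewrite (pair_ae_eq oO gi (sqint0 mu mO) iS) pair0r addr0.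
have h1 : pair (damping_rhs U V) (damping_rhs U V) <= 2 * (pair (cmp V vel) (cmp V vel)
    + pair (fun x => g x * cmp U vel x) (fun x => g x * cmp U vel x)).
  apply: (pair_le_add mO sr sV sgU); apply: aeW => x _.
  by rewrite /damping_rhs mulN1r normrN; exact: ler_normD.
have h2 := pair_mul_le mO g_bounded sU.
have h3 := component_sq_le U pos; have h4 := component_sq_le V vel.
have h5 := component_sq_le U vel.
rewrite -(sqr_ipnorm hip U) in h3 h5; rewrite -(sqr_ipnorm hip V) in h4.
have h6 := ler_wpM2l (sqr_ge0 M) h5.
have M0 := M_ge0; have U0 := seminorm_ge0 hN U; have V0 := seminorm_ge0 hN V.
exact (graph_norm_arith M0 U0 V0 h1 h2 h3 h4 h6).
Qed.

Lemma damped_equation U V (alpha : R) (a : E -> R) : (forall x, g x = alpha * a x) -> damped U V ->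
  ae_on Omega (fun x => rp V vel x + ((alpha * a x)%:C)%C * rp V pos x + S0 Omega b (rp U pos) x = 0).
Proof.
move=> ga h; have [e _] := h.
have [lS rS iS] := S0_state hb b_ge (damping_rhs_sqint U V) (damped_form h).
have ri := ae_onW2 (fun x _ h h' => conj h h') rS iS.
move: e ri; apply: ae_onW2 => x _ e [r i].
rewrite /real_part /real_fun e -ga; move: r i; rewrite /re_fun /im_fun /damping_rhs.
case: (S0 _ _ _ _) => y z /= -> ->.
by apply/eqP; rewrite eq_complex /=; apply/andP; split; apply/eqP; ring.
Qed.

Section curve.
Variables (u v : R -> X).
Hypothesis u_damped : forall t, 0 <= t -> damped (u t) (v t).
Hypothesis u_diff : forall T, exists2 K, 0 <= K & forall s t,
  0 <= s -> s <= t -> t <= T ->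
        N (u t - u s - (t - s) *: v s) <= K * (t - s) ^+ 2 /\
        N (v t - v s) <= K * (t - s).

Lemma local_lipschitz t0 : 0 <= t0 -> exists2 K, 0 <= K & forall t, 0 <= t -> `|t - t0| < 1 ->
  [/\ N (u t - u t0) <= K * `|t - t0|, N (v t - v t0) <= K * `|t - t0| &
      t != t0 -> N ((t - t0)^-1 *: (u t - u t0) - v t0) <= K * `|t - t0|].
Proof.
move=> t00; have [K K0 hK] := curve_lipschitz hN u_diff (t0 + 1); exists K => // t tp tt.
have [||h1 h2 h3] := hK t0 t.
- by rewrite t00 lerDl ler01.
- by rewrite tp -lerBlDl (le_trans (ler_norm _))// ltW.
split; [exact: h1|exact: h2|move=> tne]; have d0 : t - t0 != 0 by rewrite subr_eq0.
rewrite -[v t0](scalerK d0) -scalerBr (seminormZ hN) normfV.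
by rewrite ler_pdivrMl ?normr_gt0// mulrCA -expr2.
Qed.

Lemma C0_curve_real (D : set (E -> R[i])) (NN : (E -> R[i]) -> R) (w : R -> X) k :
  (forall f, 0 <= NN f) -> (forall t, 0 <= t -> D (rp (w t) k)) ->
  (forall t0, 0 <= t0 -> exists2 K, 0 <= K & forall t, 0 <= t -> `|t - t0| < 1 ->
    NN (rp (w t - w t0) k) <= K * `|t - t0|) ->
  C0_curve D NN (fun t => rp (w t) k).
Proof.
move=> NN0 hD hK; split=> // t0 t00; have [K K0 h] := hK t0 t00.
apply: (cvg0_lipschitz (K := K)) => //; first exact: cvg_within.
apply: filterS (nbhsx_ballx t0 _ ltr01) => t; rewrite /ball /= distrC => tt tp.
by rewrite real_partB ger0_norm ?NN0// h.
Qed.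

Lemma curve_derivative_real (NN : (E -> R[i]) -> R) (w w' : R -> X) k :
  (forall f, 0 <= NN f) ->
  (forall t0, 0 <= t0 -> exists2 K, 0 <= K & forall t, 0 <= t -> `|t - t0| < 1 -> t != t0 ->
    NN (rp ((t - t0)^-1 *: (w t - w t0) - w' t0) k) <= K * `|t - t0|) ->
  is_curve_derivative NN (fun t => rp (w t) k) (fun t => rp (w' t) k).
Proof.
move=> NN0 hK t0 t00; have [K K0 h] := hK t0 t00.
apply: (cvg0_lipschitz (K := K)) => //.
  by apply: cvg_trans (cvg_within _) _; exact: cvg_within.
apply: filterS (nbhsx_ballx t0 _ ltr01) => t; rewrite /ball /= distrC => tt tne tp.
by rewrite real_part_quotient -component_quotient ger0_norm ?NN0// h//; apply/eqP.
Qed.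

Let psi t := rp (u t) pos.
Let psit t := rp (v t) pos.
Let psitt t := rp (v t) vel.

Lemma solution_C0_S0 : C0_curve (dom_S0 Omega b) (S0norm Omega b) psi.
Proof.
apply: C0_curve_real => [f|t t0|t0 t00]; first exact: sqrtr_ge0.
  exact: damped_dom_S0 (u_damped t0).
have [K K0 hK] := local_lipschitz t00.
exists ((2 + 2 * M) * (K + K)); first by rewrite mulr_ge0 ?addr_ge0 ?mulr_ge0.
move=> t tp tt; have [h1 h2 _] := hK t tp tt.
have hd : damped (u t - u t0) (v t - v t0).
  have := dampedD M_ge0 g_bounded (u_damped tp) (dampedZ M_ge0 g_bounded (-1) (u_damped t00)).
  by rewrite !scaleN1r.
apply: le_trans (S0norm_le hd) _; rewrite -mulrA ler_wpM2l ?addr_ge0 ?mulr_ge0//.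
by rewrite mulrDl lerD.
Qed.

Lemma solution_C0 (D : set (E -> R[i])) (NN : (E -> R[i]) -> R) k : (forall f, 0 <= NN f) ->
  (forall U, D (rp U k)) -> (forall U, NN (rp U k) <= N U) ->
  [/\ C0_curve D NN (fun t => rp (u t) k), C0_curve D NN (fun t => rp (v t) k) &
      is_curve_derivative NN (fun t => rp (u t) k) (fun t => rp (v t) k)].
Proof.
move=> NN0 hD hNN; split.
- apply: C0_curve_real => // t0 /local_lipschitz[K K0 hK]; exists K => // t tp tt.
  by have [h _ _] := hK t tp tt; exact: le_trans (hNN _) h.
- apply: C0_curve_real => // t0 /local_lipschitz[K K0 hK]; exists K => // t tp tt.
  by have [_ h _] := hK t tp tt; exact: le_trans (hNN _) h.
apply: curve_derivative_real => // t0 /local_lipschitz[K K0 hK]; exists K => // t tp tt tne.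
by have [_ _ h] := hK t tp tt; exact: le_trans (hNN _) (h tne).
Qed.

(** The curve [v] is only known to be Lipschitz. Its position equals the velocity of [u] almost
    everywhere, and that component of [u] is differentiable, with derivative the velocity of [v]. *)
Lemma solution_velocity_derivative : is_curve_derivative (L2norm Omega) psit psitt.
Proof.
move=> t0 t00; have [_ _ /(_ t0 t00)] := @solution_C0 (L2 Omega) (L2norm Omega) vel
  (fun f => sqrtr_ge0 _) (fun U => L2_real oO (component_sqint U vel)) (L2norm_le^~ vel).
apply: cvg_trans; apply: near_eq_cvg.
apply: filterS (@filterT _ (nbhs t0) _) => t _ tne tp.
rewrite /psit /psitt !real_part_quotient.
have sq k : sqint (fun x => (t - t0)^-1 * (cmp (v t) k x - cmp (v t0) k x) - cmp (v t0) vel x).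
  exact (sqintB mO (sqintZ mO (t - t0)^-1 (sqintB mO (component_sqint (v t) k)
    (component_sqint (v t0) k))) (component_sqint (v t0) vel)).
have squ := component_sqint ((t - t0)^-1 *: (u t - u t0) - v t0) vel.
rewrite component_quotient in squ.
rewrite (L2norm_real oO squ) (L2norm_real oO (sq pos)).
congr (Num.sqrt _); apply: (pair_ae_eq oO squ (sq pos)).
have [e _] := u_damped tp; have [e0 _] := u_damped t00.
by move: e e0; apply: ae_onW2 => x _ -> ->.
Qed.

Lemma damped_curve_solution alpha a : (forall x, g x = alpha * a x) ->
  solution Omega a b alpha (psi 0) (psit 0) psi psit.
Proof.
move=> ga; split; first exact: solution_C0_S0.
split.
  have [h1 h2 h3] := @solution_C0 (dom_s0 Omega b) (s0norm Omega b) pos (fun f => sqrtr_ge0 _)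
    (fun U => dom_s0_state hb (re_real (cmp U pos)) (im_real_state b oO (cmp U pos))) s0norm_le.
  exact (And3 h1 h2 h3).
have L2k k U := L2_real oO (component_sqint U k).
have [h1 h2 h3] := @solution_C0 (L2 Omega) (L2norm Omega) pos (fun f => sqrtr_ge0 _)
  (L2k pos) (L2norm_le^~ pos).
have [k1 k2 k3] := @solution_C0 (L2 Omega) (L2norm Omega) vel (fun f => sqrtr_ge0 _)
  (L2k vel) (L2norm_le^~ vel).
exists psitt; split.
- exact (And3 h1 h2 h3).
- exact (And3 h2 k2 solution_velocity_derivative).
- by move=> t tp; exact: (damped_equation ga (u_damped tp)).
- exact: aeW.
- exact: aeW.
Qed.

Lemma energy_curve t : 0 <= t -> energy Omega b psi psit t = N (u t) ^+ 2.
Proof.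
move=> tp; rewrite /energy s0norm_sqr (sqr_ipnorm (energy_semi_ip b oO)) energy_split.
rewrite addrC (L2norm_pair oO (L2_real oO (component_sqint (v t) pos))) re_real im_real pair0r addr0.
congr (_ + _); apply: (pair_ae_eq oO (component_sqint _ _) (component_sqint _ _)).
by have [] := u_damped tp.
Qed.

End curve.

End damped_solution.

Unset Implicit Arguments.

Theorem theorem1 (R : realType) (d : nat) (Omega : set 'rV[R]_d)
    (a b : 'rV[R]_d -> R) :
  (1 <= d)%N -> Omega !=set0 -> open Omega -> connected Omega ->
  Linfty Omega a -> Linfty_loc Omega b ->
  (-oo < ess_inf_on Omega b)%E ->
  (ess_inf_on Omega a < 0)%E ->
  exists2 alpha0 : R, 0 < alpha0 &
    forall alpha : R, alpha0 < alpha ->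
      exists phi1 phi2 : 'rV[R]_d -> R[i],
        [/\ dom_S0 Omega b phi1, dom_s0 Omega b phi2 &
          exists psi psit : R -> 'rV[R]_d -> R[i],
            solution Omega a b alpha phi1 phi2 psi psit /\
            ereal_sup [set (energy Omega b psi psit t)%:E | t in [set t | 0 <= t]]
              = +oo%E].

Proof.
move=> _ _ oO _ ha hb hbm ham.
have b_ge := bmin_le hbm; have mO := measurable_Omega oO.
have [M M0 [ma hM]] := Linfty_ess_bounded ha.
(* Here [- m] is the essential infimum of [a]. Any fraction strictly between 1/2 and 1 would do for
   3/4: it leaves [a + m / 2 <= - m / 4] on a set that is not null. *)
have [m m0 [a_ge a_not]] : exists2 m : R, 0 < m & ae_on Omega (fun x => - m <= a x) /\
    ~ ae_on Omega (fun x => - (3 / 4 * m) < a x).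
  have lb (c : R) : ae_on Omega (fun x => c <= a x) -> (c%:E <= ess_inf_on Omega a)%E.
    move=> h; apply/ess_infP; move: h.
    apply: (@filterS _ (almost_everywhere (lebesgue R d)) _) => x h.
    by case: ifPn => [/set_mem/h|]; rewrite ?lee_fin ?leey.
  (* Boundedness of [a] excludes an infinite essential infimum. *)
  have hMb : ((- M)%:E <= ess_inf_on Omega a)%E.
    by apply: lb; move: hM; apply: ae_onW => x _ /ler_normlP[]; rewrite lerNl.
  have ub := @ess_inf_le _ _ R (lebesgue R d) (fun x => if x \in Omega then (a x)%:E else +oo%E).
  have ham' : (ess_inf_on Omega a < 0)%E := ham.
  move: ham' hMb lb ub; rewrite -/(ess_inf_on Omega a).
  case: (ess_inf_on Omega a) => [r| |]; [|by []|by rewrite leeNy_eq].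
  rewrite lte_fin => r0 _ lb ub; exists (- r); first by rewrite oppr_gt0.
  rewrite opprK; split.
    move: ub; apply: (@filterS _ (almost_everywhere (lebesgue R d)) _) => x + Ox.
    by rewrite mem_set.
  move=> h; have := lb (- (3 / 4 * - r)); rewrite lee_fin => H.
  have : - (3 / 4 * - r) <= r by apply: H; move: h; apply: ae_onW => x _ /ltW.
  lra.
pose f x := a x + m / 2.
have f_meas : Lmeasurable Omega f by apply: measurable_funD => //; exact: measurable_cst.
have fb : ae_on Omega (fun x => `|f x| <= M + m / 2).
  move: hM; apply: ae_onW => x _ h; apply: le_trans (ler_normD _ _) _.
  by rewrite lerD// ger0_norm// divr_ge0// ltW.
have [||phi tphi neg] := @negative_test _ _ _ oO f (M + m / 2) (m / 4) f_meas fb.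
- by rewrite divr_gt0.
- move=> h; apply: a_not; move: h; apply: ae_onW => x _; rewrite /f; lra.
set I := \int[_]_(_ in _) _ in neg.
set T := test_energy Omega b phi.
have kap : 0 < - (m / 2 * I) by rewrite -mulrN mulr_gt0 ?divr_gt0// oppr_gt0.
(* The form equals [T - alpha^2 * - (m / 2 * I)] on the chosen data. The second bound gives
   [T < alpha * - (m / 2 * I)], and [alpha > 1] allows replacing [alpha] by its square. *)
exists (Num.max 1 (T / - (m / 2 * I))); first by rewrite lt_max ltr01.
move=> alpha; rewrite gt_max => /andP[al1 alT].
have al0 : 0 < alpha by apply: lt_trans al1.
pose g x := alpha * a x.
have g_bounded : ess_bounded (lebesgue R d) Omega (alpha * M) g.
  split; first by apply: measurable_funM => //; exact: measurable_cst.
  move: hM; apply: ae_onW => x _ h.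
  by rewrite normrM (gtr0_norm al0) ler_wpM2l// ltW.
have aM0 : 0 <= alpha * M by rewrite mulr_ge0// ltW.
pose lam := alpha * (m / 2).
have lam0 : 0 < lam by rewrite mulr_gt0 ?divr_gt0.
have g_ge : ae_on Omega (fun x => 0 <= 2 * lam + g x).
  move: a_ge; apply: ae_onW => x _ h; rewrite (_ : _ + _ = alpha * (m + a x)).
    by rewrite mulr_ge0 ?(ltW al0)// -lerBlDl sub0r.
  by rewrite /lam /g; field.
have sphi := rtest_sqint oO tphi.
have a_bounded : ess_bounded (lebesgue R d) Omega M a by split.
have IE : I = wpair (lebesgue R d) Omega a phi phi
    + m / 2 * wpair (lebesgue R d) Omega (fun=> 1) phi phi.
  rewrite -(wpair_cst mO (m / 2) sphi sphi).
  rewrite -(wpairDw mO a_bounded (ess_bounded_cst _ _ _) sphi sphi).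
  by apply: eq_Rintegral => x _; rewrite expr2 mulrA.
have negQ : lam ^+ 2 * wpair (lebesgue R d) Omega (fun=> 1) phi phi + T
    + lam * wpair (lebesgue R d) Omega g phi phi < 0.
  rewrite (wpairZw mO alpha a_bounded sphi sphi).
  rewrite (_ : _ + _ = T - alpha ^+ 2 * - (m / 2 * I)); last by rewrite IE /lam; ring.
  rewrite subr_lt0; apply: (@lt_le_trans _ _ (alpha * - (m / 2 * I))).
    by rewrite -ltr_pdivrMr.
  by rewrite ler_wpM2r ?(ltW kap)// expr2 ler_peMl// ltW.
have [u [v [uA ud ugrow]]] :=
  damped_instability oO hb b_ge aM0 g_bounded lam0 g_ge tphi negQ.
have sol := damped_curve_solution hb b_ge aM0 g_bounded uA ud (fun x => erefl (g x)).
exists (real_part (u 0) (position d)), (real_part (v 0) (position d)); split.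
- exact (damped_dom_S0 hb b_ge g_bounded (uA 0 (lexx 0))).
- exact (dom_s0_state hb (re_real (component (v 0) (position d)))
    (im_real_state b oO (component (v 0) (position d)))).
exists (fun t => real_part (u t) (position d)), (fun t => real_part (v t) (position d)).
split; first exact: sol.
(* The energy is the square of [N (u t)]; making the norm exceed 1 as well keeps the square above
   [A]. *)
apply/eqyP => A A0; have [t t0 ht] := ugrow (Num.max A 1).
apply: ereal_sup_ge; exists (energy Omega b (fun t => real_part (u t) (position d))
   (fun t => real_part (v t) (position d)) t)%:E; first by exists t.
rewrite lee_fin (energy_curve hb uA t0).
move: ht; rewrite gt_max => /andP[hA h1].
apply: le_trans (ltW hA) _; rewrite expr2 ler_peMl// ltW//.
by apply: lt_trans h1.
Qed.
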